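(* Let $\Omega \in \mathcal{S}$. Then the map $$\varepsilon = (\varepsilon_n)_{n \geq 1} : \mathrm{Iso}(\Omega) \longrightarrow \{\pm 1\}^{\mathbb{N}}$$ is an injective group homomorphism. Consequently $\mathrm{Iso}(\Omega)$ is abelian of exponent at most $2$, and there exists an integer $0 \leq k \leq d$ with $\mathrm{Iso}(\Omega) \cong (\mathbb{Z}/2\mathbb{Z})^k$. In particular $\#\mathrm{Iso}(\Omega) \leq 2^d$.
   Context: Let $d\ge2$, $m\ge3$ be integers and $D\subset\mathbb{R}^d$ a bounded connected open set of class $C^m$. $\mathcal{O}^m(D)$ is the set of domains $f(D)$, where $f$ ranges over the $C^m$-diffeomorphisms of $\mathbb{R}^d$ such that $f-\mathrm{id}$ and all its derivatives of order at most $m$ tend to $0$ at infinity. For $\Omega\in\mathcal{O}^m(D)$, $0<\lambda_1(\Omega)\le\lambda_2(\Omega)\le\cdots$ are the eigenvalues (with multiplicity) of the Dirichlet Laplacian $-\Delta$ on $\Omega$, and $\mathcal{S}$ is the set of $\Omega\in\mathcal{O}^m(D)$ for which every $\lambda_n(\Omega)$, $n\ge1$, is simple. $\mathrm{Iso}(\Omega) := \{ S \in \mathrm{Isom}(\mathbb{R}^d) : S(\Omega)=\Omega\}$, where $\mathrm{Isom}(\mathbb{R}^d)$ is the group of Euclidean isometries $x\mapsto Ax+c$, $A\in O_d(\mathbb{R})$, $c\in\mathbb{R}^d$. For $\Omega\in\mathcal{S}$ let $\varphi_n$ be a real $L^2(\Omega)$-normalized Dirichlet eigenfunction for $\lambda_n(\Omega)$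 (unique up to sign). For $S\in\mathrm{Iso}(\Omega)$, $\varphi_n\circ S$ is again a real $L^2$-normalized eigenfunction for $\lambda_n(\Omega)$, and $\varepsilon_n(S)\in\{\pm1\}$ is the unique sign with $\varphi_n\circ S=\varepsilon_n(S)\,\varphi_n$; it does not depend on the choice of sign of $\varphi_n$. *)

(* Defs.v *)
From HB Require Import structures.
From mathcomp Require Import all_boot all_order all_algebra.
From mathcomp Require Import all_classical all_reals all_analysis.
Import Order.TTheory GRing.Theory Num.Theory.
Import numFieldNormedType.Exports.

Set Implicit Arguments.
Unset Strict Implicit.
Unset Printing Implicit Defensive.

Local Open Scope classical_set_scope.
Local Open Scope ring_scope.

(* The sigma-algebra put on ['rV[R]_d] is the product of the Borel ones, i.e.
   the Borel sigma-algebra of R^d. *)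

Fact rV_display : measure_display.
Proof. exact: default_measure_display. Qed.

Section measurable_rV.
Context (R : realType) (d : nat).

Let coords : 'I_d -> 'rV[R]_d -> R := fun i x => x ord0 i.

Let rV_set0 : g_sigma_preimage coords set0.
Proof. exact: sigma_algebra0. Qed.

Let rV_setC A : g_sigma_preimage coords A -> g_sigma_preimage coords (~` A).
Proof. exact: sigma_algebraC. Qed.

Let rV_bigcup (F : _^nat) : (forall i, g_sigma_preimage coords (F i)) ->
  g_sigma_preimage coords (\bigcup_i (F i)).
Proof. exact: sigma_algebra_bigcup. Qed.

HB.instance Definition _ := @isMeasurable.Build rV_display
  'rV[R]_d (g_sigma_preimage coords) rV_set0 rV_setC rV_bigcup.

Lemma measurable_coord (i : 'I_d) :
  measurable_fun [set: 'rV[R]_d] (fun x : 'rV[R]_d => x ord0 i).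
Proof.
move=> _ Y mY; rewrite setTI; apply: sub_sigma_algebra => /=.
rewrite -bigcup_seq/=; exists i => /=; first by rewrite mem_index_enum.
by exists Y => //; rewrite setTI.
Qed.

Lemma measurable_fun_rVP d1 (T : measurableType d1) (f : T -> 'rV[R]_d) :
  (forall i, measurable_fun [set: T] (fun x => f x ord0 i)) ->
  measurable_fun [set: T] f.
Proof.
move=> mf.
have : g_sigma_preimage (fun i => coords i \o f) `<=` measurable.
  apply: smallest_sub; first exact: sigma_algebra_measurable.
  rewrite -bigcup_seq/= => A [i _ [B mB <-]].
  exact: mf.
by rewrite g_sigma_preimage_comp => prefS _ A mA; apply: prefS; exists A.
Qed.

End measurable_rV.

Section cons_rV.
Context (R : realType) (d : nat).

Definition cons_rV (p : R * 'rV[R]_d) : 'rV[R]_d.+1 :=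
  \row_i (if unlift ord0 i is Some j then p.2 ord0 j else p.1).

Definition uncons_rV (x : 'rV[R]_d.+1) : R * 'rV[R]_d :=
  (x ord0 ord0, \row_j x ord0 (lift ord0 j)).

Lemma cons_rV0 p : cons_rV p ord0 ord0 = p.1.
Proof. by rewrite mxE unlift_none. Qed.

Lemma cons_rVS p j : cons_rV p ord0 (lift ord0 j) = p.2 ord0 j.
Proof. by rewrite mxE liftK. Qed.

Lemma cons_rVK : cancel cons_rV uncons_rV.
Proof.
move=> [t x]; rewrite /uncons_rV cons_rV0; congr pair.
by apply/rowP => j; rewrite mxE cons_rVS.
Qed.

Lemma uncons_rVK : cancel uncons_rV cons_rV.
Proof.
move=> x; apply/rowP => i.
by case: (unliftP ord0 i) => [j|] ->; rewrite ?cons_rVS ?cons_rV0 //= mxE.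
Qed.

Lemma measurable_cons_rV : measurable_fun setT cons_rV.
Proof.
apply: measurable_fun_rVP => i.
case: (unliftP ord0 i) => [j|] ->.
- rewrite (_ : (fun _ => _) = (fun x : 'rV[R]_d => x ord0 j) \o snd).
    exact: measurableT_comp (measurable_coord j) _.
  by apply/funext => p /=; rewrite cons_rVS.
- rewrite (_ : (fun _ => _) = fst); first exact: measurable_fst.
  by apply/funext => p /=; rewrite cons_rV0.
Qed.

Lemma measurable_uncons_rV : measurable_fun setT uncons_rV.
Proof.
apply/measurable_fun_pair; first exact: measurable_coord.
apply: measurable_fun_rVP => j.
rewrite (_ : (fun _ => _) = (fun x : 'rV[R]_d.+1 => x ord0 (lift ord0 j))).
  exact: measurable_coord.
by apply/funext => x; rewrite /= mxE.
Qed.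

Variable mu : {sigma_finite_measure set 'rV[R]_d -> \bar R}.

Definition lebesgue_cons : set 'rV[R]_d.+1 -> \bar R :=
  pushforward (@lebesgue_measure R \x mu)%E cons_rV.

Let lebesgue_cons_measure : {measure set 'rV[R]_d.+1 -> \bar R} :=
  measure_function_pushforward__canonical__measure_function_Measure
    (@lebesgue_measure R \x mu)%E measurable_cons_rV.

HB.instance Definition _ := Measure.copy lebesgue_cons lebesgue_cons_measure.

Let lebesgue_cons_sigma_finite : sigma_finite setT lebesgue_cons.
Proof.
have /sigma_finiteP[F [TF ndF Foo]] := sigma_finiteT (@lebesgue_measure R).
have /sigma_finiteP[G [TG ndG Goo]] := sigma_finiteT mu.
exists (fun n => uncons_rV @^-1` (F n `*` G n)).
  rewrite -preimage_bigcup [X in _ @^-1` X](_ : _ = setT) ?preimage_setT//.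
  apply/seteqP; split => // -[x y] _.
  have [n _ Fnx] : (\bigcup_i F i) x by rewrite -TF.
  have [k _ Gky] : (\bigcup_i G i) y by rewrite -TG.
  exists (maxn n k) => //; split => /=.
  - by move: x Fnx; exact/subsetPset/ndF/leq_maxl.
  - by move: y Gky; exact/subsetPset/ndG/leq_maxr.
move=> n; have [mF Fn] := Foo n; have [mG Gn] := Goo n; split.
  rewrite -[X in measurable X]setTI; apply: measurable_uncons_rV => //.
  exact: measurableX.
rewrite /lebesgue_cons /pushforward.
rewrite -comp_preimage (_ : _ \o _ = id); last by apply/funext/cons_rVK.
rewrite preimage_id product_measure1E//.
by rewrite lte_mul_pinfty// ge0_fin_numE.
Qed.

HB.instance Definition _ :=
  Measure_isSigmaFinite.Build _ _ _ lebesgue_cons lebesgue_cons_sigma_finite.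

End cons_rV.

(* Recursion on the dimension, R^(d+1) being R x R^d; [lebesgue_rV_rect] below
   pins the measure down. *)
Fixpoint lebesgue_rV (R : realType) (d : nat) :
    {sigma_finite_measure set 'rV[R]_d -> \bar R} :=
  if d is d'.+1 then lebesgue_cons (lebesgue_rV R d') else \d_(0 : 'rV[R]_0).

Lemma lebesgue_rV_rect (R : realType) (d : nat) (A : 'I_d -> set R) :
  (forall i, measurable (A i)) ->
  lebesgue_rV R d [set x | forall i, A i (x ord0 i)] =
  (\prod_(i < d) lebesgue_measure (A i))%E.
Proof.
elim: d A => [|d IH] A mA /=.
  rewrite big_ord0 diracE mem_set //=; by case.
rewrite big_ord_recl /= /lebesgue_cons /pushforward.
rewrite -IH; last by move=> i; exact: mA.
rewrite -product_measure1E //.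
- congr (_ _); apply/seteqP; split => [[t x] /= h|[t x] /= [h0 hS] i].
    split => /=; first by move: (h ord0); rewrite cons_rV0.
    by move=> i; move: (h (lift ord0 i)); rewrite cons_rVS.
  by case: (unliftP ord0 i) => [j|] ->; rewrite ?cons_rVS ?cons_rV0 /=.
- exact: (mA ord0).
- rewrite (_ : (fun _ => _) =
    \bigcap_(i in [set: 'I_d]) [set x : 'rV[R]_d | A (lift ord0 i) (x ord0 i)]).
    apply: fin_bigcap_measurable => // i _.
    by rewrite -[X in measurable X]setTI; apply: measurable_coord.
  by apply/seteqP; split => x /= h i; [move=> _|]; apply: h.
Qed.

Section smooth.
Context (R : realType) (d : nat).
Implicit Types (U V D : set 'rV[R]_d) (h : 'rV[R]_d -> R).

Definition basis_vec (i : 'I_d) : 'rV[R]_d := delta_mx ord0 i.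

Definition partial (i : 'I_d) h : 'rV[R]_d -> R := 'D_(basis_vec i) h.

Definition iter_partial (s : seq 'I_d) h : 'rV[R]_d -> R := foldr partial h s.

Definition Ck m U h :=
  forall s : seq 'I_d, (size s <= m)%N -> forall x, U x ->
    {for x, continuous (iter_partial s h)} /\
    ((size s < m)%N ->
     forall i, derivable (iter_partial s h) x (basis_vec i)).

Definition coord_fun (f : 'rV[R]_d -> 'rV[R]_d) (j : 'I_d) : 'rV[R]_d -> R :=
  fun x => f x ord0 j.

Definition Ck_map m U (f : 'rV[R]_d -> 'rV[R]_d) :=
  forall j, Ck m U (coord_fun f j).

Definition Ck_diffeo m U V (f g : 'rV[R]_d -> 'rV[R]_d) :=
  [/\ open U, open V, Ck_map m U f & Ck_map m V g] /\
  [/\ forall x, U x -> V (f x), forall y, V y -> U (g y),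
      {in U, cancel f g} & {in V, cancel g f}].

Definition boundary (D : set 'rV[R]_d) := closure D `\` interior D.

(* Near a boundary point, a C^m change of coordinates takes D to a half-space
   and its boundary to the bounding hyperplane. *)
Definition Ck_open_set m D :=
  open D /\
  forall p, boundary D p -> exists U V f g (i : 'I_d),
    [/\ U p, Ck_diffeo m U V f g,
        f @` (U `&` D) = V `&` [set y | 0 < y ord0 i] &
        f @` (U `&` boundary D) = V `&` [set y | y ord0 i = 0]].

Definition vanishes_at_infinity h :=
  forall e : R, 0 < e -> exists M : R, forall x, M < `|x| -> `|h x| < e.

Definition asymptotic_diffeo m (f : 'rV[R]_d -> 'rV[R]_d) :=
  (exists g, Ck_diffeo m setT setT f g) /\
  forall (j : 'I_d) (s : seq 'I_d), (size s <= m)%N ->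
    vanishes_at_infinity (iter_partial s (coord_fun (fun x => f x - x) j)).

Definition diffeo_images m D : set (set 'rV[R]_d) :=
  [set f @` D | f in asymptotic_diffeo m].

End smooth.

(* Functions on Omega are functions on R^d, considered only on Omega and up
   to equality almost everywhere. *)

Section dirichlet.
Context (R : realType) (d : nat) (Omega : set 'rV[R]_d).
Implicit Types (u f psi : 'rV[R]_d -> R) (t : R).

Local Notation mu := (lebesgue_rV R d).

Definition ae_eq_on u f := {ae mu, forall x, Omega x -> u x = f x}.

Definition L2 u :=
  measurable_fun Omega u /\ mu.-integrable Omega (fun x => (u x ^+ 2)%:E).

Definition test_function psi :=
  (forall m, Ck m setT psi) /\
  exists2 K, compact K /\ K `<=` Omega & forall x, ~ K x -> psi x = 0.

Definition L2_cvg (v : nat -> 'rV[R]_d -> R) u :=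
  (fun k => \int[mu]_(x in Omega) (v k x - u x) ^+ 2) @ \oo --> (0 : R).

(* u lies in H^1_0, the H^1-closure of the test functions, and g is its weak
   gradient *)
Definition H10 u (g : 'I_d -> 'rV[R]_d -> R) :=
  [/\ L2 u, forall i, L2 (g i) & exists v : nat -> 'rV[R]_d -> R,
    [/\ forall k, test_function (v k), L2_cvg v u &
        forall i, L2_cvg (fun k => partial i (v k)) (g i)]].

(* the graph of -Delta with Dirichlet boundary conditions: u belongs to its
   domain and -Delta u = f *)
Definition dirichlet_laplacian u f :=
  L2 f /\ exists2 g, H10 u g &
    forall psi, test_function psi ->
      \sum_(i < d) \int[mu]_(x in Omega) (g i x * partial i psi x) =
      \int[mu]_(x in Omega) (f x * psi x).

Definition eigenspace t u := dirichlet_laplacian u (fun x => t * u x).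

Definition lin_indep k (u : 'I_k -> 'rV[R]_d -> R) :=
  forall c : 'I_k -> R,
    ae_eq_on (fun x => \sum_(i < k) c i * u i x) (fun=> 0) ->
    forall i, c i = 0.

Definition multiplicity_ge t k :=
  exists u : 'I_k -> 'rV[R]_d -> R,
    (forall i, eigenspace t (u i)) /\ lin_indep u.

Definition simple_eigenvalue t := multiplicity_ge t 1 /\ ~ multiplicity_ge t 2.

(* lam lists the eigenvalues in nondecreasing order, each one as many times
   as its multiplicity; indices start at 0, i.e. lam n is lambda_(n+1) *)
Definition eigenvalue_listing (lam : nat -> R) :=
  {homo lam : i j / (i <= j)%N >-> i <= j} /\
  forall t k, multiplicity_ge t k <-> (`I_k #<= [set n | lam n = t])%card.

(* There is at most one listing.  Without a listing [lambda] would be the zero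
   sequence, and 0 is never a Dirichlet eigenvalue of a bounded open set, so
   such an Omega would not lie in [simple_domains]. *)
Definition lambda : nat -> R := xget (fun=> 0) eigenvalue_listing.

Definition normalized_eigenfunction t u :=
  eigenspace t u /\ \int[mu]_(x in Omega) (u x ^+ 2) = 1.

End dirichlet.

Definition simple_domains (R : realType) (d m : nat) (D : set 'rV[R]_d) :
    set (set 'rV[R]_d) :=
  [set Omega | diffeo_images m D Omega /\
               forall n, simple_eigenvalue Omega (lambda Omega n)].

(* The isometry x |-> A x + c is encoded as the pair (A, c); vectors are rows,
   so A x + c reads [x *m A^T + c].  The group law is composition. *)

Section isometry.
Context (R : realType) (d : nat).

Definition orthogonal : pred ('M[R]_d * 'rV[R]_d) :=
  fun S => S.1 *m S.1^T == 1%:M.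

Definition isometry := {S : 'M[R]_d * 'rV[R]_d | orthogonal S}.

HB.instance Definition _ := Choice.on isometry.

Implicit Types S T : isometry.

Definition isometry_fun S (x : 'rV[R]_d) : 'rV[R]_d :=
  x *m (val S).1^T + (val S).2.

Lemma orthogonal1 : orthogonal (1%:M, 0).
Proof. by rewrite /orthogonal /= trmx1 mulmx1. Qed.

Lemma orthogonalM S T :
  orthogonal ((val S).1 *m (val T).1, (val T).2 *m (val S).1^T + (val S).2).
Proof.
case: S T => [[A c] /= /eqP oA] [[B b] /= /eqP oB]; rewrite /orthogonal /=.
by rewrite trmx_mul mulmxA -(mulmxA A) oB mulmx1 oA.
Qed.

Lemma orthogonalV S :
  orthogonal ((val S).1^T, - ((val S).2 *m (val S).1)).
Proof.
case: S => [[A c] /= /eqP oA]; rewrite /orthogonal /= trmxK.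
by rewrite (mulmx1C oA).
Qed.

Definition isometry1 : isometry := exist orthogonal _ orthogonal1.
Definition isometryM S T : isometry := exist orthogonal _ (orthogonalM S T).
Definition isometryV S : isometry := exist orthogonal _ (orthogonalV S).

Lemma isometry_mulA : associative isometryM.
Proof.
move=> S T W; apply: val_inj => /=.
by rewrite mulmxA mulmxDl trmx_mul mulmxA addrA.
Qed.

Lemma isometry_mul1 : left_id isometry1 isometryM.
Proof.
move=> S; apply: val_inj => /=.
by rewrite trmx1 mul1mx mulmx1 addr0; case: (sval S).
Qed.

Lemma isometry_mulr1 : right_id isometry1 isometryM.
Proof.
move=> S; apply: val_inj => /=.
by rewrite mulmx1 mul0mx add0r; case: (sval S).
Qed.

Lemma isometry_mulV : left_inverse isometry1 isometryV isometryM.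
Proof.
case=> -[A c] /= oA; apply: val_inj => /=.
by rewrite trmxK subrr (mulmx1C (eqP oA)).
Qed.

Lemma isometry_mulrV : right_inverse isometry1 isometryV isometryM.
Proof.
case=> -[A c] /= oA; apply: val_inj => /=.
by rewrite mulNmx -mulmxA (eqP oA) mulmx1 addNr.
Qed.

HB.instance Definition _ := isGroup.Build isometry isometry_mulA
  isometry_mul1 isometry_mulr1 isometry_mulV isometry_mulrV.

Lemma isometry_fun1 x : isometry_fun 1%g x = x.
Proof. by rewrite /isometry_fun /= trmx1 mulmx1 addr0. Qed.

Lemma isometry_funM S T x :
  isometry_fun (S * T)%g x = isometry_fun S (isometry_fun T x).
Proof. by rewrite /isometry_fun /= trmx_mul mulmxDl mulmxA addrA. Qed.

Definition preserves (Omega : set 'rV[R]_d) : pred isometry :=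
  fun S => `[< isometry_fun S @` Omega = Omega >].

Definition Iso Omega := {S : isometry | preserves Omega S}.

Lemma preserves_group_closed Omega : group_closed (preserves Omega).
Proof.
split=> [|S T /asboolP SO /asboolP TO]; apply/asboolP.
  apply/seteqP; split => [_ [x xO <-]|x xO]; first by rewrite isometry_fun1.
  by exists x => //; rewrite isometry_fun1.
have VO : isometry_fun T^-1%g @` Omega = Omega.
  rewrite -{1}TO image_comp; apply/seteqP; split => [_ [x xO <-]|x xO] /=.
    by rewrite -isometry_funM mulVg isometry_fun1.
  by exists x => //=; rewrite -isometry_funM mulVg isometry_fun1.
rewrite (_ : isometry_fun _ = isometry_fun S \o isometry_fun T^-1%g).
  by rewrite -image_comp VO SO.
by apply/funext => x /=; rewrite isometry_funM.
Qed.

HB.instance Definition _ Omega := SubChoice.on (Iso Omega).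
HB.instance Definition _ Omega :=
  SubChoice_isSubGroup.Build isometry (preserves Omega) (Iso Omega)
    (@preserves_group_closed Omega).

Definition Iso_fun Omega (S : Iso Omega) : 'rV[R]_d -> 'rV[R]_d :=
  isometry_fun (val S).

Definition is_sign Omega (S : Iso Omega) n (s : R) :=
  (s = 1 \/ s = -1) /\
  forall phi, normalized_eigenfunction Omega (lambda Omega n) phi ->
    ae_eq_on Omega (phi \o Iso_fun S) (fun x => s * phi x).

(* Well defined once lambda_(n+1) is simple: [is_sign S n] then holds of
   exactly one number. *)
Definition eps Omega (S : Iso Omega) (n : nat) : R := xget 0 (is_sign S n).

End isometry.

(* Main.v *)
Require Import Defs.
From HB Require Import structures.
From mathcomp Require Import all_boot all_order all_algebra.
From mathcomp Require Import all_classical all_reals all_analysis.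
From mathcomp Require Import measurable_realfun lra ring.
Import Order.TTheory GRing.Theory Num.Theory.
Import numFieldNormedType.Exports.

(* Signs multiply because eigenvalues are simple, so everything follows from the
   injectivity of eps: if S preserves Omega and is not the identity, some
   eigenfunction is not S-invariant.  Choose a test function v with
   v <> v o S, and minimize the Rayleigh quotient over the nonzero coboundaries
   v - v o S.  By Rellich compactness (a translation estimate on a fine grid of
   cells) a minimizing sequence converges to some u <> 0, whose Euler-Lagrange
   equation is tested against coboundaries only.  Since S is measure preserving,
   moving S to the other side shows that u - u o S^-1 is a genuine eigenfunction;
   it is not S-invariant, as the limit u of coboundaries is orthogonal to all
   invariant functions.

   Hence every S in Iso Omega satisfies S^2 = 1, and the group is abelian.  A
   translation of order two is trivial, so linear parts embed Iso Omega into
   commuting involutions of R^d; these are simultaneously diagonalizable with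
   entries +1 and -1, which bounds the rank by d. *)

Set Implicit Arguments.
Unset Strict Implicit.
Unset Printing Implicit Defensive.

Local Open Scope classical_set_scope.
Local Open Scope ring_scope.

(** * Lebesgue measure on row vectors *)

(** An isometry [S] preserving [Omega] is not known in advance to have finite order, so the
    invariant functions cannot be split off by averaging over the powers of [S]. Coboundaries avoid
    this projection: their L2 closure meets the invariant functions only in 0, and composition with
    [S] is unitary for the L2 product and for the Dirichlet form alike, so [1 - S] has adjoint
    [1 - S^-1] for both. A function that satisfies the eigenvalue equation against coboundaries only
    is therefore sent by [1 - S^-1] to a true eigenfunction, although it has not been shown to be
    one itself. The price is a separate proof that this image is not invariant. A noninvariant
    eigenfunction contradicts trivial signs only if its eigenvalue occurs in [lambda]. This requires
    [lambda] to be an actual listing, and the Poincare inequality provides that by excluding the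
    eigenvalue 0. *)

Section rV_measure.
Context (R : realType).

Lemma rV_ballE d (x : 'rV[R]_d) (e : R) (y : 'rV[R]_d) : 0 < e ->
  ball x e y <-> forall i, `|x ord0 i - y ord0 i| < e.
Proof.
move=> e0; split=> [[_ h] i|h]; first exact: h.
by split=> // i j; rewrite (ord1 i); exact: h.
Qed.

Lemma measurable_box d (I : 'I_d -> interval R) :
  measurable [set x : 'rV[R]_d | forall i, [set` I i] (x ord0 i)].
Proof.
rewrite (_ : [set x | _] = \bigcap_(i in [set: 'I_d])
    [set x : 'rV[R]_d | [set` I i] (x ord0 i)]).
  apply: fin_bigcap_measurable => // i _.
  by rewrite -[X in measurable X]setTI; apply: measurable_coord => //; exact: measurable_itv.
by apply/seteqP; split => x /= h i; [move=> _|]; apply: h.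
Qed.

(** The sigma-algebra is generated by the coordinates, so second countability enters: an open set is
    the union of the cubes with rational center and radius [1 / (n + 1)] that it contains. *)
Lemma open_measurable_rV d (U : set 'rV[R]_d) : open U -> measurable U.
Proof.
move=> oU.
pose box (q : {ffun 'I_d -> rat} * nat) : set 'rV[R]_d :=
  [set x | forall i, `|ratr (q.1 i) - x ord0 i| < q.2.+1%:R^-1].
have mbox q : measurable (box q).
  rewrite (_ : box q = \bigcap_(i in [set: 'I_d])
      [set x : 'rV[R]_d | ball (ratr (q.1 i) : R) q.2.+1%:R^-1 (x ord0 i)]).
    apply: fin_bigcap_measurable => // i _.
    rewrite -[X in measurable X]setTI; apply: measurable_coord => //.
    exact: measurable_ball.
  by apply/seteqP; split => x /= h i; [move=> _|]; apply: h.
rewrite (_ : U = \bigcup_(q in [set q | box q `<=` U]) box q); last first.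
  apply/seteqP; split => [x Ux|x [q qU] /qU//].
  have /nbhs_ballP[e /= e0 eU] : nbhs x U by apply: open_nbhs_nbhs.
  (* Half of [e], because points of the box are compared with [x] through its rational center. *)
  have [n ne] : exists n : nat, (n.+1%:R : R)^-1 < e / 2.
    exists (Num.truncn (e / 2)^-1).
    by rewrite invf_plt ?posrE ?divr_gt0// truncnS_gt.
  have /(_ _)/cid q i : exists q : rat, `|ratr q - x ord0 i| < n.+1%:R^-1 :> R.
    have [|q] := @rat_in_itvoo R (x ord0 i - n.+1%:R^-1) (x ord0 i).
      by rewrite ltrBlDr ltrDl invr_gt0.
    rewrite in_itv /= => /andP[q1 q2]; exists q.
    by rewrite ltr_norml; apply/andP; split; [rewrite ltrBrDl// |
      rewrite (lt_trans (y := 0))// ?subr_lt0// invr_gt0].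
  exists ([ffun i => projT1 (q i)], n); last first.
    by move=> i /=; rewrite ffunE; exact: (projT2 (q i)).
  move=> y /= h; apply: eU; apply/rV_ballE => // i.
  have := h i; rewrite ffunE; have := projT2 (q i).
  set r := ratr _ => h1 h2.
  rewrite (_ : _ - _ = - (r - x ord0 i) + (r - y ord0 i)); last by ring.
  apply: le_lt_trans (ler_normD _ _) _; rewrite normrN (splitr e).
  by apply: ltrD; apply: lt_trans ne.
rewrite bigcup_mkcond; apply: countable_bigcupT_measurable => // q.
by case: ifPn => // _; exact: mbox.
Qed.

Lemma continuous_measurable_rV d (f : 'rV[R]_d -> R) :
  continuous f -> measurable_fun setT f.
Proof.
move=> /continuousP cf; apply: (measurability _ (RGenOpens.measurableE R)).
move=> _ [_ [a [b ->] <-]]; rewrite setTI; apply: open_measurable_rV.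
by apply: cf; exact: interval_open.
Qed.

Lemma measurable_addr_rV d (c : 'rV[R]_d) : measurable_fun setT (fun x : 'rV[R]_d => x + c).
Proof.
apply: measurable_fun_rVP => i.
rewrite (_ : (fun _ => _) = (fun x : 'rV[R]_d => x ord0 i) \+ cst (c ord0 i)).
  by apply: measurable_funD => //; exact: measurable_coord.
by apply/funext => x; rewrite /= mxE.
Qed.

Lemma measurable_mulmx_rV d (A : 'M[R]_d) : measurable_fun setT (fun x : 'rV[R]_d => x *m A).
Proof.
apply: measurable_fun_rVP => i.
rewrite (_ : (fun _ => _) = (fun x : 'rV[R]_d => \sum_j x ord0 j * A j i)).
  by apply: measurable_sum => j; apply: measurable_funM => //; exact: measurable_coord.
by apply/funext => x; rewrite /= mxE.
Qed.

(** Lebesgue measure is determined by its values on half-open intervals, whose length a translation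
    keeps. *)
Lemma lebesgue_measure_translation (c : R) (A : set R) : measurable A ->
  pushforward lebesgue_measure ((fun x => x + c) : _ -> measurableTypeR R) A =
  lebesgue_measure A.
Proof.
move=> mA; apply/esym/lebesgue_measure_unique => //=.
  exact: (@measurable_funD _ _ R setT id (cst c)).
move=> _ _ [[a b]] _ <-.
rewrite /= /pushforward.
rewrite (_ : _ @^-1` _ = `]a - c, b - c]%classic); last first.
  by apply/seteqP; split => x /=; rewrite !in_itv /= ltrBlDr lerBrDr.
rewrite !lebesgue_measure_itv/= !lte_fin ltrD2r -!EFinB opprB.
by rewrite addrA subrK.
Qed.

Lemma ge0_integral_lebesgue_translation (c : R) (f : R -> \bar R) :
  measurable_fun setT f -> (forall x, 0 <= f x)%E ->
  (\int[lebesgue_measure]_x f (x + c)%R = \int[lebesgue_measure]_x f x)%E.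
Proof.
move=> mf f0.
have mc : measurable_fun [set: measurableTypeR R] ((fun x => x + c) : _ -> measurableTypeR R).
  exact: (@measurable_funD _ _ R setT id (cst c)).
have := @ge0_integral_pushforward _ _ (measurableTypeR R) (measurableTypeR R)
  R _ mc lebesgue_measure setT f measurableT mf.
rewrite preimage_setT /comp => <- //.
by apply: eq_measure_integral => C mC _; exact: lebesgue_measure_translation.
Qed.

(** Slice along the first coordinate: the induction hypothesis translates inside each slice, then
    the one-dimensional case translates the slices among themselves. *)
Lemma lebesgue_rV_translation d (c : 'rV[R]_d) (A : set 'rV[R]_d) : measurable A ->
  lebesgue_rV R d ((fun x : 'rV[R]_d => x + c) @^-1` A) = lebesgue_rV R d A.
Proof.
elim: d c A => [|d IH] c A mA /=.
  congr (dirac _ _); apply/funext => x; rewrite /preimage /=; congr (A _).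
  by apply/rowP; case.
rewrite /lebesgue_cons /pushforward /= /product_measure1.
pose B := @cons_rV R d @^-1` A.
have mB : measurable B by rewrite -[B]setTI; exact: measurable_cons_rV.
pose phi t := lebesgue_rV R d (xsection B t).
have mphi : measurable_fun setT phi by exact: measurable_fun_xsection.
pose c0 := c ord0 ord0.
have mc : measurable_fun [set: R] (fun x : R => x + c0).
  exact: (@measurable_funD _ _ R setT id (cst c0)).
transitivity (\int[@lebesgue_measure R]_t (fun u : R => phi (u + c0)%R) t)%E.
  apply: eq_integral => t _; rewrite /phi -(IH (\row_j c ord0 (lift ord0 j))); last first.
    exact: measurable_xsection.
  rewrite [LHS]/=; congr (lebesgue_rV R d _).
  apply/seteqP; split => x; rewrite /xsection /= !inE /B /=.
    move=> h; rewrite (_ : cons_rV _ = cons_rV (t, x) + c)//.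
    apply/rowP => i; rewrite [RHS]mxE.
    by case: (unliftP ord0 i) => [j|] ->; rewrite ?cons_rVS ?cons_rV0 ?mxE.
  move=> h; rewrite (_ : _ + c = cons_rV (t + c0, x + \row_j c ord0 (lift ord0 j)))//.
  apply/rowP => i; rewrite [LHS]mxE.
  by case: (unliftP ord0 i) => [j|] ->; rewrite ?cons_rVS ?cons_rV0 ?mxE.
by apply: (ge0_integral_lebesgue_translation c0 mphi) => t; exact: measure_ge0.
Qed.

Lemma ge0_integral_lebesgue_rV_translation d (c : 'rV[R]_d) (f : 'rV[R]_d -> \bar R) :
  measurable_fun setT f -> (forall x, 0 <= f x)%E ->
  (\int[lebesgue_rV R d]_x f (x + c)%R = \int[lebesgue_rV R d]_x f x)%E.
Proof.
move=> mf f0.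
have := @ge0_integral_pushforward _ _ _ _ R _ (measurable_addr_rV c) (lebesgue_rV R d) setT f measurableT mf.
rewrite preimage_setT /comp => <- //.
apply: eq_measure_integral => [|mc C mC _]; first exact: measurable_addr_rV.
exact: (lebesgue_rV_translation c mC).
Qed.

End rV_measure.

(** * Invariance of Lebesgue measure under Euclidean isometries *)

Section rV_isometry.
Context (R : realType) (d : nat).
Local Notation mu := (lebesgue_rV R d).

(** Row vectors carry the sup norm, which rotations do not preserve. The Euclidean norm is written
    out instead, and its unit ball [B] is the rotation-invariant set used below. *)
Lemma mx_row_sqr_orthogonal (A : 'M[R]_d) (x : 'rV[R]_d) : A *m A^T = 1%:M ->
  \sum_i (x *m A) ord0 i ^+ 2 = \sum_i x ord0 i ^+ 2.
Proof.
have sq (y : 'rV[R]_d) : \sum_i y ord0 i ^+ 2 = (y *m y^T) ord0 ord0.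
  by rewrite mxE; apply: eq_bigr => i _; rewrite mxE expr2.
by move=> AA; rewrite !sq trmx_mul mulmxA -(mulmxA x) AA mulmx1.
Qed.

Let B : set 'rV[R]_d := [set x | \sum_i x ord0 i ^+ 2 <= 1].

Let mB : measurable B.
Proof.
have mf : measurable_fun setT (fun x : 'rV[R]_d => \sum_i x ord0 i ^+ 2).
  by apply: measurable_sum => i; apply: measurable_funX; exact: measurable_coord.
rewrite (_ : B = setT `&` (fun x : 'rV[R]_d => \sum_i x ord0 i ^+ 2) @^-1` `]-oo, 1]%classic).
  by apply: mf => //; exact: measurable_itv.
by rewrite setTI; apply/seteqP; split => x /=; rewrite in_itv.
Qed.

Let cube (r : R) : set 'rV[R]_d := [set x | forall i, `[- r, r]%classic (x ord0 i)].

Let mcube r : measurable (cube r).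
Proof. exact: measurable_box. Qed.

Let mu_cube r : 0 <= r -> mu (cube r) = ((r + r) ^+ d)%:E.
Proof.
move=> r0; rewrite (lebesgue_rV_rect (A := fun=> `[- r, r]%classic))//.
rewrite (eq_bigr (fun=> (r + r)%:E)) => [|i _]; last first.
  rewrite lebesgue_measure_itv/= lte_fin -EFinB opprK.
  case: ltP => // r0'; congr _%:E; lra.
by rewrite prodEFin big_const_ord iter_mulr mulr1.
Qed.

(** [mu B] gets cancelled at the end of the Tonelli argument, so it must be finite and, by the next
    statement, nonzero. *)
Let muBy : (mu B < +oo)%E.
Proof.
apply: (@le_lt_trans _ _ (mu (cube 1))); last by rewrite mu_cube ?ltry.
apply: le_measure; rewrite ?inE// => x /= Bx i; rewrite /= in_itv /= -ler_norml.
rewrite -(@ler_pXn2r _ 2) ?nnegrE// expr1n real_normK ?num_real//.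
apply: le_trans Bx; rewrite (bigD1 i)//= lerDl sumr_ge0// => j _.
exact: sqr_ge0.
Qed.

Let muB0 : (0 < mu B)%E.
Proof.
(* With half-side [1 / (d + 1)] each squared coordinate is at most [1 / (d + 1)], so the sum of [d]
   of them is at most 1, also for [d = 0]. *)
apply: (@lt_le_trans _ _ (mu (cube d.+1%:R^-1))).
  by rewrite mu_cube// lte_fin exprn_gt0// addr_gt0.
apply: le_measure; rewrite ?inE// => x /= Bx.
apply: (@le_trans _ _ (\sum_(i < d) (d.+1%:R^-1 : R))).
  apply: ler_sum => i _; have := Bx i; rewrite /= in_itv /= -ler_norml => xi.
  rewrite -real_normK ?num_real// expr2 -[leRHS]mulr1 ler_pM//.
  by rewrite (le_trans xi)// invf_le1// ler1n.
rewrite sumr_const card_ord -[leLHS]mulr_natr ler_pdivrMl// mulr1.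
by rewrite ler_nat.
Qed.

(* Tonelli for [f x * \1_B (y *m A - x)], where [B] is the unit ball: one order
   of integration gives [(\int f) mu B], the other [(\int f (y *m A)) mu B]. *)
Lemma ge0_integral_lebesgue_rV_orthogonal (A : 'M[R]_d) (f : 'rV[R]_d -> \bar R) :
  A *m A^T = 1%:M -> measurable_fun setT f -> (forall x, 0 <= f x)%E ->
  (\int[mu]_x f (x *m A) = \int[mu]_x f x)%E.
Proof.
move=> AA mf f0; have A'A := mulmx1C AA.
pose g (p : 'rV[R]_d * 'rV[R]_d) : \bar R := (f p.1 * (\1_B (p.2 *m A - p.1))%:E)%E.
have mm1 : measurable_fun setT (fun p : 'rV[R]_d * 'rV[R]_d => p.2 *m A - p.1).
  apply: measurable_fun_rVP => i.
  rewrite (_ : (fun _ => _) = (fun p : 'rV[R]_d * 'rV[R]_d => (p.2 *m A) ord0 i)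
      \- (fun p : 'rV[R]_d * 'rV[R]_d => p.1 ord0 i)); last first.
    by apply/funext => x; rewrite /= !mxE.
  apply: measurable_funB.
    apply: (measurableT_comp (measurable_coord i)).
    exact: (measurableT_comp (measurable_mulmx_rV A)).
  exact: (measurableT_comp (measurable_coord i)).
have mIB : measurable_fun [set: 'rV[R]_d] (fun x => (\1_B x)%:E : \bar R).
  exact/measurable_EFinP/measurable_indic.
have mg : measurable_fun setT g.
  apply: emeasurable_funM; first exact: (measurableT_comp mf).
  exact: (measurableT_comp mIB).
have g0 p : (0 <= g p)%E by rewrite mule_ge0// lee_fin.
have IBE : (\int[mu]_y (\1_B y)%:E = mu B)%E.
  by rewrite integral_indic// setIT.
have mfA : measurable_fun setT (fun x => f (x *m A)).
  exact: (measurableT_comp mf (measurable_mulmx_rV A)).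
have I1 : (\int[mu]_x \int[mu]_y g (x, y) = \int[mu]_x f x * mu B)%E.
  rewrite -ge0_integralZr//.
  apply: eq_integral => x _; rewrite /g /= ge0_integralZl//; last first.
    apply: (measurableT_comp mIB) => //.
    exact: (measurableT_comp mm1 (measurable_pair1 x)).
  congr (_ * _)%E; rewrite -IBE.
  transitivity (\int[mu]_y (\1_B (y *m A))%:E)%E.
    rewrite -(ge0_integral_lebesgue_rV_translation (- (x *m A^T))) //=; last first.
      exact: (measurableT_comp mIB (measurable_mulmx_rV A)).
    apply: eq_integral => y _; congr (\1_B _)%:E.
    by rewrite mulmxDl mulNmx -mulmxA A'A mulmx1.
  apply: eq_integral => y _; congr _%:E; rewrite !indicE; congr (nat_of_bool _)%:R.
  by apply/idP/idP; rewrite !inE /B /= mx_row_sqr_orthogonal.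
have I2 : (\int[mu]_y \int[mu]_x g (x, y) = \int[mu]_x f (x *m A) * mu B)%E.
  (* Once [x] is replaced by [x + y *m A], the indicator no longer depends on [y] and comes out
     after a second exchange of the integrals. *)
  transitivity (\int[mu]_y \int[mu]_x (f (x + y *m A)%R * (\1_B (- x))%:E))%E.
    apply: eq_integral => y _.
    rewrite -(ge0_integral_lebesgue_rV_translation (y *m A)) //=; last first.
      exact: (measurableT_comp mg (measurable_pair2 y)).
    by apply: eq_integral => x _; rewrite /g /= opprD addrCA subrr addr0.
  pose h (p : 'rV[R]_d * 'rV[R]_d) : \bar R := (f (p.1 + p.2 *m A)%R * (\1_B (- p.1))%:E)%E.
  have mN : measurable_fun [set: 'rV[R]_d] (fun x : 'rV[R]_d => - x).
    rewrite (_ : (fun _ => _) = (fun x : 'rV[R]_d => x *m (-1)%:M)).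
      exact: measurable_mulmx_rV.
    by apply/funext => x; rewrite mul_mx_scalar scaleN1r.
  have mNB : measurable_fun [set: 'rV[R]_d] (fun x => (\1_B (- x))%:E : \bar R).
    exact: (measurableT_comp mIB mN).
  have ma2 : measurable_fun setT (fun p : 'rV[R]_d * 'rV[R]_d => p.1 + p.2 *m A).
    apply: measurable_fun_rVP => i.
    rewrite (_ : (fun _ => _) = (fun p : 'rV[R]_d * 'rV[R]_d => p.1 ord0 i)
        \+ (fun p : 'rV[R]_d * 'rV[R]_d => (p.2 *m A) ord0 i)); last first.
      by apply/funext => x; rewrite /= !mxE.
    apply: measurable_funD.
      exact: (measurableT_comp (measurable_coord i)).
    apply: (measurableT_comp (measurable_coord i)).
    exact: (measurableT_comp (measurable_mulmx_rV A)).
  have mh : measurable_fun setT h.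
    apply: emeasurable_funM; first exact: (measurableT_comp mf).
    exact: (measurableT_comp mNB).
  have h0 p : (0 <= h p)%E by rewrite mule_ge0// lee_fin.
  rewrite -[LHS](fubini_tonelli h mh h0).
  rewrite -IBE -ge0_integralZl//; last by apply: integral_ge0 => x _.
  transitivity (\int[mu]_x ((\int[mu]_y f (y *m A)) * (\1_B (- x))%:E))%E; last first.
    apply: eq_integral => x _; congr (_ * _%:E)%E; rewrite !indicE.
    congr (nat_of_bool _)%:R; have sN : \sum_(i < d) (- x) ord0 i ^+ 2 = \sum_(i < d) x ord0 i ^+ 2.
      by apply: eq_bigr => i _; rewrite mxE sqrrN.
    by apply/idP/idP; rewrite !inE /B /= sN.
  apply: eq_integral => x _; rewrite /h /= ge0_integralZr//; last first.
    exact: (measurableT_comp mf (measurableT_comp ma2 (measurable_pair1 x))).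
  congr (_ * _)%E.
  rewrite -[RHS](ge0_integral_lebesgue_rV_translation (x *m A^T)) //=.
  apply: eq_integral => y _; congr f.
  by rewrite mulmxDl -mulmxA A'A mulmx1 addrC.
have := fubini_tonelli (m1 := mu) (m2 := mu) g mg g0; rewrite I1 I2.
have mBfin : mu B \is a fin_num by rewrite ge0_fin_numE// ltW.
move/(congr1 (fun z => z * ((fine (mu B))^-1)%:E)%E).
rewrite -!muleA -(fineK mBfin) -EFinM divff ?mule1//.
by rewrite fine_eq0 ?gt_eqF.
Qed.

Lemma isometry_funE (S : Defs.isometry R d) (x : 'rV[R]_d) :
  isometry_fun S x = x *m (val S).1^T + (val S).2.
Proof. by []. Qed.

Lemma isometry_orthogonal (S : Defs.isometry R d) : (val S).1^T *m (val S).1^T^T = 1%:M.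
Proof. by rewrite trmxK; apply: mulmx1C; exact/eqP/(valP S). Qed.

Lemma isometry_funK (S : Defs.isometry R d) : cancel (isometry_fun S) (isometry_fun S^-1%g).
Proof. by move=> x; rewrite -isometry_funM mulVg isometry_fun1. Qed.

Lemma isometry_funVK (S : Defs.isometry R d) : cancel (isometry_fun S^-1%g) (isometry_fun S).
Proof. by move=> x; rewrite -isometry_funM mulgV isometry_fun1. Qed.

Lemma measurable_isometry_fun (S : Defs.isometry R d) : measurable_fun setT (isometry_fun S).
Proof.
exact: (measurableT_comp (measurable_addr_rV (val S).2)
  (measurable_mulmx_rV (val S).1^T)).
Qed.

Lemma ge0_integral_isometry (S : Defs.isometry R d) (f : 'rV[R]_d -> \bar R) :
  measurable_fun setT f -> (forall x, 0 <= f x)%E ->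
  (\int[mu]_x f (isometry_fun S x) = \int[mu]_x f x)%E.
Proof.
move=> mf f0; rewrite -[RHS](ge0_integral_lebesgue_rV_translation (val S).2)//.
rewrite -[RHS](ge0_integral_lebesgue_rV_orthogonal (isometry_orthogonal S))//.
exact: (measurableT_comp mf (measurable_addr_rV _)).
Qed.

Lemma integral_isometry (S : Defs.isometry R d) (f : 'rV[R]_d -> \bar R) :
  measurable_fun setT f -> (\int[mu]_x f (isometry_fun S x) = \int[mu]_x f x)%E.
Proof.
move=> mf; rewrite integralE [RHS]integralE; congr (_ - _)%E.
  rewrite -[RHS](ge0_integral_isometry S)//; last exact: measurable_funepos.
  by apply: eq_integral => x _; rewrite !funeposE.
rewrite -[RHS](ge0_integral_isometry S)//; last exact: measurable_funeneg.
by apply: eq_integral => x _; rewrite !funenegE.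
Qed.

Lemma lebesgue_rV_isometry (S : Defs.isometry R d) (A : set 'rV[R]_d) : measurable A ->
  mu (isometry_fun S @^-1` A) = mu A.
Proof.
move=> mA; have mSA : measurable (isometry_fun S @^-1` A).
  by rewrite -[X in measurable X]setTI; exact: measurable_isometry_fun.
rewrite -[in RHS](setIT A) -[in LHS](setIT (_ @^-1` _)) -!integral_indic//.
by rewrite -[RHS](ge0_integral_isometry S)//; exact/measurable_EFinP/measurable_indic.
Qed.

Lemma negligible_isometry (S : Defs.isometry R d) (A : set 'rV[R]_d) :
  mu.-negligible A -> mu.-negligible (isometry_fun S @^-1` A).
Proof.
move=> [N [mN N0 AN]]; exists (isometry_fun S @^-1` N); split.
- by rewrite -[X in measurable X]setTI; exact: measurable_isometry_fun.
- by rewrite lebesgue_rV_isometry.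
- by move=> x; exact: AN.
Qed.

Section invariant_domain.
Variables (Omega : set 'rV[R]_d) (S : Defs.isometry R d).
Hypothesis mO : measurable Omega.
Hypothesis SO : forall x, Omega (isometry_fun S x) <-> Omega x.

Lemma measurable_fun_isometry (f : 'rV[R]_d -> R) :
  measurable_fun Omega f -> measurable_fun Omega (f \o isometry_fun S).
Proof.
move=> mf; apply: (measurable_comp mO _ mf).
  by move=> _ [x Ox <-]; exact/SO.
exact: (measurable_funS measurableT (@subsetT _ _) (measurable_isometry_fun S)).
Qed.

Lemma integral_domain_isometry (f : 'rV[R]_d -> \bar R) :
  measurable_fun Omega f ->
  (\int[mu]_(x in Omega) f (isometry_fun S x) = \int[mu]_(x in Omega) f x)%E.
Proof.
move=> mf; rewrite integral_mkcond [RHS]integral_mkcond.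
rewrite -[RHS](integral_isometry S); last first.
  by apply/(measurable_restrict f mO measurableT); rewrite setTI.
apply: eq_integral => x _; rewrite /patch.
suff -> : (x \in Omega) = (isometry_fun S x \in Omega) by [].
by apply/idP/idP; rewrite !inE => /SO.
Qed.

Lemma Rintegral_domain_isometry (f : 'rV[R]_d -> R) :
  measurable_fun Omega f ->
  \int[mu]_(x in Omega) f (isometry_fun S x) = \int[mu]_(x in Omega) f x.
Proof.
by move=> mf; congr fine; apply: (integral_domain_isometry (f := EFin \o f));
  exact/measurable_EFinP.
Qed.

Lemma ae_domain_isometry (P : 'rV[R]_d -> Prop) :
  {ae mu, forall x, Omega x -> P x} ->
  {ae mu, forall x, Omega x -> P (isometry_fun S x)}.
Proof.
move/(negligible_isometry S); apply: negligibleS => x /= h g; apply: h => Ox.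
by apply: g; exact/SO.
Qed.

End invariant_domain.

End rV_isometry.

(** * The space L2 *)

Section L2_space.
Context (R : realType) (d : nat) (Omega : set 'rV[R]_d).
Hypothesis mO : measurable Omega.
Local Notation mu := (lebesgue_rV R d).
Local Notation L2 := (L2 Omega).
Implicit Types f g h u : 'rV[R]_d -> R.

(** The real-valued integral takes a default value when the product is not integrable, which is why
    bilinearity is stated for [L2] functions. *)
Definition ip f g : R := \int[mu]_(x in Omega) (f x * g x).

Lemma L2_measurable f : L2 f -> measurable_fun Omega f.
Proof. by case. Qed.

Lemma L2M_integrable f g : L2 f -> L2 g ->
  mu.-integrable Omega (EFin \o (fun x => f x * g x)).
Proof.
move=> [mf f2] [mg g2].
apply: (le_integrable mO (g := fun x => (f x ^+ 2 + g x ^+ 2)%:E)).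
- by apply/measurable_EFinP; apply: measurable_funM.
- move=> x _ /=; rewrite lee_fin [leRHS]ger0_norm ?addr_ge0 ?sqr_ge0//.
  rewrite ler_norml; apply/andP; split; last by nra.
  by nra.
- rewrite (_ : (fun x => _) = (fun x => (f x ^+ 2)%:E) \+ (fun x => (g x ^+ 2)%:E))%E.
    exact: integrableD.
  by apply/funext => x; rewrite EFinD.
Qed.

Lemma L2D f g : L2 f -> L2 g -> L2 (fun x => f x + g x).
Proof.
move=> fL gL; have fgi := L2M_integrable fL gL; case: (fL) (gL) => mf f2 [mg g2].
split; first exact: measurable_funD.
rewrite (_ : (fun x => _) = (fun x => (f x ^+ 2)%:E) \+
    ((fun x => (g x ^+ 2)%:E) \+ (fun x => (2%:E * (f x * g x)%:E))))%E; last first.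
  by apply/funext => x /=; rewrite -EFinM -!EFinD; congr _%:E; ring.
by apply: integrableD => //; apply: integrableD => //; exact: integrableZl.
Qed.

Lemma L2Z c f : L2 f -> L2 (fun x => c * f x).
Proof.
move=> [mf f2]; split; first exact: measurable_funM.
rewrite (_ : (fun x => _) = (fun x => (c ^+ 2)%:E * (f x ^+ 2)%:E)%E); last first.
  by apply/funext => x; rewrite exprMn.
exact: integrableZl.
Qed.

Lemma L2N f : L2 f -> L2 (fun x => - f x).
Proof.
move=> /(L2Z (-1)); congr (Defs.L2 _ _).
by apply/funext => x; rewrite mulN1r.
Qed.

Lemma L2B f g : L2 f -> L2 g -> L2 (fun x => f x - g x).
Proof. by move=> fL gL; apply: L2D => //; exact: L2N. Qed.

Lemma L2_0 : L2 (fun=> 0).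
Proof.
split; first exact: measurable_cst.
rewrite (_ : (fun _ => _) = cst 0%E); first exact: integrable0.
by apply/funext => x; rewrite expr0n.
Qed.

Lemma L2_sum (I : Type) (r : seq I) (F : I -> 'rV[R]_d -> R) :
  (forall i, L2 (F i)) -> L2 (fun x => \sum_(i <- r) F i x).
Proof.
move=> FL; elim: r => [|i r IH].
  by rewrite (_ : (fun _ => _) = (fun=> 0));
    [exact: L2_0|apply/funext => x; rewrite big_nil].
rewrite (_ : (fun _ => _) = (fun x => F i x + \sum_(j <- r) F j x)); first exact: L2D.
by apply/funext => x; rewrite big_cons.
Qed.

Lemma ipC f g : ip f g = ip g f.
Proof. by apply: eq_Rintegral => x _; rewrite mulrC. Qed.

Lemma ipDl f g h : L2 f -> L2 g -> L2 h ->
  ip (fun x => f x + g x) h = ip f h + ip g h.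
Proof.
move=> fL gL hL; rewrite -RintegralD//; try exact: L2M_integrable.
by apply: eq_Rintegral => x _; rewrite mulrDl.
Qed.

Lemma ipZl c f h : L2 f -> L2 h -> ip (fun x => c * f x) h = c * ip f h.
Proof.
move=> fL hL; rewrite -RintegralZl//; last exact: L2M_integrable.
by apply: eq_Rintegral => x _; rewrite mulrA.
Qed.

Lemma ipNl f h : L2 f -> L2 h -> ip (fun x => - f x) h = - ip f h.
Proof.
move=> fL hL; rewrite -mulN1r -ipZl//.
by apply: eq_Rintegral => x _; rewrite mulN1r.
Qed.

Lemma ipBl f g h : L2 f -> L2 g -> L2 h ->
  ip (fun x => f x - g x) h = ip f h - ip g h.
Proof. by move=> fL gL hL; rewrite ipDl ?ipNl//; exact: L2N. Qed.

Lemma ipDr f g h : L2 f -> L2 g -> L2 h ->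
  ip h (fun x => f x + g x) = ip h f + ip h g.
Proof. by move=> *; rewrite ipC ipDl// !(ipC h). Qed.

Lemma ipZr c f h : L2 f -> L2 h -> ip h (fun x => c * f x) = c * ip h f.
Proof. by move=> *; rewrite ipC ipZl// (ipC h). Qed.

Lemma ipBr f g h : L2 f -> L2 g -> L2 h ->
  ip h (fun x => f x - g x) = ip h f - ip h g.
Proof. by move=> *; rewrite ipC ipBl// !(ipC h). Qed.

Lemma ip_suml (I : Type) (r : seq I) (F : I -> 'rV[R]_d -> R) h :
  (forall i, L2 (F i)) -> L2 h ->
  ip (fun x => \sum_(i <- r) F i x) h = \sum_(i <- r) ip (F i) h.
Proof.
move=> FL hL; elim: r => [|i r IH].
  rewrite big_nil /ip; under eq_Rintegral do rewrite big_nil mul0r.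
  by rewrite Rintegral_cst// mul0r.
rewrite big_cons -IH -ipDl//; last exact: L2_sum.
by apply: eq_Rintegral => x _; rewrite big_cons.
Qed.

Lemma ip_ge0 f : 0 <= ip f f.
Proof. by apply: Rintegral_ge0 => x _; rewrite -expr2 sqr_ge0. Qed.

Lemma ip_sqrD f g : L2 f -> L2 g ->
  ip (fun x => f x + g x) (fun x => f x + g x) = ip f f + 2 * ip f g + ip g g.
Proof.
move=> fL gL; have fgL := L2D fL gL.
by rewrite ipDl// !ipDr// (ipC g f); ring.
Qed.

Lemma ip_sqrB f g : L2 f -> L2 g ->
  ip (fun x => f x - g x) (fun x => f x - g x) = ip f f - 2 * ip f g + ip g g.
Proof.
move=> fL gL; have fgL := L2B fL gL.
by rewrite ipBl// !ipBr// (ipC g f); ring.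
Qed.

Lemma ip_sqrZ c f : L2 f ->
  ip (fun x => c * f x) (fun x => c * f x) = c ^+ 2 * ip f f.
Proof. by move=> fL; rewrite ipZl ?ipZr//; [rewrite mulrA|exact: L2Z]. Qed.

Lemma ip_CS f g : L2 f -> L2 g -> `|ip f g| <= Num.sqrt (ip f f) * Num.sqrt (ip g g).
Proof.
move=> fL gL; rewrite -sqrtrM ?ip_ge0// -sqrtr_sqr ler_wsqrtr//.
set a := ip f f; set b := ip f g; set c := ip g g.
have h (t : R) : 0 <= a + 2 * t * b + t ^+ 2 * c.
  have := ip_ge0 (fun x => f x + t * g x); rewrite ip_sqrD//; last exact: L2Z.
  by rewrite ip_sqrZ// ipZr// -/a -/b -/c mulrA.
have a0 : 0 <= a by exact: ip_ge0.
have : 0 <= c by exact: ip_ge0.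
rewrite le_eqVlt => /predU1P[c0|c0].
  rewrite -c0 mulr0.
  have [->|b0] := eqVneq b 0; first by rewrite expr0n.
  (* For [c = 0] the polynomial is affine in [t]; this point gives it the value [-1]. *)
  have := h (- (a + 1) / (2 * b)); rewrite -c0 mulr0 addr0.
  rewrite (_ : 2 * _ * b = - (a + 1)); last by field.
  lra.
have := h (- b / c).
rewrite (_ : _ + _ = (a * c - b ^+ 2) / c); last by field; rewrite gt_eqF.
by rewrite pmulr_lge0 ?invr_gt0// subr_ge0.
Qed.

Lemma ip_eq0 f : L2 f -> ip f f = 0 -> ae_eq_on Omega f (fun=> 0).
Proof.
move=> fL ff0.
have mf : measurable_fun Omega (fun x => (f x * f x)%:E).
  by apply/measurable_EFinP; apply: measurable_funM; exact: L2_measurable.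
have /(ae_eq_integral_abs mu mO mf) : (\int[mu]_(x in Omega) `|(f x * f x)%:E| = 0)%E.
  have fi := L2M_integrable fL fL.
  rewrite (eq_integral (fun x => (f x * f x)%:E)); last first.
    by move=> x _; rewrite gee0_abs// lee_fin -expr2 sqr_ge0.
  have := ff0; rewrite /ip /Rintegral => h.
  rewrite -[LHS]fineK ?h//; exact: integrable_fin_num.
apply: filterS => x h Ox; have /= := h Ox.
by move=> [] /eqP; rewrite mulf_eq0 orbb => /eqP.
Qed.

Lemma ae_eq_ip f g h : L2 f -> L2 g -> L2 h -> ae_eq_on Omega f g -> ip f h = ip g h.
Proof.
move=> fL gL hL fg; congr fine; apply: ae_eq_integral => //.
- by apply/measurable_EFinP; apply: measurable_funM; exact: L2_measurable.
- by apply/measurable_EFinP; apply: measurable_funM; exact: L2_measurable.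
- by apply: filterS fg => x h' Ox; rewrite h'.
Qed.

Lemma L2_cvgE (v : nat -> 'rV[R]_d -> R) u : L2_cvg Omega v u =
  ((fun k => ip (fun x => v k x - u x) (fun x => v k x - u x)) @ \oo --> (0 : R)).
Proof. by []. Qed.

Lemma L2_cvg_ip (v w : nat -> 'rV[R]_d -> R) u h : (forall k, L2 (v k)) -> L2 u -> (forall k, L2 (w k)) -> L2 h ->
  L2_cvg Omega v u -> L2_cvg Omega w h ->
  (fun k => ip (v k) (w k)) @ \oo --> ip u h.
Proof.
move=> vL uL wL hL; rewrite !L2_cvgE => vu wh.
pose p k := Num.sqrt (ip (fun x => v k x - u x) (fun x => v k x - u x)).
pose q k := Num.sqrt (ip (fun x => w k x - h x) (fun x => w k x - h x)).
have p0 : p @ \oo --> (0 : R).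
  by rewrite -(@sqrtr0 R); apply: continuous_cvg => //; exact: sqrt_continuous.
have q0 : q @ \oo --> (0 : R).
  by rewrite -(@sqrtr0 R); apply: continuous_cvg => //; exact: sqrt_continuous.
pose b k := p k * q k + (p k * Num.sqrt (ip h h) + Num.sqrt (ip u u) * q k).
have b0 : b @ \oo --> (0 : R).
  rewrite (_ : 0 = 0 * 0 + (0 * Num.sqrt (ip h h) + Num.sqrt (ip u u) * 0)); last by rewrite !mul0r mulr0 !addr0.
  apply: cvgD; first exact: cvgM.
  by apply: cvgD; [exact: cvgMl|exact: cvgMr].
apply/cvgrPdist_le => e e0; move/cvgrPdist_le: b0 => /(_ e e0).
apply: filterS => k; rewrite sub0r normrN => bk.
apply: le_trans (le_trans (ler_norm _) bk).
have -> : ip u h - ip (v k) (w k) = - (ip (fun x => v k x - u x) (fun x => w k x - h x)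
    + (ip (fun x => v k x - u x) h + ip u (fun x => w k x - h x))).
  by rewrite !ipBl// ?ipBr//; [ring|exact: L2B].
rewrite normrN; apply: le_trans (ler_normD _ _) _; apply: lerD.
  by apply: ip_CS; exact: L2B.
by apply: le_trans (ler_normD _ _) _; apply: lerD; apply: ip_CS => //; exact: L2B.
Qed.

Lemma L2_cvg_cst u : L2_cvg Omega (fun=> u) u.
Proof.
rewrite L2_cvgE (_ : (fun _ => _) = fun=> 0); first exact: cvg_cst.
apply/funext => _; rewrite /ip; under eq_Rintegral do rewrite subrr mul0r.
by rewrite Rintegral_cst// mul0r.
Qed.

(** The two sides differ by the square norm of [f - g]. This stands in for the triangle inequality
    and keeps square roots out of the estimates. *)
Lemma ip_sqrD_le f g : L2 f -> L2 g ->
  ip (fun x => f x + g x) (fun x => f x + g x) <= 2 * ip f f + 2 * ip g g.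
Proof.
move=> fL gL; rewrite ip_sqrD//; have := ip_ge0 (fun x => f x - g x).
by rewrite ip_sqrB//; lra.
Qed.

Lemma L2_cvgD (v w : nat -> 'rV[R]_d -> R) u h :
  (forall k, L2 (v k)) -> L2 u -> (forall k, L2 (w k)) -> L2 h ->
  L2_cvg Omega v u -> L2_cvg Omega w h ->
  L2_cvg Omega (fun k x => v k x + w k x) (fun x => u x + h x).
Proof.
move=> vL uL wL hL; rewrite !L2_cvgE => vu wh.
apply: (@squeeze_cvgr _ _ _ _ (fun=> 0) (fun k =>
    2 * ip (fun x => v k x - u x) (fun x => v k x - u x) +
    2 * ip (fun x => w k x - h x) (fun x => w k x - h x))).
- apply: nearW => k; rewrite ip_ge0/=.
  apply: le_trans (ip_sqrD_le _ _); [|exact: L2B|exact: L2B].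
  by rewrite le_eqVlt; apply/predU1l/eq_Rintegral => x _; congr (_ * _); ring.
- exact: cvg_cst.
- rewrite -[0]addr0 -[X in _ --> X + _](mulr0 2) -[X in _ --> _ + X](mulr0 2).
  by apply: cvgD; exact: cvgMr.
Qed.

Lemma L2_cvgZ c (v : nat -> 'rV[R]_d -> R) u :
  (forall k, L2 (v k)) -> L2 u ->
  L2_cvg Omega v u -> L2_cvg Omega (fun k x => c * v k x) (fun x => c * u x).
Proof.
move=> vL uL; rewrite !L2_cvgE => vu.
rewrite (_ : (fun _ => _) =
    (fun k => c ^+ 2 * ip (fun x => v k x - u x) (fun x => v k x - u x))).
  by rewrite -(mulr0 (c ^+ 2)); exact: cvgMr.
apply/funext => k; rewrite -ip_sqrZ; last exact: L2B.
by apply: eq_Rintegral => x _; rewrite -mulrBr.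
Qed.

Lemma L2_cvg_sum (I : Type) (r : seq I) (v : I -> nat -> 'rV[R]_d -> R)
    (u : I -> 'rV[R]_d -> R) :
  (forall i k, L2 (v i k)) -> (forall i, L2 (u i)) ->
  (forall i, L2_cvg Omega (v i) (u i)) ->
  L2_cvg Omega (fun k x => \sum_(i <- r) v i k x) (fun x => \sum_(i <- r) u i x).
Proof.
move=> vL uL vu; elim: r => [|i r IH].
  rewrite (_ : (fun _ => _) = (fun _ _ => 0)); last first.
    by apply/funext => k; apply/funext => x; rewrite big_nil.
  rewrite (_ : (fun x => \sum_(i <- [::]) u i x) = (fun=> 0)).
    exact: L2_cvg_cst.
  by apply/funext => x; rewrite big_nil.
rewrite (_ : (fun _ => _) = (fun k x => v i k x + \sum_(j <- r) v j k x)); last first.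
  by apply/funext => k; apply/funext => x; rewrite big_cons.
rewrite (_ : (fun x => \sum_(i <- i :: r) u i x) = (fun x => u i x + \sum_(j <- r) u j x)).
  by apply: L2_cvgD => // [k|]; exact: L2_sum.
by apply/funext => x; rewrite big_cons.
Qed.

Let sqr_int (f : 'rV[R]_d -> R) := (\int[mu]_(x in Omega) (f x ^+ 2)%:E)%E.

Let sqr_intE f : L2 f -> sqr_int f = (ip f f)%:E.
Proof.
move=> fL; rewrite /ip /Rintegral fineK; last first.
  exact: integrable_fin_num (L2M_integrable fL fL).
by apply: eq_integral => x _; rewrite expr2.
Qed.

(* Riesz-Fischer along a fast subsequence: [4 ^ k (w (k+1) - w k) ^ 2] is
   summable a.e., hence so is [w (k+1) - w k]. *)
Let L2_fast_limit (w : nat -> 'rV[R]_d -> R) : (forall k, L2 (w k)) ->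
  (forall k j, (k <= j)%N ->
    ip (fun x => w j x - w k x) (fun x => w j x - w k x) <= 16^-1 ^+ k) ->
  exists u, forall k, L2 (fun x => u x - w k x) /\
    ip (fun x => u x - w k x) (fun x => u x - w k x) <= 16^-1 ^+ k.
Proof.
move=> wL wC.
have mw k : measurable_fun Omega (fun x => (w k x)%:E).
  by apply/measurable_EFinP; exact: L2_measurable.
have mdw j k : measurable_fun Omega (fun x => w j x - w k x).
  by apply: L2_measurable; exact: L2B.
pose F_ k x : \bar R := (4 ^+ k * (w k.+1 x - w k x) ^+ 2)%:E.
pose F x := (\sum_(0 <= k <oo) F_ k x)%E.
have F_0 k x : (0 <= F_ k x)%E by rewrite lee_fin mulr_ge0 ?sqr_ge0 ?exprn_ge0.
have mF_ k : measurable_fun Omega (F_ k).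
  apply/measurable_EFinP; apply: measurable_funM => //.
  by apply: measurable_funX; exact: mdw.
have mF : measurable_fun Omega F.
  exact: (ge0_emeasurable_sum (h := F_) (P := xpredT)).
have F0 x : (0 <= F x)%E by apply: nneseries_ge0.
have Foo : mu.-integrable Omega F.
  apply/integrableP; split => //.
  rewrite (eq_integral F); last by move=> x _; rewrite gee0_abs.
  rewrite /F integral_nneseries//.
  apply: (@le_lt_trans _ _ 2%:E); last exact: ltry.
  apply: lime_le.
    by apply: is_cvg_nneseries => n _ _; exact: integral_ge0.
  apply: nearW => n.
  (* The rate [16^-k] of the hypothesis absorbs the weight [4 ^ k] and leaves [4^-k], whose sum
     stays below 2. *)
  apply: (@le_trans _ _ (\sum_(0 <= k < n) (4^-1 ^+ k)%:E)%E).
    apply: lee_sum => k _.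
    rewrite (_ : (fun x => F_ k x) = (fun x => ((2 ^+ k * (w k.+1 x - w k x)) ^+ 2)%:E)).
      rewrite -/(sqr_int _) sqr_intE; last by apply: L2Z; exact: L2B.
      rewrite lee_fin ip_sqrZ; last exact: L2B.
      have := wC k k.+1 (leqnSn k).
      move/(ler_wpM2l (exprn_ge0 2 (exprn_ge0 k (ler0n R 2)))).
      move/le_trans; apply; rewrite -exprM mulnC exprM -exprMn le_eqVlt.
      by apply/predU1l; congr (_ ^+ _); field.
    apply/funext => x; rewrite /F_ exprMn -exprM mulnC exprM.
    by congr (_ * _)%:E; congr (_ ^+ _); ring.
  rewrite sumEFin lee_fin.
  suff : \sum_(0 <= k < n) 4^-1 ^+ k <= 2 - 2 * 4^-1 ^+ n :> R.
    by move/le_trans; apply; rewrite gerBl mulr_ge0 ?exprn_ge0.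
  elim: n => [|n IH]; first by rewrite big_nil expr0; lra.
  rewrite big_nat_recr//= exprS.
  have : 0 <= 4^-1 ^+ n :> R by rewrite exprn_ge0.
  by move: IH; set s := \sum_(_ <= _ < _) _; set t := _ ^+ n; lra.
(* The limsup is measurable and defined everywhere, so no null set has to be removed; it equals the
   limit wherever the sequence converges. *)
pose u x := fine (limn_esup (fun k => (w k x)%:E)).
have mu_ : measurable_fun Omega u.
  apply: (measurableT_comp (f := fine)); first exact: fine_measurable.
  exact: (measurable_fun_limn_esup (f := fun k x => (w k x)%:E)).
have cvgw : {ae mu, forall x, Omega x -> w ^~ x @ \oo --> u x}.
  have := integrable_ae mO Foo.
  apply: filterS => x + Ox => /(_ Ox) Fx.
  set C := fine (F x).
  have C0 : 0 <= C by apply: fine_ge0; exact: F0.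
  (* A single term of the series is at most its sum [C], and dividing by the weight [4 ^ k] leaves a
     geometric bound on the increment. *)
  have wk k : `|w k.+1 x - w k x| <= geometric (Num.sqrt C) 2^-1 k.
    have : (F_ k x <= F x)%E.
      apply: le_trans (nneseries_lim_ge k.+1 _) => [|n _ _]; last exact: F_0.
      by rewrite big_nat_recr//= leeDr// sume_ge0// => n _; exact: F_0.
    rewrite -(fineK Fx) lee_fin -/C => h.
    rewrite /geometric /= -sqrtr_sqr exprVn -(@ler_pM2r _ (2 ^+ k)) ?exprn_gt0//.
    rewrite -mulrA mulVf ?mulr1 ?expf_neq0// -(@ger0_norm _ (2 ^+ k)) ?exprn_ge0//.
    rewrite -sqrtr_sqr -sqrtrM ?sqr_ge0// ler_wsqrtr//.
    apply: le_trans h; rewrite -exprM mulnC exprM mulrC le_eqVlt; apply/predU1l.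
    by congr (_ * _); congr (_ ^+ _); ring.
  have cw : cvgn (fun k => w k x).
    have -> : (fun k => w k x) = (fun n => w 0 x + series (telescope (w ^~ x)) n).
      by apply/funext => n; rewrite [LHS](eq_sum_telescope (w ^~ x) n).
    apply: is_cvgD; first exact: is_cvg_cst.
    apply: normed_cvg; apply: series_le_cvg wk _ => //.
      by move=> n; rewrite mulr_ge0 ?sqrtr_ge0 ?exprn_ge0.
    apply: is_cvg_geometric_series; rewrite ger0_norm//.
    by rewrite invf_lt1// ltr1n.
  suff -> : u x = limn (fun k => w k x) by [].
  rewrite /u (cvg_limn_einf_sup (l := (limn (fun k => w k x))%:E))//.
  by apply/cvg_EFin => //; exact: nearW.
exists u => k.
have mduw : measurable_fun Omega (fun x => u x - w k x).
  by apply: measurable_funB => //; exact: L2_measurable.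
(* Fatou's lemma lets [j] tend to infinity in the bound [wC k j]. *)
have le16 : (sqr_int (fun x => (u x - w k x)%R) <= (16^-1 ^+ k)%:E)%E.
  pose f j x : \bar R := ((w j x - w k x) ^+ 2)%:E.
  have mf j : measurable_fun Omega (f j).
    by apply/measurable_EFinP; apply: measurable_funX; exact: mdw.
  apply: (@le_trans _ _ (\int[mu]_(x in Omega) limn_einf (f ^~ x))%E).
    apply: ae_ge0_le_integral => //.
    - by move=> x _; rewrite lee_fin sqr_ge0.
    - by apply/measurable_EFinP; exact: measurable_funX.
    - move=> x _; rewrite limn_einf_lim; apply: lime_ge; first exact: is_cvg_einfs.
      by apply: nearW => n; apply: le_ereal_inf_tmp => _ [j /= _ <-]; rewrite lee_fin sqr_ge0.
    - apply: (measurableT_comp (f := -%E)) => //.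
      apply: (measurable_fun_limn_esup (f := fun j x => - f j x)%E) => j.
      exact: (measurableT_comp (f := -%E)).
    apply: filterS cvgw => x + Ox => /(_ Ox) wux.
    rewrite (cvg_limn_einf_sup (l := ((u x - w k x) ^+ 2)%:E))//.
    apply/cvg_EFin; first exact: nearW.
    apply: (cvg_comp _ (fun y : R => y ^+ 2) (cvgB wux (cvg_cst _))).
    exact: exprn_continuous.
  apply: le_trans (fatou mu mO mf _) _; first by move=> n x _; rewrite lee_fin sqr_ge0.
  rewrite limn_einf_lim; apply: lime_le; first exact: is_cvg_einfs.
  apply: nearW => n; apply: (@le_trans _ _ (sqr_int (fun x => w (n + k)%N x - w k x))).
    by apply: ereal_inf_lbound; exists (n + k)%N => //=; exact: leq_addr.
  by rewrite sqr_intE ?lee_fin ?wC ?leq_addl//; exact: L2B.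
have uwL : L2 (fun x => u x - w k x).
  split => //; apply/integrableP; split.
    by apply/measurable_EFinP; exact: measurable_funX.
  rewrite (eq_integral (fun x => ((u x - w k x) ^+ 2)%:E)).
    by apply: le_lt_trans le16 _; exact: ltry.
  by move=> x _; rewrite gee0_abs// lee_fin sqr_ge0.
by split=> //; rewrite -lee_fin -sqr_intE.
Qed.

Lemma L2_complete (v : nat -> 'rV[R]_d -> R) : (forall k, L2 (v k)) ->
  (forall e, 0 < e -> exists N, forall i j, (N <= i)%N -> (N <= j)%N ->
    ip (fun x => v i x - v j x) (fun x => v i x - v j x) <= e) ->
  exists2 u, L2 u & L2_cvg Omega v u.
Proof.
move=> vL vC.
have /choice[N NP] k : exists N, forall i j, (N <= i)%N -> (N <= j)%N ->
    ip (fun x => v i x - v j x) (fun x => v i x - v j x) <= 16^-1 ^+ k.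
  by apply: vC; rewrite exprn_gt0.
(* With the maximum in place of [N k], the index [s j] is admissible for every precision
   [k <= j]. *)
pose s k := (\max_(i < k.+1) N i)%N.
have Ns k j : (k <= j)%N -> (N k <= s j)%N.
  move=> kj; have kj1 : (k < j.+1)%N by rewrite ltnS.
  exact: (@leq_bigmax _ (fun i : 'I_j.+1 => N i) (Ordinal kj1)).
have [u uP] : exists u, forall k, L2 (fun x => u x - v (s k) x) /\
    ip (fun x => u x - v (s k) x) (fun x => u x - v (s k) x) <= 16^-1 ^+ k.
  apply: (@L2_fast_limit (v \o s)) => [k|k j kj]; first exact: vL.
  by apply: NP; apply: Ns.
have uL : L2 u.
  rewrite (_ : u = (fun x => (u x - v (s 0%N) x) + v (s 0%N) x)).
    by apply: L2D => //; have [] := uP 0%N.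
  by apply/funext => x; rewrite subrK.
exists u => //; rewrite L2_cvgE.
apply/cvgrPdist_le => e e0.
(* The factor 4 comes from [ip_sqrD_le] applied to [v n - v (s k)] and [v (s k) - u], each of square
   norm at most [16^-k]. *)
have : (fun k => 4 * 16^-1 ^+ k) @ \oo --> (0 : R).
  rewrite -(mulr0 4); apply: cvgMr; apply: cvg_expr.
  by rewrite ger0_norm// invf_lt1// ltr1n.
move=> /cvgrPdist_le/(_ e e0)[k _ /(_ k (leqnn k))].
rewrite sub0r normrN ger0_norm ?mulr_ge0 ?exprn_ge0// => ke.
exists (N k) => // n /= kn; rewrite sub0r normrN ger0_norm ?ip_ge0//.
apply: le_trans ke.
have [duL du] := uP k.
have := ip_sqrD_le (L2B (vL n) (vL (s k))) (L2N duL).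
rewrite (_ : (fun x => v n x - v (s k) x + _) = (fun x => v n x - u x)); last first.
  by apply/funext => x; ring.
move/le_trans; apply.
have -> : ip (fun x => - (u x - v (s k) x)) (fun x => - (u x - v (s k) x)) =
    ip (fun x => u x - v (s k) x) (fun x => u x - v (s k) x).
  by apply: eq_Rintegral => x _; rewrite mulrNN.
have := NP k n (s k) kn (Ns _ _ (leqnn k)); lra.
Qed.

End L2_space.

(** * Smooth functions *)

Section lines.
Context (R : realType) (V : normedModType R).

Lemma is_derive_line (h : V -> R) (p v : V) (s df : R) :
  is_derive (p + s *: v) v h df -> is_derive s 1 (fun t : R => h (p + t *: v)) df.
Proof.
have E : (fun t : R => t^-1 *: (((fun t : R => h (p + t *: v)) \o shift s) (t *: 1) - h (p + s *: v)))
   = (fun t : R => t^-1 *: ((h \o shift (p + s *: v)) (t *: v) - h (p + s *: v))).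
  apply/funext => t /=; congr (_ *: (h _ - _)).
  by rewrite scaler1 scalerDl addrCA.
by case=> dh Dh; apply: DeriveDef; rewrite /derivable /derive E.
Qed.

(** Locating the point by [|c| <= |s|] covers both signs of [s], and [s = 0], in one statement. *)
Lemma line_MVT (h df : V -> R) (p v : V) (s : R) :
  (forall x, is_derive x v h (df x)) ->
  exists2 c, `|c| <= `|s| & h (p + s *: v) - h p = s * df (p + c *: v).
Proof.
move=> hd; pose phi t := h (p + t *: v).
have dphi (t : R) : is_derive t (1 : R) phi (df (p + t *: v)) by exact: is_derive_line.
have cphi : continuous phi.
  by move=> t; apply/differentiable_continuous/derivable1_diffP; have [] := dphi t.
have mvt a b : a < b -> exists2 c, c \in `]a, b[ & phi b - phi a = df (p + c *: v) * (b - a).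
  move=> ab; apply: (@MVT R phi (fun t => df (p + t *: v)) _ _ ab).
  exact: continuous_subspaceT.
have phi0 : phi 0 = h p by rewrite /phi scale0r addr0.
have [s0|s0|<-] := ltgtP 0 s.
- have [c] := mvt _ _ s0; rewrite in_itv /= => /andP[c0 cs] E; exists c.
    by rewrite !gtr0_norm// ltW.
  by rewrite -/(phi s) -phi0 E subr0 mulrC.
- have [c] := mvt _ _ s0; rewrite in_itv /= => /andP[sc c0] E; exists c.
    by rewrite !ltr0_norm// lerN2 ltW.
  by rewrite -/(phi s) -phi0 -opprB E sub0r mulrN opprK mulrC.
- by exists 0 => //; rewrite scale0r addr0 subrr mul0r.
Qed.

End lines.

(** * Directional derivatives, smooth functions and flat exponentials *)

Section C1.
Context (R : realType) (d : nat).
Implicit Types (h : 'rV[R]_d -> R) (x v : 'rV[R]_d).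

Lemma row_basis_sum v : v = \sum_i v ord0 i *: basis_vec R i.
Proof. exact: row_sum_delta. Qed.

(** The segment from [x] to [x + t v] is replaced by a path that changes one coordinate at a time.
    The mean value theorem applies on each edge, and continuity of the partial derivatives gives the
    limit. *)
Lemma is_derive_C1 h x v :
  (forall i x, derivable h x (basis_vec R i)) ->
  (forall i, continuous (partial i h)) ->
  is_derive x v h (\sum_i v ord0 i * partial i h x).
Proof.
move=> dh ch.
have hd i y : is_derive y (basis_vec R i) h (partial i h y) by apply: DeriveDef.
(* The vertices of the path: [p t n] has received the first [n] coordinates of [t v]. *)
pose p (t : R) n := x + t *: \sum_(i < d | (i < n)%N) v ord0 i *: basis_vec R i.
suff cvg_quot : (fun t : R => t^-1 *: ((h \o shift x) (t *: v) - h x)) @ 0^' -->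
    \sum_i v ord0 i * partial i h x.
  apply: DeriveDef; first by apply/cvg_ex; eexists; exact: cvg_quot.
  exact: cvg_lim.
have step (t : R) (i : 'I_d) : exists2 c : R, `|c| <= `|t| * `|v ord0 i| &
    h (p t i.+1) - h (p t i) = t * v ord0 i * partial i h (p t i + c *: basis_vec R i).
  have [c] := line_MVT (p t i) (t * v ord0 i) (hd i).
  rewrite normrM => c1 E; exists c => //; rewrite -E; congr (h _ - _).
  rewrite /p (bigD1 i)//= scalerDr scalerA [X in x + X]addrC addrA; congr (_ + _ *: _ + _).
  apply: eq_bigl => j; rewrite ltnS leq_eqVlt andbC.
  have [->|ji] /= := eqVneq j i; first by rewrite ltnn.
  by rewrite -val_eqE in ji; rewrite (negbTE ji).
have /choice[c cP] (q : R * 'I_d) : exists c : R, `|c| <= `|q.1| * `|v ord0 q.2| /\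
    h (p q.1 q.2.+1) - h (p q.1 q.2) =
      q.1 * v ord0 q.2 * partial q.2 h (p q.1 q.2 + c *: basis_vec R q.2).
  by have [c ? ?] := step q.1 q.2; exists c.
have tele (t : R) : t != 0 -> t^-1 *: (h (t *: v + x) - h x) =
    \sum_i v ord0 i * partial i h (p t i + c (t, i) *: basis_vec R i).
  move=> t0.
  have -> : t *: v + x = p t d.
    by rewrite /p addrC {1}(row_basis_sum v); congr (_ + _ *: _); apply: eq_bigl => i; rewrite ltn_ord.
  have -> : h x = h (p t 0%N) by rewrite /p big_pred0_eq scaler0 addr0.
  rewrite -(telescope_sumr (fun n => h (p t n)) (leq0n d)) big_mkord scaler_sumr.
  apply: eq_bigr => i _; have [_ /= ->] := cP (t, i).
  by rewrite /GRing.scale /= !mulrA mulVf// mul1r.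
(* The intermediate point is within [|t| * K] of [x], whatever the value [c (t, i)] picked by
   choice. *)
have cvgp (i : 'I_d) : (fun t : R => p t i + c (t, i) *: basis_vec R i) @ 0^' --> x.
  pose K := `|\sum_(j < d | (j < i)%N) v ord0 j *: basis_vec R j| + `|v ord0 i| * `|basis_vec R i|.
  have K1 : 0 < K + 1 by rewrite ltr_wpDl// addr_ge0 ?mulr_ge0.
  apply/cvgrPdist_le => e e0; near=> t.
  rewrite /p -addrA opprD addrA subrr sub0r normrN.
  apply: (@le_trans _ _ (`|t| * K)).
    apply: le_trans (ler_normD _ _) _; rewrite mulrDr !normrZ lerD2l mulrA ler_wpM2r//.
    by have [] := cP (t, i).
  apply: (@le_trans _ _ (e / (K + 1) * K)).
    rewrite ler_wpM2r ?addr_ge0 ?mulr_ge0//; near: t.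
    by apply: dnbhs0_le; exact: divr_gt0.
  by rewrite mulrAC ler_pdivrMr// ler_wpM2l ?lerDl// ltW.
apply: (@cvg_trans _ ((fun t : R => \sum_i v ord0 i * partial i h (p t i + c (t, i) *: basis_vec R i)) @ 0^')).
  apply: near_eq_cvg; near=> t; rewrite /= tele//; near: t; exact: nbhs_dnbhs_neq.
apply: cvg_big => [|i _]; first exact: add_continuous.
apply: cvgMr.
exact: (cvg_comp _ _ (cvgp i) (ch i x)).
Unshelve. all: by end_near.
Qed.

Definition smooth h := forall m, Ck m setT h.

Lemma smooth_continuous h : smooth h -> continuous h.
Proof. by move=> sh x; have [] := sh 0%N [::] isT x I. Qed.

Lemma smooth_derivable h i x : smooth h -> derivable h x (basis_vec R i).
Proof. by move=> sh; have [_] := sh 1%N [::] isT x I; exact. Qed.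

Lemma smooth_partial h i : smooth h -> smooth (partial i h).
Proof.
move=> sh m s sm x _; have := sh m.+1 (rcons s i).
by rewrite /iter_partial foldr_rcons size_rcons => /(_ sm x I)[].
Qed.

(** The induction on lists of partial derivatives is done once here; a smoothness proof then only
    has to exhibit a class stable under [partial]. *)
Lemma smooth_coind (C : ('rV[R]_d -> R) -> Prop) :
  (forall h, C h -> [/\ continuous h, forall i x, derivable h x (basis_vec R i) &
    forall i, C (partial i h)]) ->
  forall h, C h -> smooth h.
Proof.
move=> HC h Ch m s _ x _.
have Cs : C (iter_partial s h) by elim: s => //= i s /HC[].
by have [cs ds _] := HC _ Cs; split=> [|_ i]; [exact: cs|exact: ds].
Qed.

Lemma smooth_is_derive h x v : smooth h ->
  is_derive x v h (\sum_i v ord0 i * partial i h x).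
Proof.
move=> sh; apply: is_derive_C1 => i; first by move=> y; exact: smooth_derivable.
exact/smooth_continuous/smooth_partial.
Qed.

Lemma isometry_continuous (S : Defs.isometry R d) : continuous (isometry_fun S).
Proof.
have -> : isometry_fun S = (fun x : 'rV[R]_d =>
    \sum_i x ord0 i *: row i (val S).1^T + (val S).2).
  by apply/funext => x; rewrite isometry_funE mulmx_sum_row.
suff cF (F : set_system 'rV[R]_d) (FF : Filter F) (x : 'rV[R]_d) : F --> x ->
    (fun y : 'rV[R]_d => \sum_i y ord0 i *: row i (val S).1^T + (val S).2) @ F -->
    \sum_i x ord0 i *: row i (val S).1^T + (val S).2.
  by move=> x; apply: (cF (nbhs x)).
move=> Fx; apply: cvgD; last exact: cvg_cst.
apply: cvg_big => [|i _]; first exact: add_continuous.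
by apply: cvgZr_tmp; exact: (cvg_comp _ _ Fx (@coord_continuous _ _ _ _ _ _)).
Qed.

Lemma is_derive_isometry (S : Defs.isometry R d) h i x : smooth h ->
  is_derive x (basis_vec R i) (h \o isometry_fun S)
    (\sum_j (val S).1 j i * partial j h (isometry_fun S x)).
Proof.
move=> sh; have := smooth_is_derive (isometry_fun S x) (basis_vec R i *m (val S).1^T) sh.
under eq_bigr => j _.
  rewrite (_ : (basis_vec R i *m _) ord0 j = (val S).1 j i); last first.
    by rewrite -rowE !mxE.
  over.
case=> dh Dh.
have E : (fun t : R => t^-1 *: (((h \o isometry_fun S) \o shift x) (t *: basis_vec R i) - (h \o isometry_fun S) x))
  = (fun t : R => t^-1 *: ((h \o shift (isometry_fun S x)) (t *: (basis_vec R i *m (val S).1^T)) - h (isometry_fun S x))).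
  apply/funext => t /=; congr (_ *: (h _ - _)).
  by rewrite !isometry_funE mulmxDl -scalemxAl addrA.
by apply: DeriveDef; rewrite /derivable /derive E.
Qed.

(** The functions [t^-n exp(-1/t)], extended by 0. Keeping [n] as a parameter makes the family
    stable under differentiation up to linear combinations, so no polynomial factors need to be
    tracked. *)
Definition exp_flat (n : nat) (t : R) : R :=
  if 0 < t then (t^-1) ^+ n * expR (- t^-1) else 0.

Lemma exp_flat_ge0 n t : 0 <= exp_flat n t.
Proof.
rewrite /exp_flat; case: ifP => // t0.
by rewrite mulr_ge0 ?expR_ge0// exprn_ge0// invr_ge0 ltW.
Qed.

(** With [y = 1 / t], this is [exp y >= (y / (n + 2)) ^ (n + 2)]. Quadratic decay is what makes the
    derivative at 0 vanish. *)
Lemma exp_flat_le n t : exp_flat n t <= n.+2%:R ^+ n.+2 * t ^+ 2.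
Proof.
rewrite /exp_flat; case: ifP => [t0|_]; last by rewrite mulr_ge0 ?sqr_ge0 ?exprn_ge0.
set y := t^-1; have y0 : 0 < y by rewrite invr_gt0.
have ht : t = y^-1 by rewrite invrK.
have ye : (y / n.+2%:R) ^+ n.+2 <= expR y.
  have -> : expR y = expR (n.+2%:R * (y / n.+2%:R)) by rewrite mulrC divfK ?pnatr_eq0.
  rewrite [leRHS]expRM_natl lerXn2r ?nnegrE ?expR_ge0//.
    by rewrite divr_ge0// ltW.
  by apply: le_trans (expR_ge1Dx _); rewrite lerDr.
rewrite expRN ler_pdivrMr ?expR_gt0// ht -(@ler_pM2r _ (y ^+ 2)) ?exprn_gt0//.
rewrite -exprD addn2.
have -> : n.+2%:R ^+ n.+2 * y^-1 ^+ 2 * expR y * y ^+ 2 = n.+2%:R ^+ n.+2 * expR y.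
  by set C := _ ^+ n.+2; field; rewrite gt_eqF.
have := ler_wpM2l (exprn_ge0 n.+2 (ler0n R n.+2)) ye.
by rewrite exprMn mulrCA -exprMn divff ?expr1n ?mulr1 ?pnatr_eq0.
Qed.

Lemma is_derive_exp_flat n t :
  is_derive t (1 : R) (exp_flat n) (exp_flat n.+2 t - n%:R * exp_flat n.+1 t).
Proof.
have [t0|t0|->] := ltgtP t 0.
- rewrite /exp_flat (lt_gtF t0) mulr0 subr0.
  apply: (@near_eq_is_derive _ _ _ (cst 0)).
  near=> u; rewrite /exp_flat ifF//; apply/negbTE; rewrite -leNgt ltW//.
  by near: u; exact: lt_nbhsl.
- rewrite /exp_flat t0.
  apply: (@near_eq_is_derive _ _ _ ((fun u : R => u^-1) ^+ n * (fun u : R => expR (- u^-1)))).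
  + near=> u; have u0 : 0 < u by near: u; exact: lt_nbhsr.
    by rewrite u0 !fctE.
  + have tn0 : t != 0 by rewrite gt_eqF.
    have dV : is_derive t (1 : R) (fun u : R => u^-1) (- t ^- 2).
      have := is_deriveV (f := id) tn0 (is_derive_id t (1 : R)).
      by move=> h; apply: is_derive_eq h _; rewrite scaler1.
    have dE : is_derive t (1 : R) (fun u : R => expR (- u^-1)) (expR (- t^-1) * - - t ^- 2).
      apply: (is_derive1_comp (f := expR) (g := fun u => - u^-1)).
    have := is_deriveM (is_deriveX n dV) dE.
    move=> h; apply: is_derive_eq h _; rewrite /GRing.scale /= !fctE opprK.
    case: (n) => [|k] /=; first by rewrite !exprS expr0; field.
    by rewrite !exprS; set a := t^-1 ^+ k; field.
(* At 0 the difference quotient is [exp_flat n u / u], which the quadratic bound makes of order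
   [|u|]. *)
- have -> : exp_flat n.+2 0 - n%:R * exp_flat n.+1 0 = 0.
    by rewrite /exp_flat ltxx mulr0 subr0.
  suff cv : (fun u : R => u^-1 *: ((exp_flat n \o shift 0) (u *: (1:R)) - exp_flat n 0)) @ 0^' --> (0 : R).
    apply: DeriveDef; first by apply/cvg_ex; eexists; exact: cv.
    exact: cvg_lim.
  have -> : (fun u : R => u^-1 *: ((exp_flat n \o shift 0) (u *: (1:R)) - exp_flat n 0)) =
      (fun u : R => u^-1 * exp_flat n u).
    by apply/funext => u /=; rewrite scaler1 addr0 {2}/exp_flat ltxx subr0.
  apply/cvgrPdist_le => e e0; near=> u; rewrite sub0r normrN normrM.
  have un0 : u != 0 by near: u; exact: nbhs_dnbhs_neq.
  rewrite (ger0_norm (exp_flat_ge0 _ _)) normfV ler_pdivrMl ?normr_gt0//.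
  apply: le_trans (exp_flat_le _ _) _.
  rewrite -real_normK ?num_real// expr2 mulrCA ler_wpM2l//.
  rewrite -ler_pdivlMl ?exprn_gt0//.
  by near: u; apply: dnbhs0_le; rewrite mulr_gt0 ?invr_gt0 ?exprn_gt0.
Unshelve. all: by end_near.
Qed.

(* A class of functions stable under [partial], so that smoothness of products
   and compositions follows by coinduction, without any Leibniz formula. *)
Inductive smooth_gen : ('rV[R]_d -> R) -> Prop :=
| gen_smooth h : smooth h -> smooth_gen h
| gen_isometry S h : smooth h -> smooth_gen (h \o isometry_fun S)
| gen_flat n i s c : smooth_gen (fun x => exp_flat n (c + s * x ord0 i))
| gen_cst c : smooth_gen (cst c)
| gen_add f g : smooth_gen f -> smooth_gen g -> smooth_gen (f + g)
| gen_mul f g : smooth_gen f -> smooth_gen g -> smooth_gen (f * g).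

Lemma gen_sum (I : Type) (r : seq I) (F : I -> 'rV[R]_d -> R) :
  (forall i, smooth_gen (F i)) -> smooth_gen (fun x => \sum_(i <- r) F i x).
Proof.
move=> gF; elim: r => [|i r IH].
  rewrite (_ : (fun _ => _) = cst 0); first exact: gen_cst.
  by apply/funext => x; rewrite big_nil.
rewrite (_ : (fun _ => _) = F i + (fun x => \sum_(j <- r) F j x)).
  exact: gen_add.
by apply/funext => x; rewrite big_cons.
Qed.

Lemma smooth_gen_smooth h : smooth_gen h -> smooth h.
Proof.
apply: smooth_coind => {}h.
elim=> {h} [h sh|S h sh|n i s c|c|f g _ [cf df gf] _ [cg dg gg]|f g Gf [cf df gf] Gg [cg dg gg]].
- split; first exact: smooth_continuous.
    by move=> i x; exact: smooth_derivable.
  by move=> i; apply/gen_smooth/smooth_partial.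
- split.
  + move=> x; apply: continuous_comp; first exact: isometry_continuous.
    exact: smooth_continuous.
  + by move=> i x; have [] := is_derive_isometry S i x sh.
  + move=> i.
    rewrite (_ : partial i _ = (fun x => \sum_j (cst ((val S).1 j i) *
        (partial j h \o isometry_fun S)) x)); last first.
      by apply/funext => x; have [_] := is_derive_isometry S i x sh.
    apply: gen_sum => j; apply: gen_mul; first exact: gen_cst.
    exact/gen_isometry/smooth_partial.
- pose g := fun t : R => exp_flat n.+2 t - n%:R * exp_flat n.+1 t.
  have D j x : is_derive x (basis_vec R j) (fun x : 'rV[R]_d => exp_flat n (c + s * x ord0 i))
      (s * (i == j)%:R * g (c + s * x ord0 i)).
    set a := c + s * x ord0 i; set s' := s * (i == j)%:R.
    have [df Df] := is_derive_exp_flat n a.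
    have difff : differentiable (exp_flat n) a by exact/derivable1_diffP.
    have : is_derive a s' (exp_flat n) (s' * g a).
      apply: DeriveDef; first exact: diff_derivable.
      rewrite deriveE// -[s' in LHS]mulr1 [LHS](linearZ_LR _ s' 1) /=.
      by rewrite -deriveE// Df.
    case=> da Da.
    have E : (fun t : R => t^-1 *: (((fun x : 'rV[R]_d => exp_flat n (c + s * x ord0 i)) \o shift x)
         (t *: basis_vec R j) - exp_flat n a)) =
       (fun t : R => t^-1 *: ((exp_flat n \o shift a) (t *: s') - exp_flat n a)).
      apply/funext => t /=; congr (_ *: (exp_flat n _ - _)).
      by rewrite !mxE eqxx /= /a /s' /GRing.scale /= (eq_sym i j); ring.
    by apply: DeriveDef; rewrite /derivable /derive E.
  split.
  + suff cF (F : set_system 'rV[R]_d) (FF : Filter F) (x : 'rV[R]_d) : F --> x ->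
        (fun y : 'rV[R]_d => exp_flat n (c + s * y ord0 i)) @ F -->
        exp_flat n (c + s * x ord0 i).
      by move=> x; apply: (cF (nbhs x)).
    move=> Fx; apply: continuous_cvg.
      apply/differentiable_continuous/derivable1_diffP.
      by have [] := is_derive_exp_flat n (c + s * x ord0 i).
    apply: cvgD; first exact: cvg_cst.
    by apply: cvgMr; exact: (cvg_comp _ _ Fx (@coord_continuous _ _ _ _ _ _)).
  + by move=> j x; have [] := D j x.
  + move=> j.
    rewrite (_ : partial j _ = cst (s * (i == j)%:R) * ((fun x => exp_flat n.+2 (c + s * x ord0 i)) +
        cst (- n%:R) * (fun x => exp_flat n.+1 (c + s * x ord0 i)))).
      apply: gen_mul; first exact: gen_cst.
      apply: gen_add; first exact: gen_flat.
      by apply: gen_mul; [exact: gen_cst|exact: gen_flat].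
    apply/funext => x; rewrite /partial; have [_ ->] := D j x.
    by rewrite /g -mulNr.
- split; first exact: cst_continuous.
    by move=> i x; exact: derivable_cst.
  move=> i; rewrite (_ : partial i _ = cst 0); first exact: gen_cst.
  by apply/funext => x; rewrite /partial derive_cst.
- split.
  + by move=> x; apply: continuousD; [exact: cf|exact: cg].
  + by move=> i x; apply: derivableD; [exact: df|exact: dg].
  + move=> i; rewrite (_ : partial i _ = partial i f + partial i g); first exact: gen_add.
    by apply/funext => x; rewrite /partial deriveD.
- split.
  + by move=> x; apply: continuousM; [exact: cf|exact: cg].
  + by move=> i x; apply: derivableM; [exact: df|exact: dg].
  + move=> i; rewrite (_ : partial i _ = f * partial i g + g * partial i f).
      by apply: gen_add; apply: gen_mul.
    by apply/funext => x; rewrite /partial deriveM.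
Qed.

End C1.

(** * The Rellich inequality *)

Section unit_interval.
Context (R : realType).

(* Jensen on [0, 1]: with [m := F 1 - F 0], integrate [2 m phi - m ^ 2 <= phi ^ 2]. *)
Lemma sqr_increment_le (F phi : R -> R) : continuous phi ->
  (forall s : R, is_derive s (1 : R) F (phi s)) ->
  (((F 1 - F 0) ^+ 2)%:E <= \int[lebesgue_measure]_(s in `[0%R, 1%R]) (phi s ^+ 2)%:E)%E.
Proof.
move=> cphi dF; set m := F 1 - F 0.
pose G s := 2 * m * F s - m ^+ 2 * s.
pose f s := 2 * m * phi s - m ^+ 2.
have cf : continuous f.
  move=> s; apply: cvgB; last exact: cvg_cst.
  by apply: cvgMr; exact: cphi.
have dG (s : R) : is_derive s (1 : R) G (f s).
  have h := is_deriveB (is_deriveZ (2 * m) (dF s)) (is_deriveZ (m ^+ 2) (is_derive_id s (1 : R))).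
  by apply: is_derive_eq h _; rewrite /f scaler1.
have cG : continuous G.
  by move=> s; apply/differentiable_continuous/derivable1_diffP; have [] := dG s.
have := @continuous_FTC2 R f G 0 1 ltr01 (continuous_subspaceT cf).
rewrite (_ : (G 1)%:E - (G 0)%:E = (m ^+ 2)%:E)%E; last first.
  by rewrite -EFinB; congr _%:E; rewrite /G /m; ring.
move=> <-; last 2 first.
- split; first by move=> s _; have [] := dG s.
    exact/cvg_at_right_filter/cG.
  exact/cvg_at_left_filter/cG.
- by move=> s _; rewrite derive1E; have [] := dG s.
apply: le_integral => //.
- apply: continuous_compact_integrable; first exact: segment_compact.
  exact: continuous_subspaceT.
- apply: continuous_compact_integrable; first exact: segment_compact.
  apply: continuous_subspaceT => s.
  exact: (continuous_comp (cphi s) (@exprn_continuous _ 2 _)).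
- move=> s _; rewrite lee_fin /f -subr_ge0.
  by rewrite (_ : _ - _ = (phi s - m) ^+ 2) ?sqr_ge0//; ring.
Qed.

End unit_interval.

(** * Test functions, Dirichlet energy and the translation estimate *)

Section test_functions.
Context (R : realType) (d : nat) (Omega : set 'rV[R]_d).
Hypothesis oO : open Omega.
Variable L : R.
Hypothesis bO : forall x, Omega x -> forall i, `|x ord0 i| < L.
Local Notation mu := (lebesgue_rV R d).
Local Notation test := (test_function Omega).
Local Notation L2 := (L2 Omega).
Local Notation ipO := (ip Omega).
Implicit Types (v w : 'rV[R]_d -> R).

Let mO : measurable Omega := open_measurable_rV oO.

Lemma test_smooth v : test v -> smooth v.
Proof. by case. Qed.

Lemma test_continuous v : test v -> continuous v.
Proof. by move=> /test_smooth/smooth_continuous. Qed.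

Lemma test_out v x : test v -> ~ Omega x -> v x = 0.
Proof. by move=> [_ [K [_ KO] v0]] nOx; apply: v0 => Kx; apply: nOx; exact: KO. Qed.

(** The same compact set [K] serves: it is closed, so [v] vanishes in a neighbourhood of each point
    outside it. *)
Lemma test_partial v i : test v -> test (partial i v).
Proof.
move=> tv; split; first exact/smooth_partial/test_smooth.
case: tv => _ [K [cK KO] v0]; exists K => // x nKx.
have oK : open (~` K).
  by rewrite openC; apply: compact_closed => //; exact: norm_hausdorff.
rewrite /partial (@near_eq_derive _ _ _ _ (cst 0)); first exact: derive_cst.
by have : nbhs x (~` K) by [exact: open_nbhs_nbhs]; apply: filterS => y /v0.
Qed.

Lemma testD v w : test v -> test w -> test (fun x => v x + w x).
Proof.
move=> [sv [K [cK KO] v0]] [sw [K' [cK' KO'] w0]]; split.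
  by apply: smooth_gen_smooth; apply: (@gen_add _ _ v w); exact: gen_smooth.
exists (K `|` K').
  split; last by move=> x [/KO|/KO'].
  exact: compactU.
by move=> x nK; rewrite v0 ?w0 ?addr0// => ?; apply: nK; [right|left].
Qed.

Lemma testZ c v : test v -> test (fun x => c * v x).
Proof.
move=> [sv [K KO v0]]; split.
  by apply: smooth_gen_smooth; apply: (@gen_mul _ _ (cst c) v); [exact: gen_cst|exact: gen_smooth].
by exists K => // x nK; rewrite v0 ?mulr0.
Qed.

Lemma testB v w : test v -> test w -> test (fun x => v x - w x).
Proof.
move=> tv /(testZ (-1)) tw; have := testD tv tw; congr test.
by apply/funext => x; rewrite mulN1r.
Qed.

Lemma partial_testD v w i : test v -> test w ->
  partial i (fun x => v x + w x) = (fun x => partial i v x + partial i w x).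
Proof.
move=> tv tw; apply/funext => x; rewrite /partial; apply: deriveD;
  exact/smooth_derivable/test_smooth.
Qed.

Lemma partial_testZ c v i : test v ->
  partial i (fun x => c * v x) = (fun x => c * partial i v x).
Proof.
by move=> tv; apply/funext => x; apply: deriveZ; exact/smooth_derivable/test_smooth.
Qed.

Lemma partial_testB v w i : test v -> test w ->
  partial i (fun x => v x - w x) = (fun x => partial i v x - partial i w x).
Proof.
move=> tv tw; apply/funext => x; rewrite /partial; apply: deriveB;
  exact/smooth_derivable/test_smooth.
Qed.

Lemma mu_domain_lty : (mu Omega < +oo)%E.
Proof.
pose C : set 'rV[R]_d := [set x | forall i, `[- L, L]%classic (x ord0 i)].
have mC : measurable C by exact: measurable_box.
apply: (@le_lt_trans _ _ (mu C)).
  apply: le_measure; rewrite ?inE// => x Ox i /=; rewrite in_itv /= -ler_norml.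
  by apply: ltW; exact: bO.
rewrite (lebesgue_rV_rect (A := fun=> `[- L, L]%classic))//.
rewrite (eq_bigr (fun=> (fine (lebesgue_measure `[- L, L]%classic))%:E)).
  by rewrite prodEFin ltry.
by move=> i _; rewrite fineK// lebesgue_measure_itv/=; case: ifP.
Qed.

Lemma test_bounded v : test v -> exists M, forall x, `|v x| <= M.
Proof.
move=> tv; case: (tv) => sv [K [cK KO] v0].
have : compact (v @` K).
  by apply: continuous_compact cK; apply: continuous_subspaceT; exact: test_continuous.
move=> /compact_bounded[M [_ /(_ (M + 1))]]; rewrite ltrDl ltr01 => /(_ isT) h.
exists (Num.max 0 (M + 1)) => x; have [Kx|nKx] := pselect (K x).
  by rewrite le_max; apply/orP; right; apply: (h (v x)); exists x.
by rewrite v0// normr0 le_max lexx.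
Qed.

Lemma test_measurable v (D : set 'rV[R]_d) : test v -> measurable_fun D v.
Proof.
move=> tv; apply: (measurable_funS measurableT (@subsetT _ _)).
exact: (continuous_measurable_rV (test_continuous tv)).
Qed.

Lemma test_L2 v : test v -> L2 v.
Proof.
move=> tv; split; first exact: test_measurable.
apply: (@measurable_bounded_integrable _ _ _ mu (fun x => v x ^+ 2)) => //.
- exact: mu_domain_lty.
- by apply: measurable_funX; exact: test_measurable.
- have [M vM] := test_bounded tv.
  exists (M ^+ 2); split; first exact: num_real.
  move=> N MN x _ /=; apply: le_trans (ltW MN).
  by rewrite normrX lerXn2r ?nnegrE// (le_trans _ (vM x)).
Qed.

(** Translations do not preserve [Omega], so the estimates below integrate over the whole space,
    where [v] is zero off [Omega]. *)
Lemma test_integral_sqr v : test v ->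
  (\int[mu]_x (v x ^+ 2)%:E = (ipO v v)%:E)%E.
Proof.
move=> tv; have vL := test_L2 tv.
rewrite /ip /Rintegral fineK; last first.
  exact: (integrable_fin_num mO (L2M_integrable mO vL vL)).
rewrite [RHS]integral_mkcond; apply: eq_integral => x _; rewrite /patch.
case: ifPn; first by rewrite expr2.
by move=> /negP nO; rewrite (test_out tv) ?expr0n// => Ox; apply: nO; rewrite inE.
Qed.

(** The Dirichlet energy, that is the integral of the squared gradient. *)
Definition energy v := \sum_i ipO (partial i v) (partial i v).

Lemma energy_ge0 v : 0 <= energy v.
Proof. by apply: sumr_ge0 => i _; exact: ip_ge0. Qed.

(** A crude Cauchy-Schwarz inequality in terms of the sup norm of [a], obtained from
    [2 c_i c_j <= c_i ^+ 2 + c_j ^+ 2]. *)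
Lemma sqr_sum_le (n : nat) (a b : 'I_n -> R) (M : R) : (forall i, `|a i| <= M) ->
  (\sum_i a i * b i) ^+ 2 <= n%:R * M ^+ 2 * \sum_i b i ^+ 2.
Proof.
move=> aM; pose c i := a i * b i.
have cb : n%:R * \sum_i c i ^+ 2 <= n%:R * M ^+ 2 * \sum_i b i ^+ 2.
  rewrite -mulrA ler_wpM2l// mulr_sumr; apply: ler_sum => i _.
  rewrite /c exprMn ler_wpM2r ?sqr_ge0// -real_normK ?num_real//.
  by rewrite lerXn2r ?nnegrE// (le_trans _ (aM i)).
apply: le_trans cb; rewrite expr2 big_distrlr /=.
apply: (@le_trans _ _ (\sum_(i < n) \sum_(j < n) (c i ^+ 2 / 2 + c j ^+ 2 / 2))).
  apply: ler_sum => i _; apply: ler_sum => j _.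
  have := sqr_ge0 (c i - c j); rewrite /c; nra.
rewrite (eq_bigr (fun i => n%:R * (c i ^+ 2 / 2) + (\sum_(j < n) c j ^+ 2) / 2)).
  rewrite big_split /= sumr_const card_ord -mulr_sumr -mulr_suml.
  set t := \sum_(i < n) _; have -> : t / 2 *+ n = n%:R * (t / 2) by rewrite mulr_natl.
  by rewrite -mulrDr -splitr.
by move=> i _; rewrite big_split /= sumr_const card_ord -mulr_suml [in RHS]mulr_natl.
Qed.

(** The increment is the integral over [s] in [0, 1] of the directional derivative [G (x + s *: z)].
    After [sqr_increment_le] and Tonelli, translation invariance gives the integral over [x] the
    same value for every [s]. *)
Lemma translation_estimate v (z : 'rV[R]_d) (M : R) : test v ->
  (forall i, `|z ord0 i| <= M) ->
  (\int[mu]_x ((v (x + z) - v x) ^+ 2)%:E <= (d%:R * M ^+ 2 * energy v)%:E)%E.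
Proof.
move=> tv zM.
pose G x := \sum_i z ord0 i * partial i v x.
have cG : continuous G.
  suff cF (F : set_system 'rV[R]_d) (FF : Filter F) (x : 'rV[R]_d) : F --> x ->
      G @ F --> G x by move=> x; apply: (cF (nbhs x)).
  move=> Fx; apply: cvg_big => [|i _]; first exact: add_continuous.
  by apply: cvgMr; exact: (cvg_comp _ _ Fx (@test_continuous _ (test_partial i tv) x)).
have mG : measurable_fun setT G by exact: continuous_measurable_rV.
(* The indicator of [0, 1] lets [s] range over the whole line, as Tonelli's theorem is applied to
   the full product. *)
pose g (p : 'rV[R]_d * R) : \bar R :=
  ((\1_(`[0, 1]%classic : set R) p.2)%:E * (G (p.1 + p.2 *: z) ^+ 2)%:E)%E.
have mxz : measurable_fun setT (fun p : 'rV[R]_d * R => p.1 + p.2 *: z).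
  apply: measurable_fun_rVP => i.
  rewrite (_ : (fun _ => _) = (fun p : 'rV[R]_d * R => p.1 ord0 i) \+
      (fun p : 'rV[R]_d * R => p.2 * z ord0 i)); last first.
    by apply/funext => p; rewrite /= !mxE.
  apply: measurable_funD; first exact: (measurableT_comp (measurable_coord i)).
  by apply: measurable_funM.
have mI : measurable_fun [set: R] (fun s : R => (\1_(`[0, 1]%classic : set R) s)%:E : \bar R).
  exact/measurable_EFinP/measurable_indic.
have I1 : (\int[lebesgue_measure]_s (\1_(`[0%R, 1%R]%classic : set R) s)%:E = 1 :> \bar R)%E.
  rewrite (integral_indic lebesgue_measure measurableT (measurable_itv `[0, 1])) setIT.
  by rewrite /= lebesgue_measure_itv/= lte_fin ltr01 oppr0 adde0.
have mg : measurable_fun setT g.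
  apply: emeasurable_funM.
    exact: (measurableT_comp mI).
  apply/measurable_EFinP; apply: measurable_funX.
  exact: (measurableT_comp mG mxz).
have g0 p : (0 <= g p)%E by rewrite mule_ge0 ?lee_fin ?sqr_ge0.
have mv : measurable_fun setT v by exact: test_measurable.
have Ioo : (\int[mu]_x (G x ^+ 2)%:E <= (d%:R * M ^+ 2 * energy v)%:E)%E.
  apply: (@le_trans _ _ (\int[mu]_x ((d%:R * M ^+ 2)%:E * \sum_i (partial i v x ^+ 2)%:E))%E).
    apply: ge0_le_integral => //.
    - by move=> x _; rewrite lee_fin sqr_ge0.
    - by apply/measurable_EFinP; exact: measurable_funX.
    - apply: measurable_funeM; apply: emeasurable_sum => i.
      apply/measurable_EFinP; apply: measurable_funX.
      by apply: test_measurable; exact: test_partial.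
    - move=> x _; rewrite sumEFin -EFinM lee_fin; exact: sqr_sum_le.
  rewrite ge0_integralZl_EFin; last 4 first.
    - exact: measurableT.
    - by move=> x _; apply: sume_ge0 => i _; rewrite lee_fin sqr_ge0.
    - apply: emeasurable_sum => i.
      apply/measurable_EFinP; apply: measurable_funX.
      by apply: test_measurable; exact: test_partial.
    - by rewrite mulr_ge0 ?sqr_ge0.
  rewrite ge0_integral_sum//; last 2 first.
    - move=> i; apply/measurable_EFinP; apply: measurable_funX.
      by apply: test_measurable; exact: test_partial.
    - by move=> i x _; rewrite lee_fin sqr_ge0.
  rewrite (eq_bigr (fun i => (ipO (partial i v) (partial i v))%:E)); last first.
    by move=> i _; rewrite test_integral_sqr//; exact: test_partial.
  by rewrite sumEFin -EFinM.
have slice (s : R) : (\int[mu]_x g (x, s) =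
    (\1_(`[0, 1]%classic : set R) s)%:E * \int[mu]_x (G x ^+ 2)%:E)%E.
  have mGs : measurable_fun setT (fun x : 'rV[R]_d => (G (x + s *: z) ^+ 2)%:E).
    apply/measurable_EFinP; apply: measurable_funX.
    exact: (measurableT_comp mG (measurable_addr_rV _)).
  have Gs0 (x : 'rV[R]_d) : [set: 'rV[R]_d] x -> (0 <= (G (x + s *: z) ^+ 2)%:E)%E.
    by move=> _; rewrite lee_fin sqr_ge0.
  have I0 : 0 <= \1_(`[0, 1]%classic : set R) s :> R by [].
  have E := ge0_integralZl_EFin mu measurableT Gs0 mGs I0.
  have T : (\int[mu]_x (G (x + s *: z) ^+ 2)%:E = \int[mu]_x (G x ^+ 2)%:E)%E.
    apply: (ge0_integral_lebesgue_rV_translation (s *: z) (f := fun x => (G x ^+ 2)%:E)).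
      by apply/measurable_EFinP; exact: measurable_funX.
    by move=> x; rewrite lee_fin sqr_ge0.
  exact: (etrans E (congr1 (fun t => (\1_(`[0, 1]%classic : set R) s)%:E * t)%E T)).
apply: le_trans Ioo.
apply: (@le_trans _ _ (\int[mu]_x \int[lebesgue_measure]_s g (x, s))%E).
  apply: ge0_le_integral => //.
  - by move=> x _; rewrite lee_fin sqr_ge0.
  - apply/measurable_EFinP; apply: measurable_funX; apply: measurable_funB => //.
    exact: (measurableT_comp mv (measurable_addr_rV z)).
  - exact: measurable_fun_fubini_tonelli_F.
  - move=> x _.
    have dF (s : R) : is_derive s (1 : R) (fun s => v (x + s *: z)) (G (x + s *: z)).
      exact/is_derive_line/smooth_is_derive/test_smooth.
    have cGs : continuous (fun s : R => G (x + s *: z)).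
      move=> s; have cz : (fun u : R => x + u *: z) @ s --> x + s *: z.
        by apply: cvgD; [exact: cvg_cst|apply: cvgZr_tmp; exact: cvg_id].
      exact: (cvg_comp _ _ cz (cG _)).
    have := sqr_increment_le cGs dF; rewrite scale1r scale0r addr0.
    move=> h; apply: (le_trans h).
    rewrite integral_mkcond le_eqVlt; apply/predU1l/eq_integral => s _.
    rewrite /g /patch /= indicE.
    by case: ifPn => _; rewrite ?mul1e ?mul0e.
rewrite (fubini_tonelli (m1 := mu) (m2 := lebesgue_measure) g mg g0).
under eq_integral do rewrite slice.
rewrite ge0_integralZr; last 4 first.
- exact: measurableT.
- exact: mI.
- by move=> s _; rewrite lee_fin.
- by apply: integral_ge0 => x _; rewrite lee_fin sqr_ge0.
by rewrite I1 mul1e.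
Qed.

(* The translate of [Omega] by [z = (2 L, ..., 2 L)] is disjoint from [Omega]. *)
Lemma Poincare v : (0 < d)%N -> test v ->
  ip Omega v v <= d%:R * (2 * L) ^+ 2 * energy v.
Proof.
(* For [L <= 0] the domain is empty, there being at least one coordinate; otherwise [2 * L] is a
   genuine length. *)
move=> d0 tv; have [L0|L0] := leP L 0.
  have Oe x : ~ Omega x.
    by move=> /bO/(_ (Ordinal d0)); apply/negP; rewrite -leNgt (le_trans L0).
  have -> : Omega = set0 by apply/seteqP; split => x // /Oe.
  by rewrite /ip Rintegral_set0 mulr_ge0 ?energy_ge0// mulr_ge0 ?sqr_ge0.
pose z : 'rV[R]_d := const_mx (2 * L).
have zM i : `|z ord0 i| <= 2 * L by rewrite mxE ger0_norm// mulr_ge0// ltW.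
rewrite -lee_fin -test_integral_sqr//.
apply: le_trans (translation_estimate tv zM).
apply: ge0_le_integral => //.
- by move=> x _; rewrite lee_fin sqr_ge0.
- by apply/measurable_EFinP; apply: measurable_funX; exact: test_measurable.
- apply/measurable_EFinP; apply: measurable_funX; apply: measurable_funB; last exact: test_measurable.
  exact: (measurableT_comp (test_measurable tv) (measurable_addr_rV z)).
- move=> x _; rewrite lee_fin.
  have [Ox|nOx] := pselect (Omega x); last first.
    by rewrite (test_out tv nOx) expr0n/= sqr_ge0.
  rewrite (@test_out _ (x + z) tv) ?sub0r ?sqrrN// => Oxz.
  have := bO Oxz (Ordinal d0); have := bO Ox (Ordinal d0).
  by rewrite !mxE !ltr_norml => /andP[h1 h2] /andP[h3 h4]; lra.
Qed.

End test_functions.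

(** * Comparison of a test function with its means over a grid *)

Section Rellich.
Context (R : realType) (d : nat) (Omega : set 'rV[R]_d).
Hypothesis oO : open Omega.
Variable L : R.
Hypothesis L0 : 0 < L.
Hypothesis bO : forall x, Omega x -> forall i, `|x ord0 i| < L.
Local Notation mu := (lebesgue_rV R d).
Local Notation test := (test_function Omega).
Local Notation energy := (energy Omega).
Implicit Types (v w : 'rV[R]_d -> R).

Let mO : measurable Omega := open_measurable_rV oO.

Lemma test_integrable v (Q : set 'rV[R]_d) : test v -> measurable Q -> (mu Q < +oo)%E ->
  mu.-integrable Q (EFin \o v) /\ mu.-integrable Q (EFin \o (fun x => v x ^+ 2)).
Proof.
move=> tv mQ Qoo; have [M vM] := test_bounded tv; split.
  apply: measurable_bounded_integrable => //; first exact: (test_measurable tv).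
  exists M; split; first exact: num_real.
  by move=> K MK x _ /=; exact: le_trans (vM x) (ltW MK).
apply: measurable_bounded_integrable => //.
  by apply: measurable_funX; exact: (test_measurable tv).
exists (M ^+ 2); split; first exact: num_real.
move=> K MK x _ /=; apply: le_trans (ltW MK).
by rewrite normrX lerXn2r ?nnegrE// (le_trans _ (vM x)).
Qed.

(** The variance in pair form: deviations from the mean are traded for differences [v y - v x],
    which translation estimates control. *)
Lemma variance_identity v (Q : set 'rV[R]_d) (m : R) : test v -> measurable Q -> mu Q = m%:E ->
  (\int[mu]_(x in Q) \int[mu]_(y in Q) ((v y - v x) ^+ 2)%:E =
   (2 * m * \int[mu]_(x in Q) (v x ^+ 2) - 2 * (\int[mu]_(x in Q) v x) ^+ 2)%:E)%E.
Proof.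
move=> tv mQ Qm; have Qoo : (mu Q < +oo)%E by rewrite Qm ltry.
have [iv iv2] := test_integrable tv mQ Qoo.
have ic (c : R) : mu.-integrable Q (EFin \o (fun=> c)).
  apply: measurable_bounded_integrable => //.
  exists `|c|; split; first exact: num_real.
  by move=> K cK x _ /=; exact: ltW.
set I := \int[mu]_(x in Q) v x; set J := \int[mu]_(x in Q) (v x ^+ 2).
(* Both the inner and the outer integrand are quadratic polynomials in [v], so one formula serves
   twice. *)
have intp (a b c : R) : mu.-integrable Q (EFin \o (fun x => a * v x ^+ 2 + (b * v x + c))) /\
    \int[mu]_(x in Q) (a * v x ^+ 2 + (b * v x + c)) = a * J + (b * I + c * m).
  have i1 : mu.-integrable Q (EFin \o (fun x => a * v x ^+ 2)) by exact: (integrableZl mQ a iv2).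
  have i2 : mu.-integrable Q (EFin \o (fun x => b * v x)) by exact: (integrableZl mQ b iv).
  have i3 : mu.-integrable Q (EFin \o (fun x => b * v x + c)) by exact: (integrableD mQ i2 (ic c)).
  split; first exact: (integrableD mQ i1 i3).
  rewrite RintegralD// RintegralD// RintegralZl// RintegralZl// Rintegral_cst//.
  by congr (_ + (_ + _ * _)); exact: (congr1 fine Qm).
have toR (f : 'rV[R]_d -> R) : mu.-integrable Q (EFin \o f) ->
    (\int[mu]_(x in Q) (f x)%:E = (\int[mu]_(x in Q) f x)%:E)%E.
  by move=> fi; rewrite /Rintegral fineK//; exact: integrable_fin_num.
transitivity (\int[mu]_(x in Q) (m * v x ^+ 2 + ((- 2 * I) * v x + J))%:E)%E.
  apply: eq_integral => x _.
  have [i1 i2] := intp 1 (- 2 * v x) (v x ^+ 2).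
  transitivity (\int[mu]_(y in Q) (1 * v y ^+ 2 + (- 2 * v x * v y + v x ^+ 2))%:E)%E.
    by apply: eq_integral => y _; congr _%:E; ring.
  by rewrite toR// i2; congr _%:E; ring.
have [i1 i2] := intp m (- 2 * I) J.
by rewrite toR// i2; congr _%:E; ring.
Qed.

Section cells.
Variable N : nat.
Hypothesis N0 : (0 < N)%N.

Definition mesh : R := 2 * L / N%:R.

(** Half-open cells share no faces: they are pairwise disjoint, and still cover the domain. *)
Definition cell (c : {ffun 'I_d -> 'I_N}) : set 'rV[R]_d :=
  [set x | forall i, `[- L + (c i)%:R * mesh, - L + (c i).+1%:R * mesh[%classic (x ord0 i)].

Let mesh_gt0 : 0 < mesh.
Proof. by rewrite divr_gt0 ?ltr0n// mulr_gt0. Qed.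

Lemma measurable_cell c : measurable (cell c).
Proof. exact: measurable_box. Qed.

Lemma mu_cell c : mu (cell c) = (mesh ^+ d)%:E.
Proof.
rewrite /cell (lebesgue_rV_rect
  (A := fun i => `[- L + (c i)%:R * mesh, - L + (c i).+1%:R * mesh[%classic))//.
rewrite (eq_bigr (fun=> mesh%:E)) => [|i _].
  by rewrite prodEFin prodr_const card_ord.
rewrite lebesgue_measure_itv/= lte_fin ltrD2l ltr_pM2r// ltr_nat ltnSn.
by rewrite -EFinB; congr _%:E; rewrite -natr1; ring.
Qed.

Lemma cell_inj c c' x : cell c x -> cell c' x -> c = c'.
Proof.
move=> cx c'x; apply/ffunP => i; apply/val_inj/eqP.
have := cx i; have := c'x i; rewrite /= !in_itv /= => /andP[h1 h2] /andP[h3 h4].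
have := le_lt_trans h1 h4; have := le_lt_trans h3 h2.
by rewrite !ltrD2l !ltr_pM2r// !ltr_nat !ltnS eqn_leq => -> ->.
Qed.

Lemma cell_cover x : Omega x -> exists c, cell c x.
Proof.
move=> Ox.
have yP i : 0 <= (x ord0 i + L) / mesh /\ (x ord0 i + L) / mesh < N%:R.
  have := bO Ox i; rewrite ltr_norml => /andP[h1 h2]; split.
    by rewrite divr_ge0 ?(ltW mesh_gt0)//; lra.
  rewrite ltr_pdivrMr// /mesh mulrC divfK ?pnatr_eq0 -?lt0n//; lra.
have tN i : (Num.truncn ((x ord0 i + L) / mesh) < N)%N.
  have [y0 yN] := yP i; rewrite -(ltr_nat R); apply: le_lt_trans yN.
  by rewrite truncn_le.
exists [ffun i => Ordinal (tN i)] => i /=; rewrite ffunE /= in_itv /=.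
have [y0 _] := yP i.
have h1 : (Num.truncn ((x ord0 i + L) / mesh))%:R <= (x ord0 i + L) / mesh by rewrite truncn_le.
have h2 := truncnS_gt ((x ord0 i + L) / mesh).
rewrite ler_pdivlMr// in h1; rewrite ltr_pdivrMr// in h2.
by apply/andP; split; lra.
Qed.

Lemma cell_diam c x y i : cell c x -> cell c y -> `|y ord0 i - x ord0 i| <= mesh.
Proof.
move=> /(_ i) + /(_ i); rewrite /= !in_itv /= -natr1 => /andP[h1 h2] /andP[h3 h4].
by rewrite ler_norml; apply/andP; split; lra.
Qed.

Lemma L2_indic_cell c : L2 Omega (\1_(cell c) : 'rV[R]_d -> R).
Proof.
have mc : measurable_fun Omega (\1_(cell c) : 'rV[R]_d -> R).
  by apply: measurable_indic; exact: measurable_cell.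
split => //.
apply: (@measurable_bounded_integrable _ _ _ mu (fun x => \1_(cell c) x ^+ 2)) => //.
- exact: (mu_domain_lty oO bO).
- exact: measurable_funX.
- exists 1; split; first exact: num_real.
  move=> K K1 x _ /=; apply: le_trans (ltW K1); rewrite indicE.
  by case: (_ \in _); rewrite ?expr1n ?expr0n /= ?normr1 ?normr0.
Qed.

Lemma integral_cell v c : test v -> \int[mu]_(x in cell c) v x = ip Omega v \1_(cell c).
Proof.
move=> tv; rewrite /ip Rintegral_mkcond [RHS]Rintegral_mkcond.
apply: eq_Rintegral => x _; rewrite /patch indicE.
case: ifPn => xc; case: ifPn => xO; rewrite ?mulr1 ?mulr0//.
by rewrite (test_out tv)// => Ox; move/negP: xO; apply; rewrite inE.
Qed.

(* On each cell the variance of [v] is a mean of [(v y - v x) ^ 2] over pairs in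
   the cell, and all those pairs satisfy [|y - x| <= mesh]. *)
Lemma Rellich v : test v ->
  ip Omega v v <= 2 ^+ d * d%:R * mesh ^+ 2 * energy v + \sum_c (ip Omega v \1_(cell c)) ^+ 2 / mesh ^+ d.
Proof.
move=> tv; set m := mesh ^+ d; have m0 : 0 < m by rewrite exprn_gt0.
have mv : measurable_fun setT v by exact: (test_measurable tv).
pose f (p : 'rV[R]_d * 'rV[R]_d) : \bar R := ((v p.2 - v p.1) ^+ 2)%:E.
have mf : measurable_fun setT f.
  apply/measurable_EFinP; apply: measurable_funX; apply: measurable_funB.
    exact: (measurableT_comp mv).
  exact: (measurableT_comp mv).
have f0 p : (0 <= f p)%E by rewrite lee_fin sqr_ge0.
pose k c (p : 'rV[R]_d * 'rV[R]_d) : \bar R :=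
  ((\1_(cell c) p.1)%:E * ((\1_(cell c) p.2)%:E * f p))%E.
have mI c : measurable_fun [set: 'rV[R]_d] (fun x => (\1_(cell c) x)%:E : \bar R).
  by apply/measurable_EFinP; apply: measurable_indic; exact: measurable_cell.
have mk c : measurable_fun setT (k c).
  apply: emeasurable_funM; first exact: (measurableT_comp (mI c)).
  by apply: emeasurable_funM => //; exact: (measurableT_comp (mI c)).
have k0 c p : (0 <= k c p)%E by rewrite mule_ge0// ?mule_ge0// lee_fin.
(* [B] contains every difference of two points of a common cell; its volume [(2 * mesh) ^ d] is the
   source of the factor [2 ^+ d]. *)
pose B : set 'rV[R]_d := [set z | forall i, `[- mesh, mesh]%classic (z ord0 i)].
have mB : measurable B by exact: measurable_box.
have muB : mu B = (2 ^+ d * m)%:E.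
  rewrite (lebesgue_rV_rect (A := fun=> `[- mesh, mesh]%classic))//.
  rewrite (eq_bigr (fun=> (2 * mesh)%:E)) => [|i _].
    by rewrite prodEFin prodr_const card_ord exprMn.
  rewrite lebesgue_measure_itv/= lte_fin gtrN// -EFinB opprK.
  by congr _%:E; ring.
have mIB : measurable_fun [set: 'rV[R]_d] (fun x => (\1_B x)%:E : \bar R).
  exact/measurable_EFinP/measurable_indic.
pose g (p : 'rV[R]_d * 'rV[R]_d) : \bar R := ((\1_B (p.2 - p.1))%:E * f p)%E.
have mBx : measurable_fun setT (fun p : 'rV[R]_d * 'rV[R]_d => p.2 - p.1).
  apply: measurable_fun_rVP => i.
  rewrite (_ : (fun _ => _) = (fun p : 'rV[R]_d * 'rV[R]_d => p.2 ord0 i)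
      \- (fun p : 'rV[R]_d * 'rV[R]_d => p.1 ord0 i)); last first.
    by apply/funext => x; rewrite /= !mxE.
  apply: measurable_funB; exact: (measurableT_comp (measurable_coord i)).
have mg : measurable_fun setT g.
  by apply: emeasurable_funM => //; exact: (measurableT_comp mIB).
have g0 p : (0 <= g p)%E by rewrite mule_ge0// lee_fin.
have kc c : (\int[mu \x mu]_p k c p = (2 * m * \int[mu]_(x in cell c) (v x ^+ 2) -
    2 * (ip Omega v \1_(cell c)) ^+ 2)%:E)%E.
  rewrite -integral_cell// -(variance_identity tv (measurable_cell c) (mu_cell c)).
  rewrite (fubini_tonelli1 (m1 := mu) (m2 := mu) (k c) (mk c) (k0 c)) /fubini_F.
  rewrite [RHS]integral_mkcond; apply: eq_integral => x _.
  rewrite /patch /k /= indicE; case: ifPn => xc; last first.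
    by rewrite integral0_eq// => y _; rewrite mul0e.
  rewrite [RHS]integral_mkcond; apply: eq_integral => y _.
  by rewrite mul1e /patch indicE; case: ifPn => yc; rewrite ?mul1e ?mul0e.
(* At most one cell contains both points, and then [p.2 - p.1] lies in [B]. *)
have sumk p : (\sum_c k c p <= g p)%E.
  have [[c0 [xc yc]]|nc] := pselect (exists c, cell c p.1 /\ cell c p.2).
    rewrite (bigD1 c0)//= big1 ?adde0.
      rewrite /k /g !indicE !mem_set// ?mul1e// => i; rewrite /= in_itv /= -ler_norml !mxE.
      exact: (cell_diam i xc yc).
    move=> c cc0; rewrite /k indicE memNset ?mul0e// => xc'.
    by move/eqP: cc0; apply; exact: cell_inj xc' xc.
  rewrite big1// => c _; rewrite /k !indicE.
  have [xc|xc] := pselect (cell c p.1); last by rewrite memNset// mul0e.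
  rewrite [X in ((nat_of_bool X)%:R%:E * f p)%E]memNset ?mul0e ?mule0// => yc.
  by apply: nc; exists c.
have gle : (\int[mu \x mu]_p g p <= (2 ^+ d * m * (d%:R * mesh ^+ 2 * energy v))%:E)%E.
  rewrite (fubini_tonelli1 (m1 := mu) (m2 := mu) g mg g0) /fubini_F.
  (* The variables become [x] and [z = y - x]: at fixed [z], the integral over [x] is the one that
     [translation_estimate] bounds. *)
  pose g' (p : 'rV[R]_d * 'rV[R]_d) : \bar R :=
    ((\1_B p.2)%:E * ((v (p.1 + p.2) - v p.1) ^+ 2)%:E)%E.
  have mg' : measurable_fun setT g'.
    apply: emeasurable_funM; first exact: (measurableT_comp mIB).
    apply/measurable_EFinP; apply: measurable_funX; apply: measurable_funB; last first.
      exact: (measurableT_comp mv).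
    apply: (measurableT_comp mv); apply: measurable_fun_rVP => i.
    rewrite (_ : (fun _ => _) = (fun p : 'rV[R]_d * 'rV[R]_d => p.1 ord0 i)
        \+ (fun p : 'rV[R]_d * 'rV[R]_d => p.2 ord0 i)); last first.
      by apply/funext => x; rewrite /= !mxE.
    apply: measurable_funD; exact: (measurableT_comp (measurable_coord i)).
  have g'0 p : (0 <= g' p)%E by rewrite mule_ge0// lee_fin// sqr_ge0.
  have gg' (x : 'rV[R]_d) : (\int[mu]_y g (x, y) = \int[mu]_y g' (x, y))%E.
    have mgx : measurable_fun setT (fun y => g (x, y)).
      exact: (measurableT_comp mg (measurable_pair1 x)).
    have := ge0_integral_lebesgue_rV_translation x mgx (fun y => g0 (x, y)).
    move=> <-; apply: eq_integral => y _.
    by rewrite /g /g' /f /= addrK (addrC y).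
  have slice (z : 'rV[R]_d) : (\int[mu]_x g' (x, z) <=
      (\1_B z)%:E * (d%:R * mesh ^+ 2 * energy v)%:E)%E.
    have mz : measurable_fun setT (fun x : 'rV[R]_d => ((v (x + z) - v x) ^+ 2)%:E).
      apply/measurable_EFinP; apply: measurable_funX; apply: measurable_funB => //.
      exact: (measurableT_comp mv (measurable_addr_rV z)).
    have z0 (x : 'rV[R]_d) : [set: 'rV[R]_d] x -> (0 <= ((v (x + z) - v x) ^+ 2)%:E)%E.
      by move=> _; rewrite lee_fin sqr_ge0.
    have I0 : 0 <= \1_B z :> R by [].
    have E := ge0_integralZl_EFin mu measurableT z0 mz I0.
    rewrite [leLHS]E indicE; case: (boolP (z \in B)) => [zB|_]; last by rewrite !mul0e.
    rewrite !mul1e; apply: (translation_estimate oO bO tv) => i.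
    by move: zB; rewrite inE => /(_ i); rewrite /= in_itv /= -ler_norml.
  under eq_integral do rewrite gg'.
  rewrite (fubini_tonelli (m1 := mu) (m2 := mu) g' mg' g'0).
  apply: (@le_trans _ _ (\int[mu]_z ((\1_B z)%:E * (d%:R * mesh ^+ 2 * energy v)%:E))%E).
    apply: ge0_le_integral => //.
    - by move=> z _; apply: integral_ge0.
    - exact: measurable_fun_fubini_tonelli_G.
    - apply: emeasurable_funM => //; exact: measurable_cst.
  rewrite ge0_integralZr; last 4 first.
  - exact: measurableT.
  - exact: mIB.
  - by move=> s _; rewrite lee_fin.
  - by rewrite lee_fin mulr_ge0 ?energy_ge0// mulr_ge0 ?sqr_ge0.
  by rewrite integral_indic// setIT -[X in (X * _ <= _)%E]/(mu B) muB -EFinM.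
have main : (\sum_c \int[mu \x mu]_p k c p <= (2 ^+ d * m * (d%:R * mesh ^+ 2 * energy v))%:E)%E.
  apply: le_trans gle; rewrite -ge0_integral_sum//.
  apply: ge0_le_integral => //.
  - by move=> p _; apply: sume_ge0.
  - exact: emeasurable_sum.
have cover : ip Omega v v <= \sum_c \int[mu]_(x in cell c) (v x ^+ 2).
  rewrite -lee_fin -(test_integral_sqr oO bO tv) -sumEFin.
  rewrite (eq_bigr (fun c => (\int[mu]_x ((\1_(cell c) x)%:E * (v x ^+ 2)%:E))%E)); last first.
    move=> c _; have coo : (mu (cell c) < +oo)%E by rewrite mu_cell ltry.
    have [_ iv2] := test_integrable tv (measurable_cell c) coo.
    rewrite /Rintegral fineK; last exact: (integrable_fin_num (measurable_cell c) iv2).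
    rewrite integral_mkcond; apply: eq_integral => x _.
    by rewrite /patch indicE; case: ifPn => _; rewrite ?mul1e ?mul0e.
  have mIv c : measurable_fun setT (fun x => (\1_(cell c) x)%:E * (v x ^+ 2)%:E)%E.
    by apply: emeasurable_funM => //; apply/measurable_EFinP; exact: measurable_funX.
  have Iv0 c (x : 'rV[R]_d) : [set: 'rV[R]_d] x -> (0 <= (\1_(cell c) x)%:E * (v x ^+ 2)%:E)%E.
    by move=> _; rewrite mule_ge0// lee_fin// sqr_ge0.
  rewrite -ge0_integral_sum//; apply: ge0_le_integral => //.
  - by move=> x _; rewrite lee_fin sqr_ge0.
  - by apply/measurable_EFinP; exact: measurable_funX.
  - exact: emeasurable_sum.
  - move=> x _; have [Ox|nOx] := pselect (Omega x); last first.
      by rewrite (test_out tv nOx) expr0n/=; apply: sume_ge0 => c _; rewrite mule0.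
    have [c xc] := cell_cover Ox.
    rewrite (bigD1 c)//= indicE mem_set// mul1e leeDl// sume_ge0// => c' _.
    exact: Iv0.
move: main; under eq_bigr do rewrite kc.
rewrite sumEFin lee_fin sumrB -!mulr_sumr => main.
rewrite -(ler_pM2l m0).
apply: (@le_trans _ _ (m * \sum_c \int[mu]_(x in cell c) (v x ^+ 2))); first by rewrite ler_pM2l.
rewrite mulrDr -mulr_suml [X in _ + X]mulrCA divff ?gt_eqF// mulr1.
move: main; set a := \sum_c _; set b := \sum_c _; set e := energy v => main.
(* [main] bounds [2 * (m * a - b)] by this quantity; its sign allows the spare factor 2 to be
   dropped. *)
have e0 : 0 <= 2 ^+ d * m * (d%:R * mesh ^+ 2 * e).
  apply: mulr_ge0; first by rewrite mulr_ge0 ?exprn_ge0 ?ltW.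
  by rewrite mulr_ge0 ?energy_ge0// mulr_ge0 ?sqr_ge0.
have -> : m * (2 ^+ d * d%:R * mesh ^+ 2 * e) = 2 ^+ d * m * (d%:R * mesh ^+ 2 * e) by ring.
move: main e0; set q := 2 ^+ d * _ * _; lra.
Qed.

End cells.
End Rellich.

(** * Isometries acting on eigenspaces *)

Section isometry_action.
Context (R : realType) (d : nat) (Omega : set 'rV[R]_d).
Hypothesis oO : open Omega.
Variable L : R.
Hypothesis bO : forall x, Omega x -> forall i, `|x ord0 i| < L.
Local Notation mu := (lebesgue_rV R d).
Local Notation test := (test_function Omega).
Local Notation L2 := (L2 Omega).
Local Notation ip := (ip Omega).
Implicit Types (S : Defs.isometry R d) (v w u f : 'rV[R]_d -> R) (g h : 'I_d -> 'rV[R]_d -> R).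

Let mO : measurable Omega := open_measurable_rV oO.

Definition symmetry S := forall x, Omega (isometry_fun S x) <-> Omega x.

Lemma symmetryV S : symmetry S -> symmetry S^-1%g.
Proof. by move=> SO x; rewrite -SO isometry_funVK. Qed.

(** The chain rule for gradients: if [g] is the weak gradient of [u], this is the one of
    [u \o isometry_fun S]. *)
Definition transport S g : 'I_d -> 'rV[R]_d -> R :=
  fun i x => \sum_j (val S).1 j i * g j (isometry_fun S x).

Definition grad_ip g h := \sum_i ip (g i) (h i).

Lemma L2_isometry S f : symmetry S -> L2 f -> L2 (f \o isometry_fun S).
Proof.
move=> SO [mf /integrableP[mf2 f2]]; split; first exact: measurable_fun_isometry.
apply/integrableP; split.
  apply/measurable_EFinP; apply: measurable_funX; exact: measurable_fun_isometry.
rewrite -(integral_domain_isometry mO SO (f := fun x => `|(f x ^+ 2)%:E|%E)) in f2 => //.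
exact: (measurableT_comp (f := abse)).
Qed.

Lemma ip_isometry S f f' : symmetry S -> L2 f -> L2 f' ->
  ip (f \o isometry_fun S) (f' \o isometry_fun S) = ip f f'.
Proof.
move=> SO [mf _] [mf' _].
apply: (Rintegral_domain_isometry mO SO (f := fun x => f x * f' x)).
exact: measurable_funM.
Qed.

Lemma L2_transport S g i : symmetry S -> (forall j, L2 (g j)) -> L2 (transport S g i).
Proof.
move=> SO gL; apply: (L2_sum mO) => j; apply: (L2Z mO).
exact: (L2_isometry SO (gL j)).
Qed.

(** Expanding both transports leaves the coefficients [\sum_i A j i * A k i], which are Kronecker
    deltas since the rows of the linear part [A] are orthonormal. *)
Lemma grad_ip_transport S g h : symmetry S -> (forall j, L2 (g j)) -> (forall j, L2 (h j)) ->
  grad_ip (transport S g) (transport S h) = grad_ip g h.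
Proof.
move=> SO gL hL.
have gS j : L2 (g j \o isometry_fun S) by exact: L2_isometry.
have hS j : L2 (h j \o isometry_fun S) by exact: L2_isometry.
have E i : ip (transport S g i) (transport S h i) =
    \sum_j \sum_k (val S).1 j i * (val S).1 k i * ip (g j) (h k).
  rewrite (ip_suml mO); last 2 first.
  - by move=> j; apply: (L2Z mO); exact: (gS j).
  - exact: L2_transport.
  apply: eq_bigr => j _; rewrite (ipZl mO); [|exact: (gS j)|exact: L2_transport].
  rewrite ipC (ip_suml mO); [|by move=> k; apply: (L2Z mO); exact: (hS k)|exact: (gS j)].
  rewrite mulr_sumr; apply: eq_bigr => k _.
  rewrite (ipZl mO) ?mulrA; [|exact: (hS k)|exact: (gS j)].
  by congr (_ * _ * _); rewrite ipC; exact: ip_isometry.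
rewrite /grad_ip (eq_bigr _ (fun i _ => E i)) exchange_big /=.
apply: eq_bigr => j _; rewrite exchange_big /= (bigD1 j)//= [X in _ + X]big1 ?addr0; last first.
  move=> k kj; rewrite -mulr_suml.
  have := congr1 (fun M : 'M[R]_d => M j k) (eqP (valP S)).
  rewrite !mxE eq_sym (negbTE kj) => jk.
  by rewrite (eq_bigr (fun i => (val S).1 j i * (val S).1^T i k)) ?jk ?mul0r// => i _; rewrite !mxE.
rewrite -mulr_suml.
have := congr1 (fun M : 'M[R]_d => M j j) (eqP (valP S)).
rewrite !mxE eqxx => jj.
by rewrite (eq_bigr (fun i => (val S).1 j i * (val S).1^T i j)) ?jj ?mul1r// => i _; rewrite !mxE.
Qed.

Lemma transportVK S g : transport S (transport S^-1%g g) = g.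
Proof.
apply/funext => i; apply/funext => x; rewrite /transport.
under eq_bigr => j _ do rewrite mulr_sumr isometry_funK.
rewrite exchange_big /=.
have AA k : \sum_j (val S).1 j i * (val S).1 j k = (i == k)%:R.
  have := congr1 (fun M : 'M[R]_d => M i k) (mulmx1C (eqP (valP S))); rewrite !mxE => <-.
  by apply: eq_bigr => j _; rewrite !mxE.
rewrite (eq_bigr (fun k => (i == k)%:R * g k x)); last first.
  move=> k _; rewrite -AA mulr_suml; apply: eq_bigr => j _.
  by rewrite mulrA /= mxE.
rewrite (bigD1 i)//= eqxx mul1r big1 ?addr0// => k ki.
by rewrite eq_sym (negbTE ki) mul0r.
Qed.

Lemma partial_isometry S v i : test v ->
  partial i (v \o isometry_fun S) = transport S (fun j => partial j v) i.
Proof.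
move=> tv; apply/funext => x.
by have [_] := is_derive_isometry S i x (test_smooth tv).
Qed.

Lemma test_isometry S v : symmetry S -> test v -> test (v \o isometry_fun S).
Proof.
move=> SO tv; split; first exact/smooth_gen_smooth/gen_isometry/(test_smooth tv).
case: tv => _ [K [cK KO] v0]; exists (isometry_fun S^-1%g @` K); last first.
  by move=> x nK; apply: v0 => Kx; apply: nK; exists (isometry_fun S x) => //; rewrite isometry_funK.
split; last by move=> _ [x /KO Ox <-]; exact/(symmetryV SO).
apply: continuous_compact cK; apply: continuous_subspaceT; exact: isometry_continuous.
Qed.

Lemma L2_cvg_isometry S (v : nat -> 'rV[R]_d -> R) u : symmetry S ->
  (forall k, L2 (v k)) -> L2 u -> L2_cvg Omega v u ->
  L2_cvg Omega (fun k => v k \o isometry_fun S) (u \o isometry_fun S).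
Proof.
move=> SO vL uL; rewrite !L2_cvgE => vu.
rewrite (_ : (fun k => _) = (fun k => ip (fun x => v k x - u x) (fun x => v k x - u x)))//.
apply/funext => k; have vuL : L2 (fun x => v k x - u x) by exact: (L2B mO).
exact: (ip_isometry SO vuL vuL).
Qed.

Lemma H10_isometry S u g : symmetry S -> H10 Omega u g ->
  H10 Omega (u \o isometry_fun S) (transport S g).
Proof.
move=> SO [uL gL [v [tv vu vg]]]; split.
- exact: L2_isometry.
- by move=> i; exact: L2_transport.
- have vL k : L2 (v k) by exact: (test_L2 oO bO).
  have dvL k i : L2 (partial i (v k)) by apply: (test_L2 oO bO); exact: test_partial.
  exists (fun k => v k \o isometry_fun S); split.
  + by move=> k; exact: test_isometry.
  + exact: L2_cvg_isometry.
  + move=> i.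
    rewrite (_ : (fun k => _) = (fun k x => \sum_j
        ((val S).1 j i * (partial j (v k) \o isometry_fun S) x))); last first.
      by apply/funext => k; rewrite partial_isometry.
    apply: (@L2_cvg_sum _ _ _ mO _ _ (fun j k x => (val S).1 j i * (partial j (v k) \o isometry_fun S) x)
        (fun j x => (val S).1 j i * (g j \o isometry_fun S) x)).
    * by move=> j k; apply: (L2Z mO); exact: L2_isometry.
    * by move=> j; apply: (L2Z mO); exact: L2_isometry.
    * move=> j; apply: (@L2_cvgZ _ _ _ mO _ (fun k => partial j (v k) \o isometry_fun S)
        (g j \o isometry_fun S)).
      - by move=> k; exact: L2_isometry.
      - exact: L2_isometry.
      - by apply: L2_cvg_isometry => //; exact: gL.
Qed.

Lemma H10D u u' g g' : H10 Omega u g -> H10 Omega u' g' ->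
  H10 Omega (fun x => u x + u' x) (fun i x => g i x + g' i x).
Proof.
move=> [uL gL [v [tv vu vg]]] [uL' gL' [v' [tv' vu' vg']]]; split.
- exact: (L2D mO).
- by move=> i; exact: (L2D mO).
- have vL w : test w -> L2 w by exact: (test_L2 oO bO).
  have dvL w i : test w -> L2 (partial i w) by move=> tw; apply: vL; exact: test_partial.
  exists (fun k x => v k x + v' k x); split.
  + by move=> k; exact: testD.
  + by apply: (L2_cvgD mO) => // k; exact: vL.
  + move=> i; rewrite (_ : (fun k => _) = (fun k x => partial i (v k) x + partial i (v' k) x)).
      by apply: (L2_cvgD mO) => // k; exact: dvL.
    by apply/funext => k; rewrite (partial_testD _ (tv k) (tv' k)).
Qed.

Lemma H10Z c u g : H10 Omega u g -> H10 Omega (fun x => c * u x) (fun i x => c * g i x).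
Proof.
move=> [uL gL [v [tv vu vg]]]; split.
- exact: (L2Z mO).
- by move=> i; exact: (L2Z mO).
- have vL w : test w -> L2 w by exact: (test_L2 oO bO).
  have dvL w i : test w -> L2 (partial i w) by move=> tw; apply: vL; exact: test_partial.
  exists (fun k x => c * v k x); split.
  + by move=> k; exact: testZ.
  + by apply: (L2_cvgZ mO) => // k; exact: vL.
  + move=> i; rewrite (_ : (fun k => _) = (fun k x => c * partial i (v k) x)).
      by apply: (L2_cvgZ mO) => // k; exact: dvL.
    by apply/funext => k; rewrite (partial_testZ _ _ (tv k)).
Qed.

(** [transport S] preserves [grad_ip] and is inverse to [transport S^-1], so its adjoint is its
    inverse. *)
Lemma grad_ip_adjoint S g h : symmetry S -> (forall j, L2 (g j)) -> (forall j, L2 (h j)) ->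
  grad_ip (transport S g) h = grad_ip g (transport S^-1%g h).
Proof.
move=> SO gL hL; rewrite -[in LHS](transportVK S h) grad_ip_transport// => j.
exact: (L2_transport j (symmetryV SO) hL).
Qed.

Lemma ip_adjoint S f f' : symmetry S -> L2 f -> L2 f' ->
  ip (f \o isometry_fun S) f' = ip f (f' \o isometry_fun S^-1%g).
Proof.
move=> SO fL fL'; rewrite -(ip_isometry SO fL (L2_isometry (symmetryV SO) fL')).
congr ip; apply/funext => x /=; by rewrite isometry_funK.
Qed.

(** The weak formulation alone: square integrability of [t * u] is already part of [H10]. *)
Lemma eigenspaceE t u : Defs.eigenspace Omega t u <-> exists2 g, H10 Omega u g &
  forall psi, test psi -> grad_ip g (fun i => partial i psi) = t * ip u psi.
Proof.
split=> [[_ [g ug gE]]|[g ug gE]].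
  exists g => // psi tpsi; rewrite [LHS](gE psi tpsi) -(ipZl mO)//; first by case: ug.
  exact: (test_L2 oO bO).
have uL : L2 u by case: ug.
split; first exact: (L2Z mO).
exists g => // psi tpsi; rewrite [LHS](gE psi tpsi) -(ipZl mO)//.
exact: (test_L2 oO bO).
Qed.

Lemma eigenspace_L2 t u : Defs.eigenspace Omega t u -> L2 u.
Proof. by move=> /eigenspaceE[g []]. Qed.

(** In the weak equation [S] moves from [u] to [psi] as its inverse, and [psi \o S^-1] is again a
    test function. *)
Lemma eigenspace_isometry S t u : symmetry S -> Defs.eigenspace Omega t u ->
  Defs.eigenspace Omega t (u \o isometry_fun S).
Proof.
move=> SO /eigenspaceE[g ug gE]; apply/eigenspaceE; exists (transport S g).
  exact: H10_isometry.
have [uL gL _] := ug; have SVO := symmetryV SO.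
move=> psi tpsi; have tpsiS := test_isometry SVO tpsi.
rewrite grad_ip_adjoint//; last by move=> i; apply: (test_L2 oO bO); exact: test_partial.
rewrite ip_adjoint//; last exact: (test_L2 oO bO).
rewrite -gE//; congr grad_ip; apply/funext => i; by rewrite partial_isometry.
Qed.

Lemma eigenspaceZ c t u : Defs.eigenspace Omega t u -> Defs.eigenspace Omega t (fun x => c * u x).
Proof.
move=> /eigenspaceE[g ug gE]; apply/eigenspaceE; exists (fun i x => c * g i x).
  exact: H10Z.
have [uL gL _] := ug; move=> psi tpsi; rewrite (ipZl mO)//; last exact: (test_L2 oO bO).
rewrite mulrCA -gE// mulr_sumr; apply: eq_bigr => i _; rewrite (ipZl mO)//.
by apply: (test_L2 oO bO); exact: test_partial.
Qed.

End isometry_action.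

(** A cluster point of an ultrafilter is a limit. A single ultrafilter thus gives limits to all
    bounded sequences at once, without nested extractions. *)
Lemma ultra_bounded_cvg (R : realType) (G : set_system nat) (u : nat -> R) (B : R) :
  UltraFilter G -> (forall k, `|u k| <= B) -> exists l : R, u @ G --> l.
Proof.
move=> UG uB; have PG : ProperFilter G by exact: ultra_proper.
have cB : compact `[- B, B]%classic by exact: segment_compact.
have GB : G (u @^-1` `[- B, B]%classic).
  apply: (@filterS _ G _ setT) => [k _|]; last exact: filterT.
  by rewrite /= in_itv /= -ler_norml.
have [l [_ lc]] := cB (u @ G) _ GB.
exists l => V Vl; have [//|GV] := in_ultra_setVsetC (u @^-1` V) UG.
have [y [nVy Vy]] : (~` V `&` V) !=set0.
  exact: (lc (~` V) V GV Vl).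
by [].
Qed.

(** * Compactness in L2 of sequences with bounded energy *)

Section compactness.
Context (R : realType) (d : nat) (Omega : set 'rV[R]_d).
Hypothesis oO : open Omega.
Variable L : R.
Hypothesis L0 : 0 < L.
Hypothesis bO : forall x, Omega x -> forall i, `|x ord0 i| < L.
Local Notation test := (test_function Omega).
Local Notation L2 := (L2 Omega).
Local Notation ip := (ip Omega).
Implicit Types (v w : 'rV[R]_d -> R).

Let mO : measurable Omega := open_measurable_rV oO.
Let tL2 v : test v -> L2 v := @test_L2 _ _ _ oO _ bO v.

Let tdL2 v i : test v -> L2 (partial i v).
Proof. by move=> tv; apply: tL2; exact: test_partial. Qed.

Lemma energyD_grad v w : test v -> test w ->
  energy Omega (fun x => v x + w x) =
  energy Omega v + 2 * grad_ip Omega (fun i => partial i v) (fun i => partial i w) + energy Omega w.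
Proof.
move=> tv tw; rewrite /energy mulr_sumr -!big_split; apply: eq_bigr => i _.
by rewrite (partial_testD _ tv tw) (ip_sqrD mO)//; exact: tdL2.
Qed.

Lemma energyZ c v : test v -> energy Omega (fun x => c * v x) = c ^+ 2 * energy Omega v.
Proof.
move=> tv; rewrite /energy mulr_sumr; apply: eq_bigr => i _.
by rewrite (partial_testZ _ _ tv) (ip_sqrZ mO)//; exact: tdL2.
Qed.

Lemma energyB_grad v w : test v -> test w ->
  energy Omega (fun x => v x - w x) =
  energy Omega v - 2 * grad_ip Omega (fun i => partial i v) (fun i => partial i w) + energy Omega w.
Proof.
move=> tv tw; rewrite /energy mulr_sumr -sumrN -!big_split; apply: eq_bigr => i _ /=.
by rewrite (partial_testB _ tv tw) (ip_sqrB mO)//; exact: tdL2.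
Qed.

Lemma energyB_parallelogram v w : test v -> test w ->
  energy Omega (fun x => v x - w x) =
  2 * energy Omega v + 2 * energy Omega w - energy Omega (fun x => v x + w x).
Proof.
move=> tv tw; have := energyD_grad tv tw; have := energyB_grad tv tw.
move: (energy Omega v) (energy Omega w) (energy Omega _) (energy Omega _) (grad_ip _ _ _).
by move=> a b x y c -> ->; ring.
Qed.

(** At each precision a fine grid makes the energy term of [Rellich] small; the finitely many cell
    integrals then settle along the ultrafilter [G]. *)
Lemma Rellich_subsequence (w : nat -> 'rV[R]_d -> R) (M : R) : (forall k, test (w k)) ->
  (forall k, ip (w k) (w k) <= 1) -> (forall k, energy Omega (w k) <= M) ->
  exists s : nat -> nat, (forall k, (k <= s k)%N) /\
    forall n i j, (n <= i)%N -> (n <= j)%N ->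
    ip (fun x => w (s i) x - w (s j) x) (fun x => w (s i) x - w (s j) x) <= n.+1%:R^-1.
Proof.
move=> tw w1 wM.
have M0 : 0 <= M by apply: le_trans (wM 0%N); exact: energy_ge0.
have [G [UG Goo]] := ultraFilterLemma (F := \oo) _.
have PG : ProperFilter G by exact: ultra_proper.
have small n : exists A, G A /\ forall i j, A i -> A j ->
    ip (fun x => w i x - w j x) (fun x => w i x - w j x) <= n.+1%:R^-1.
  pose e : R := n.+1%:R^-1 / 2.
  have e0 : 0 < e by rewrite divr_gt0// invr_gt0.
  (* By the parallelogram law, [4 * M] bounds the energy of a difference [w i - w j]. *)
  have [N N0 NP] : exists2 N : nat, (0 < N)%N &
      2 ^+ d * d%:R * mesh L N ^+ 2 * (4 * M) <= e.
    pose C := 2 ^+ d * d%:R * (2 * L) ^+ 2 * (4 * M).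
    have C0 : 0 <= C by apply: mulr_ge0; [rewrite mulr_ge0 ?sqr_ge0// mulr_ge0 ?exprn_ge0|rewrite mulr_ge0].
    exists (Num.truncn (C / e)).+1 => //; set N := (Num.truncn _).+1.
    have N1 : 1 <= N%:R :> R by rewrite ler1n.
    have -> : 2 ^+ d * d%:R * mesh L N ^+ 2 * (4 * M) = C / N%:R ^+ 2.
      by rewrite /mesh /C; field; rewrite pnatr_eq0.
    rewrite ler_pdivrMr; last by rewrite exprn_gt0// ltr0n.
    have : C <= e * N%:R by rewrite mulrC -ler_pdivrMr// ltW// truncnS_gt.
    move/le_trans; apply; rewrite ler_wpM2l ?(ltW e0)// expr2 ler_peMl//.
  pose h := mesh L N.
  have h0 : 0 < h by rewrite divr_gt0 ?ltr0n// mulr_gt0.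
  pose ell (c : {ffun 'I_d -> 'I_N}) k := ip (w k) \1_(cell L c).
  have cL (c : {ffun 'I_d -> 'I_N}) : L2 (\1_(cell L c) : 'rV[R]_d -> R) by exact: (L2_indic_cell oO bO).
  have ellb (c : {ffun 'I_d -> 'I_N}) k : `|ell c k| <= Num.sqrt (ip \1_(cell L c) \1_(cell L c)).
    rewrite /ell; apply: (le_trans (ip_CS mO (tL2 (tw k)) (cL c))).
    rewrite -[leRHS]mul1r ler_wpM2r ?sqrtr_ge0//.
    by rewrite -sqrtr1 ler_wsqrtr.
  have /choice[l lP] c : exists l : R, ell c @ G --> l by exact: ultra_bounded_cvg (ellb c).
  (* Two cell integrals within [eta] of their limit differ by at most [2 * eta]; summing the squares
     over all cells and dividing by the cell volume gives [K * eta ^+ 2]. *)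
  pose K : R := #|{ffun 'I_d -> 'I_N}|%:R * 4 / h ^+ d.
  have K0 : 0 <= K by rewrite !mulr_ge0 ?invr_ge0 ?exprn_ge0// ltW.
  (* [eta <= 1] gives [eta ^+ 2 <= eta], and [K + 1] is a positive denominator even if [K] is
     zero. *)
  pose eta : R := Num.min 1 (e / (K + 1)).
  have eta0 : 0 < eta by rewrite lt_min ltr01 divr_gt0// ltr_wpDl.
  have Keta : K * eta ^+ 2 <= e.
    have eta1 : eta <= 1 by rewrite ge_min lexx.
    have eta2 : eta <= e / (K + 1) by rewrite ge_min lexx orbT.
    have : eta * (K + 1) <= e by rewrite -ler_pdivlMr// ltr_wpDl.
    nra.
  exists [set k | forall c, `|l c - ell c k| <= eta]; split.
    by apply: filter_forall => c; have /cvgrPdist_le/(_ eta eta0) := lP c.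
  move=> i j Ai Aj; have tij := testB (tw i) (tw j).
  apply: le_trans (Rellich oO L0 bO N0 tij) _.
  rewrite (_ : n.+1%:R^-1 = e + e); last by rewrite -splitr.
  apply: lerD.
    apply: le_trans NP; rewrite ler_wpM2l//.
      by rewrite mulr_ge0 ?sqr_ge0// mulr_ge0 ?exprn_ge0.
    rewrite energyB_parallelogram//.
    have := energy_ge0 Omega (fun x => w i x + w j x); have := wM i; have := wM j.
    by move: (energy Omega _) (energy Omega _) (energy Omega _) => a b c; lra.
  apply: le_trans Keta.
  apply: (@le_trans _ _ (\sum_(c : {ffun 'I_d -> 'I_N}) 4 * eta ^+ 2 / h ^+ d)).
    apply: ler_sum => c _; rewrite ler_wpM2r ?invr_ge0 ?exprn_ge0 ?(ltW h0)//.
    rewrite (ipBl mO)//; [|exact: tL2|exact: tL2].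
    have := Ai c; have := Aj c; rewrite /ell /= !ler_norml => /andP[a1 a2] /andP[a3 a4].
    rewrite (_ : 4 * eta ^+ 2 = (2 * eta) ^+ 2); last by ring.
    rewrite -real_normK ?num_real// lerXn2r ?nnegrE ?mulr_ge0 ?(ltW eta0)//.
    by rewrite ler_norml; apply/andP; split; lra.
  rewrite sumr_const -mulr_natl /K le_eqVlt; apply/predU1l; ring.
have /choice[A AP] := small.
(* A diagonal choice: taking [s k] in [A i] for all [i <= k] makes one sequence serve every
   precision, and only finite intersections of members of [G] are used. *)
have GA n : G [set k | (n <= k)%N /\ forall i, (i <= n)%N -> A i k].
  apply: filterI; first by apply: Goo; exact: nbhs_infty_ge.
  elim: n => [|n IH].
    have [GA0 _] := AP 0%N; move: GA0; apply: filterS => k Ak i.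
    by rewrite leqn0 => /eqP ->.
  have [GAn _] := AP n.+1.
  apply: (@filterS _ G _ ([set k | forall i, (i <= n)%N -> A i k] `&` A n.+1)); last exact: filterI.
  move=> k [IHk Ak] i.
  by rewrite leq_eqVlt => /predU1P[->//|]; rewrite ltnS; exact: IHk.
have /choice[s sP] n : exists k, (n <= k)%N /\ forall i, (i <= n)%N -> A i k.
  by have [k] := filter_ex (GA n); exists k.
exists s; split; first by move=> k; have [] := sP k.
move=> n i j ni nj; have [_ + ] := AP n; apply.
  by have [_] := sP i; apply.
by have [_] := sP j; apply.
Qed.

End compactness.

(** * Minimizing the Rayleigh quotient on coboundaries *)

Section variational.
Context (R : realType) (d : nat) (Omega : set 'rV[R]_d).
Hypothesis oO : open Omega.
Variable L : R.
Hypothesis L0 : 0 < L.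
Hypothesis bO : forall x, Omega x -> forall i, `|x ord0 i| < L.
Variable S : Defs.isometry R d.
Hypothesis SO : symmetry Omega S.
Local Notation test := (test_function Omega).
Local Notation L2 := (L2 Omega).
Local Notation ip := (ip Omega).
Local Notation grad v := (fun i => partial i v).
Implicit Types (u v w : 'rV[R]_d -> R) (g : 'I_d -> 'rV[R]_d -> R).

Let mO : measurable Omega := open_measurable_rV oO.
Let tL2 v : test v -> L2 v.
Proof. exact: (test_L2 oO bO). Qed.
Let tdL2 v i : test v -> L2 (partial i v).
Proof. by move=> tv; apply: tL2; exact: test_partial. Qed.
Let SVO : symmetry Omega S^-1%g := symmetryV SO.

Definition coboundary v := fun x => v x - v (isometry_fun S x).

Lemma test_coboundary v : test v -> test (coboundary v).
Proof. by move=> tv; apply: testB => //; exact: test_isometry. Qed.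

(** For invariant [u], [ip u (v \o S)] equals [ip (u \o S) (v \o S)], which is [ip u v]. *)
Lemma ip_invariant_coboundary u v : L2 u -> ae_eq_on Omega (u \o isometry_fun S) u -> test v ->
  ip u (coboundary v) = 0.
Proof.
move=> uL uS tv; have vL := tL2 tv; have vSL := L2_isometry oO SO vL.
have uSL := L2_isometry oO SO uL.
rewrite (ipBr mO vL vSL uL) -(ae_eq_ip mO uSL uL vSL uS) (ip_isometry oO SO uL vL).
exact: subrr.
Qed.

(** Composition with [S] is unitary, hence [1 - S] has adjoint [1 - S^-1]. *)
Lemma ip_coboundary u v : L2 u -> test v ->
  ip u (coboundary v) = ip (fun x => u x - u (isometry_fun S^-1%g x)) v.
Proof.
move=> uL tv; have vL := tL2 tv; have vSL := L2_isometry oO SO vL.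
rewrite (ipBr mO vL vSL uL) (ipBl mO uL (L2_isometry oO SVO uL) vL).
by rewrite (ip_adjoint oO SVO uL vL) invgK.
Qed.

Lemma grad_ip_coboundary g v : (forall i, L2 (g i)) -> test v ->
  grad_ip Omega g (grad (coboundary v)) =
  grad_ip Omega (fun i x => g i x - transport S^-1%g g i x) (grad v).
Proof.
move=> gL tv; have tvS := test_isometry SO tv.
have gSL i : L2 (transport S^-1%g g i) by exact: L2_transport.
transitivity (grad_ip Omega g (grad v) - grad_ip Omega g (transport S (grad v))).
  rewrite -sumrB; apply: eq_bigr => i _.
  rewrite (partial_testB i tv tvS) (partial_isometry _ _ tv).
  have tL : L2 (transport S (grad v) i) by apply: L2_transport => // j; exact: tdL2.
  exact: (ipBr mO (tdL2 i tv) tL (gL i)).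
transitivity (grad_ip Omega g (grad v) - grad_ip Omega (transport S^-1%g g) (grad v)).
  congr (_ - _); rewrite (grad_ip_adjoint oO SVO gL) ?invgK// => j; exact: tdL2.
rewrite -sumrB; apply: eq_bigr => i _.
by rewrite -(ipBl mO (gL i) (gSL i) (tdL2 i tv)).
Qed.

Lemma eigenspace_coboundary t u g : H10 Omega u g ->
  (forall v, test v -> grad_ip Omega g (grad (coboundary v)) = t * ip u (coboundary v)) ->
  Defs.eigenspace Omega t (fun x => u x - u (isometry_fun S^-1%g x)).
Proof.
move=> ug uE; have [uL gL _] := ug.
apply/(eigenspaceE oO bO).
exists (fun i x => g i x - transport S^-1%g g i x).
  have := H10D oO bO ug (H10Z oO bO (-1) (H10_isometry oO bO SVO ug)).
  congr (H10 _ _ _); first by apply/funext => x; rewrite mulN1r.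
  by apply/funext => i; apply/funext => x; rewrite mulN1r.
by move=> psi tpsi; rewrite -grad_ip_coboundary// uE// ip_coboundary.
Qed.

(** An invariant [w] would be orthogonal to [u]. Since [ip w w = 2 * ip w u], it would vanish,
    making [u] itself invariant and hence orthogonal to itself. *)
Lemma eigenspace_coboundary_noninvariant u (v : nat -> 'rV[R]_d -> R) : L2 u ->
  (forall k, test (v k)) -> L2_cvg Omega (fun k => coboundary (v k)) u -> ip u u != 0 ->
  let w := fun x => u x - u (isometry_fun S^-1%g x) in
  ~ ae_eq_on Omega (w \o isometry_fun S) w.
Proof.
move=> uL tv vu /negP u0 w wS; have uVL := L2_isometry oO SVO uL.
have wL : L2 w by exact: (L2B mO uL uVL).
have cL k : L2 (coboundary (v k)) by apply: tL2; exact: test_coboundary.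
have orth f : L2 f -> ae_eq_on Omega (f \o isometry_fun S) f -> ip f u = 0.
  move=> fL fS.
  have := L2_cvg_ip mO (fun _ => fL) fL cL uL (L2_cvg_cst mO f) vu.
  rewrite (_ : (fun k => _) = cst 0); first by move/cvg_lim => <- //; exact: lim_cst.
  by apply/funext => k; rewrite ip_invariant_coboundary.
have wu := orth w wL wS.
have ww : ip w w = 0.
  have E1 : ip w u = ip u u - ip (u \o isometry_fun S^-1%g) u by exact: (ipBl mO uL uVL uL).
  have E2 := ip_sqrB mO uL uVL.
  have E3 := ip_isometry oO SVO uL uL.
  rewrite [LHS]E2 E3; move: E1; rewrite wu (ipC _ u).
  by move: (ip u u) (ip u _) => a b; lra.
have w0 := ip_eq0 mO wL ww.
apply: u0; apply/eqP; apply: orth => //.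
have := ae_domain_isometry SO w0; apply: filterS => x h Ox /=.
have := h Ox; rewrite /w isometry_funK => /eqP; rewrite subr_eq0 => /eqP ->.
by [].
Qed.

Lemma coboundaryD v v' : coboundary (fun x => v x + v' x) =
  (fun x => coboundary v x + coboundary v' x).
Proof. by apply/funext => x; rewrite /coboundary; ring. Qed.

Lemma coboundaryZ c v : coboundary (fun x => c * v x) = (fun x => c * coboundary v x).
Proof. by apply/funext => x; rewrite /coboundary mulrBr. Qed.

Let q v := ip (coboundary v) (coboundary v).
Let e v := energy Omega (coboundary v).

Let qZ c v : test v -> q (fun x => c * v x) = c ^+ 2 * q v.
Proof.
by move=> tv; rewrite /q coboundaryZ (ip_sqrZ mO)//; apply: tL2; exact: test_coboundary.
Qed.

Let eZ c v : test v -> e (fun x => c * v x) = c ^+ 2 * e v.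
Proof.
by move=> tv; rewrite /e coboundaryZ (energyZ oO bO)//; exact: test_coboundary.
Qed.

Let q_ge0 v : 0 <= q v. Proof. exact: ip_ge0. Qed.
Let e_ge0 v : 0 <= e v. Proof. exact: energy_ge0. Qed.

Let normalize v : test v -> q v != 0 -> q (fun x => (Num.sqrt (q v))^-1 * v x) = 1.
Proof.
move=> tv qv; rewrite qZ// exprVn sqr_sqrtr//.
exact: mulVf.
Qed.

Let Rayleigh := [set e v | v in [set v | test v /\ q v = 1]].

(** The bound on the unit sphere extends by homogeneity; for [q v = 0] it only says that the energy
    is nonnegative. *)
Let Rayleigh_inf v : test v -> inf Rayleigh * q v <= e v.
Proof.
move=> tv; have [->|qv] := eqVneq (q v) 0; first by rewrite mulr0.
have qv0 : 0 < q v by rewrite lt_neqAle eq_sym qv q_ge0.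
have : inf Rayleigh <= e (fun x => (Num.sqrt (q v))^-1 * v x).
  apply: ge_inf; first by exists 0 => _ [w _ <-].
  exists (fun x => (Num.sqrt (q v))^-1 * v x) => //; split; last exact: normalize.
  exact: testZ.
by rewrite eZ// exprVn sqr_sqrtr// ler_pdivlMl// mulrC.
Qed.

(** The first variation vanishes at a minimum. At [t = - X / (Y + 1)] the polynomial is
    [- X ^ 2 (Y + 2) / (Y + 1) ^ 2]; adding 1 to [Y] avoids dividing by zero. *)
Let quadratic_nonneg (X Y : R) : 0 <= Y -> (forall t, 0 <= 2 * t * X + t ^+ 2 * Y) -> X = 0.
Proof.
move=> Y0 h; have Y1 : 0 < Y + 1 by rewrite ltr_wpDl.
have := h (- X / (Y + 1)).
rewrite (_ : _ + _ = - (X ^+ 2 * (Y + 2)) / (Y + 1) ^+ 2); last by field; rewrite gt_eqF.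
rewrite pmulr_lge0 ?invr_gt0 ?exprn_gt0// oppr_ge0 pmulr_lle0; last by rewrite ltr_wpDl.
by move=> X2; apply/eqP; rewrite -sqrf_eq0 eq_le X2 sqr_ge0.
Qed.

(* Minimizing over coboundaries replaces the expansion in eigenfunctions: only
   one non-invariant eigenfunction is needed. *)
Lemma Rayleigh_minimizer : (exists2 v0, test v0 & q v0 != 0) ->
  exists t u g (v : nat -> 'rV[R]_d -> R),
  [/\ H10 Omega u g, ip u u = 1, forall k, test (v k),
      L2_cvg Omega (fun k => coboundary (v k)) u &
      forall v', test v' -> grad_ip Omega g (grad (coboundary v')) = t * ip u (coboundary v')].
Proof.
move=> hv0; have [v0 tv0 qv0] := hv0.
have infR : has_inf Rayleigh.
  split; last by exists 0 => _ [w _ <-].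
  exists (e (fun x => (Num.sqrt (q v0))^-1 * v0 x)); exists (fun x => (Num.sqrt (q v0))^-1 * v0 x) => //.
  by split; [exact: testZ|exact: normalize].
set m := inf Rayleigh.
have mq v : test v -> m * q v <= e v by exact: Rayleigh_inf.
have m0 : 0 <= m by apply: lb_le_inf; [exact: infR.1|move=> _ [w _ <-]].
have /choice[v vP] k : exists v, [/\ test v, q v = 1 & e v <= m + k.+1%:R^-1].
  have k0 : 0 < k.+1%:R^-1 :> R by rewrite invr_gt0.
  have [_ [v [tv qv] <-] ev] := inf_adherent k0 infR.
  by exists v; split=> //; exact: ltW.
have tv k : test (v k) by have [] := vP k.
have qv k : q (v k) = 1 by have [] := vP k.
have ev k : e (v k) <= m + k.+1%:R^-1 by have [] := vP k.
have tw k : test (coboundary (v k)) by exact: test_coboundary.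
have [s [ks sC]] : exists s : nat -> nat, (forall k, (k <= s k)%N) /\
    forall n i j, (n <= i)%N -> (n <= j)%N ->
    ip (fun x => coboundary (v (s i)) x - coboundary (v (s j)) x)
       (fun x => coboundary (v (s i)) x - coboundary (v (s j)) x) <= n.+1%:R^-1.
  apply: (Rellich_subsequence oO L0 bO (M := m + 1) tw).
    by move=> k; rewrite -/(q (v k)) qv.
  move=> k; apply: le_trans (ev k) _; rewrite lerD2l invf_le1// ler1n//.
pose w k := coboundary (v (s k)).
have twk k : test (w k) by exact: tw.
have wL k : L2 (w k) by exact: tL2.
have ew k : e (v (s k)) <= m + k.+1%:R^-1.
  apply: le_trans (ev _) _; rewrite lerD2l lef_pV2 ?posrE ?ltr0n// ler_nat ltnS.
  exact: ks.
have small (eps : R) : 0 < eps -> exists N : nat, N.+1%:R^-1 <= eps.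
  move=> eps0; exists (Num.truncn eps^-1).
  by rewrite invf_ple ?posrE// ltW// truncnS_gt.
have [u uL wu] : exists2 u, L2 u & L2_cvg Omega w u.
  apply: (L2_complete mO wL) => eps /small[N NP]; exists N => i j Ni Nj.
  exact: le_trans (sC N i j Ni Nj) NP.
(* Put [r = 1 / (n + 1)]. The energies of [w i] and [w j] are at most [m + r], while that of
   [w i + w j] is at least [m] times its square norm, hence at least [m * (4 - r)]. The
   parallelogram law leaves [4 r + m r]. *)
have eC n i j : (n <= i)%N -> (n <= j)%N ->
    energy Omega (fun x => w i x - w j x) <= (4 + m) * n.+1%:R^-1.
  move=> ni nj; rewrite (energyB_parallelogram oO bO (twk i) (twk j)).
  have h1 := mq _ (testD (tv (s i)) (tv (s j))).
  rewrite /q /e coboundaryD in h1.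
  have hD := ip_sqrD mO (wL i) (wL j).
  have hB := ip_sqrB mO (wL i) (wL j).
  have hC := sC n i j ni nj.
  have qi : ip (w i) (w i) = 1 := qv (s i).
  have qj : ip (w j) (w j) = 1 := qv (s j).
  have ni1 : i.+1%:R^-1 <= n.+1%:R^-1 :> R by rewrite lef_pV2 ?posrE ?ltr0n// ler_nat ltnS.
  have nj1 : j.+1%:R^-1 <= n.+1%:R^-1 :> R by rewrite lef_pV2 ?posrE ?ltr0n// ler_nat ltnS.
  have ei := le_trans (ew i) (lerD (lexx m) ni1).
  have ej := le_trans (ew j) (lerD (lexx m) nj1).
  move: h1 hD hB hC ei ej; rewrite qi qj /e -/(w i) -/(w j).
  move: (energy Omega _) (energy Omega _) (energy Omega _) => a b c.
  move: (ip _ _) (ip _ _) (ip _ _) => x y z.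
  move: (n.+1%:R^-1) => r h1 hD hB hC ei ej.
  have := ler_wpM2l m0 hC.
  by rewrite hB; rewrite hD in h1; lra.
have /choice[g gP] i : exists gi, L2 gi /\ L2_cvg Omega (fun k => partial i (w k)) gi.
  suff [gi ? ?] : exists2 gi, L2 gi & L2_cvg Omega (fun k => partial i (w k)) gi by exists gi.
  apply: (L2_complete mO) => [k|eps eps0]; first exact: tdL2.
  have m4 : 0 < 4 + m by rewrite ltr_pwDl.
  have [N NP] := small (eps / (4 + m)) (divr_gt0 eps0 m4).
  exists N => a b Na Nb; apply: (@le_trans _ _ ((4 + m) * N.+1%:R^-1)); last first.
    by rewrite mulrC -ler_pdivlMr.
  apply: le_trans (eC N a b Na Nb).
  rewrite -(partial_testB i (twk a) (twk b)) /energy (bigD1 i)//= lerDl.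
  by apply: sumr_ge0 => j _; exact: ip_ge0.
have gL i : L2 (g i) by have [] := gP i.
have wg i : L2_cvg Omega (fun k => partial i (w k)) (g i) by have [] := gP i.
have dwL i k : L2 (partial i (w k)) by exact: tdL2.
have uu : ip u u = 1.
  have := L2_cvg_ip mO wL uL wL uL wu wu.
  rewrite (_ : (fun k => _) = cst 1); last by apply/funext => k; exact: qv.
  by move/cvg_lim => <- //; exact: lim_cst.
exists m, u, g, (v \o s); split => //.
- by split=> //; exists w; split.
- by move=> k; exact: tv.
move=> v' tv'; set psi := coboundary v'.
have tpsi : test psi by exact: test_coboundary.
have psiL := tL2 tpsi; have dpsiL i : L2 (partial i psi) by exact: tdL2.
pose X_ k := grad_ip Omega (grad (w k)) (grad psi) - m * ip (w k) psi.
pose X := grad_ip Omega g (grad psi) - m * ip u psi.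
pose Y := e v' - m * q v'.
have XX : X_ @ \oo --> X.
  apply: cvgB; last first.
    by apply: cvgMr; exact: (L2_cvg_ip mO wL uL (fun=> psiL) psiL wu (L2_cvg_cst mO psi)).
  apply: cvg_big => [|i _]; first exact: add_continuous.
  exact: (L2_cvg_ip mO (dwL i) (gL i) (fun=> dpsiL i) (dpsiL i) (wg i) (L2_cvg_cst mO _)).
have Y0 : 0 <= Y by rewrite subr_ge0 mq.
suff : X = 0 by move/eqP; rewrite subr_eq0 => /eqP.
apply: quadratic_nonneg Y0 _ => t.
(* The variation is made at [w k] and not at the limit [u], which need not be the coboundary of a
   test function. As [w k] only nearly minimizes, a slack [1 / (k + 1)] appears and vanishes in the
   limit. *)
have ineq k : 0 <= k.+1%:R^-1 + 2 * t * X_ k + t ^+ 2 * Y.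
  have := mq _ (testD (tv (s k)) (testZ t tv')).
  rewrite /q /e coboundaryD coboundaryZ -/psi -/(w k).
  have tpsiL := L2Z mO t psiL.
  rewrite (ip_sqrD mO (wL k) tpsiL) (ipZr mO t psiL (wL k)) (ip_sqrZ mO t psiL).
  rewrite (energyD_grad oO bO (twk k) (testZ t tpsi)) (energyZ oO bO t tpsi).
  have -> : grad_ip Omega (grad (w k)) (grad (fun x => t * psi x)) =
      t * grad_ip Omega (grad (w k)) (grad psi).
    rewrite /grad_ip mulr_sumr; apply: eq_bigr => i _.
    by rewrite (partial_testZ t i tpsi) (ipZr mO t (dpsiL i) (dwL i k)).
  have -> : ip (w k) (w k) = 1 := qv (s k).
  have := ew k; rewrite /e -/(w k) /Y /X_ /e /q -/psi.
  move: (energy Omega (w k)) (energy Omega psi) (grad_ip _ _ _) (ip (w k) psi) (ip psi psi) (k.+1%:R^-1).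
  by move=> a b c x y r; lra.
have zc : (fun k => k.+1%:R^-1 + 2 * t * X_ k + t ^+ 2 * Y) @ \oo --> 0 + 2 * t * X + t ^+ 2 * Y.
  apply: cvgD; last exact: cvg_cst.
  by apply: cvgD; [exact: cvg_harmonic|exact: cvgMr].
rewrite add0r in zc; rewrite -(cvg_lim _ zc)//; apply: limr_ge.
  by apply/cvg_ex; eexists; exact: zc.
exact: nearW.
Qed.

Lemma noninvariant_eigenfunction : (exists2 v, test v & ip (coboundary v) (coboundary v) != 0) ->
  exists t u, Defs.eigenspace Omega t u /\ ~ ae_eq_on Omega (u \o isometry_fun S) u.
Proof.
move=> /Rayleigh_minimizer[t [u [g [v [ug uu tv vu EL]]]]].
exists t, (fun x => u x - u (isometry_fun S^-1%g x)); split.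
  exact: eigenspace_coboundary ug EL.
apply: (eigenspace_coboundary_noninvariant _ tv vu); last by rewrite uu oner_eq0.
by case: ug.
Qed.

End variational.

(** * Bump functions and domains *)

Section bump.
Context (R : realType) (d : nat).
Local Notation mu := (lebesgue_rV R d).
Implicit Types (Omega : set 'rV[R]_d) (x : 'rV[R]_d).

Lemma open_lebesgue_gt0 Omega x : open Omega -> Omega x -> (0 < mu Omega)%E.
Proof.
move=> oO Ox.
have /nbhs_ballP[e /= e0 eO] : nbhs x Omega by apply: open_nbhs_nbhs.
pose I i := `](x ord0 i - e), (x ord0 i + e)[.
apply: (@lt_le_trans _ _ (mu [set y : 'rV[R]_d | forall i, [set` I i] (y ord0 i)])).
  rewrite (lebesgue_rV_rect (A := fun i => [set` I i])).
    rewrite (eq_bigr (fun=> (2 * e)%:E)) => [|i _].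
      by rewrite prodEFin prodr_const card_ord lte_fin exprn_gt0// mulr_gt0.
    rewrite lebesgue_measure_itv/= lte_fin ltrD2l gtrN// -EFinB; congr _%:E.
    by ring.
  by move=> i; exact: measurable_itv.
apply: le_measure; rewrite ?inE; [exact: measurable_box|exact: open_measurable_rV|].
move=> y /= yI; apply: eO; apply/rV_ballE => // i.
have := yI i; rewrite in_itv /= => /andP[h1 h2].
by rewrite ltr_norml; apply/andP; split; lra.
Qed.

Lemma continuous_not_ae0 Omega (f : 'rV[R]_d -> R) x : open Omega -> Omega x ->
  continuous f -> f x != 0 -> ~ ae_eq_on Omega f (fun=> 0).
Proof.
move=> oO Ox cf fx0 [N [mN N0 fN]].
pose U := Omega `&` f @^-1` [set y | y != 0].
have oU : open U.
  apply: openI => //; move/continuousP: cf; apply.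
  rewrite (_ : [set y : R | y != 0] = ~` [set 0]).
    by rewrite openC; exact: closed_eq.
  by apply/seteqP; split => y /= /eqP.
have := open_lebesgue_gt0 oU (conj Ox fx0).
rewrite lt_neqAle eq_sym => /andP[/negP U0 _]; apply: U0.
rewrite -measure_le0 -N0; apply: le_measure; rewrite ?inE//.
  exact: open_measurable_rV.
by move=> y [Oy fy]; apply: fN => /= /(_ Oy) fy0; move: fy; rewrite /= fy0 eqxx.
Qed.

Lemma smooth_gen_prod (I : Type) (r : seq I) (F : I -> 'rV[R]_d -> R) :
  (forall i, smooth_gen (F i)) -> smooth_gen (fun x => \prod_(i <- r) F i x).
Proof.
move=> gF; elim: r => [|i r IH].
  rewrite (_ : (fun _ => _) = cst 1); first exact: gen_cst.
  by apply/funext => x; rewrite big_nil.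
rewrite (_ : (fun _ => _) = F i * (fun x => \prod_(j <- r) F j x)).
  exact: gen_mul.
by apply/funext => x; rewrite big_cons.
Qed.

(** Vanishing as soon as one coordinate is at distance [r] is the form needed later, where only one
    coordinate is known to be moved by [S]. *)
Lemma test_bump Omega x r : open Omega -> 0 < r ->
  (forall y : 'rV[R]_d, (forall i, `|y ord0 i - x ord0 i| <= r) -> Omega y) ->
  exists v, [/\ test_function Omega v, v x != 0 &
    forall (y : 'rV[R]_d) i, r <= `|y ord0 i - x ord0 i| -> v y = 0].
Proof.
move=> oO r0 xO.
(* The product is nonzero exactly when [y] and [x] differ by less than [r] in coordinate [i]; both
   arguments have the affine form of [gen_flat]. *)
pose F i (y : 'rV[R]_d) := exp_flat 0 ((r - x ord0 i) + 1 * y ord0 i) *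
  exp_flat 0 ((r + x ord0 i) + - 1 * y ord0 i).
pose v y := \prod_i F i y.
have v0 (y : 'rV[R]_d) i : r <= `|y ord0 i - x ord0 i| -> v y = 0.
  move=> ry; rewrite /v (bigD1 i)//= [F i y](_ : _ = 0) ?mul0r//.
  rewrite /F /exp_flat; case: ifPn => [h1|]; last by rewrite mul0r.
  case: ifPn => [h2|]; last by rewrite mulr0.
  by move: ry; rewrite leNgt ltr_norml => /negP[]; apply/andP; split; lra.
exists v; split => //.
- split.
    apply: smooth_gen_smooth; apply: smooth_gen_prod => i.
    by apply: (@gen_mul _ _ (fun y : 'rV[R]_d => exp_flat 0 ((r - x ord0 i) + 1 * y ord0 i))
      (fun y : 'rV[R]_d => exp_flat 0 ((r + x ord0 i) + - 1 * y ord0 i))); exact: gen_flat.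
  exists [set y : 'rV[R]_d | forall i, `[x ord0 i - r, x ord0 i + r]%classic (y ord0 i)].
    split; first by apply: (@rV_compact _ _ (fun i => `[x ord0 i - r, x ord0 i + r]%classic)) => i; exact: segment_compact.
    move=> y yK; apply: xO => i; have := yK i; rewrite /= in_itv /= => /andP[h1 h2].
    by rewrite ler_norml; apply/andP; split; lra.
  move=> y /existsNP[i]; rewrite /= in_itv /= => /negP yi; apply: (v0 y i).
  rewrite leNgt; apply/negP; rewrite ltr_norml => /andP[h1 h2]; move/negP: yi; apply.
  by apply/andP; split; lra.
- apply/prodf_neq0 => i _; rewrite /F /exp_flat ifT; last by lra.
  by rewrite ifT ?expr0 ?mul1r ?mulf_neq0// ?gt_eqF ?expR_gt0//; lra.
Qed.

End bump.

(** * Diffeomorphic images, and test functions moved by an isometry *)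

Section regular_domain.
Context (R : realType) (d : nat).
Implicit Types (D Omega : set 'rV[R]_d).

Lemma coord_continuous_fun (f : 'rV[R]_d -> 'rV[R]_d) :
  (forall j, continuous (coord_fun f j)) -> continuous f.
Proof.
move=> cf.
have -> : f = (fun x => \sum_j coord_fun f j x *: basis_vec R j).
  by apply/funext => x; exact: row_basis_sum.
suff cF (F : set_system 'rV[R]_d) (FF : Filter F) (x : 'rV[R]_d) : F --> x ->
    (fun y => \sum_j coord_fun f j y *: basis_vec R j) @ F -->
    \sum_j coord_fun f j x *: basis_vec R j.
  by move=> x; apply: (cF (nbhs x)).
move=> Fx; apply: cvg_big => [|j _]; first exact: add_continuous.
by apply: cvgZr_tmp; exact: (cvg_comp _ _ Fx (cf j x)).
Qed.

Lemma Ck_map_continuous m (f : 'rV[R]_d -> 'rV[R]_d) : Ck_map m setT f ->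
  forall j, continuous (coord_fun f j).
Proof. by move=> Cf j x; have [] := Cf j [::] isT x I. Qed.

Lemma diffeo_image_open m D Omega : open D -> diffeo_images m D Omega -> open Omega.
Proof.
move=> oD [f [[g [[_ _ Cf Cg] [_ _ fK gK]]] _] <-].
rewrite (_ : f @` D = g @^-1` D).
  have : continuous g by apply: coord_continuous_fun; exact: Ck_map_continuous Cg.
  by move/continuousP; apply.
apply/seteqP; split => [_ [x Dx <-]|x Dgx] /=; first by rewrite fK// inE.
by exists (g x) => //; rewrite gK// inE.
Qed.

(** [D] lies in a closed cube, and the continuous coordinates of [f] are bounded on that compact
    set. *)
Lemma diffeo_image_bounded m D Omega : bounded_set D -> diffeo_images m D Omega ->
  exists2 L : R, 0 < L & forall x, Omega x -> forall i, `|x ord0 i| < L.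
Proof.
move=> bD [f [[g [[_ _ Cf _] _]] _] <-].
have [M [_ MD]] := bD.
have {}MD : forall x, D x -> `|x| <= M + 1 by apply: MD; rewrite ltrDl.
pose K : set 'rV[R]_d := [set x | forall i, `[- (M + 2), M + 2]%classic (x ord0 i)].
have cK : compact K by apply: (@rV_compact _ _ (fun=> `[- (M + 2), M + 2]%classic)) => i; exact: segment_compact.
have DK x : D x -> K x.
  move=> /MD xM i; have M2 : 0 < M + 2 by apply: le_lt_trans (le_trans (normr_ge0 x) xM) _; lra.
  have : ball (0 : 'rV[R]_d) (M + 2) x.
    by rewrite -ball_normE /= sub0r normrN; apply: le_lt_trans xM _; lra.
  move=> /(rV_ballE _ _ M2)/(_ i); rewrite mxE sub0r normrN => /ltW.
  by rewrite /= in_itv /= -ler_norml.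
have /choice[B BP] j : exists B : R, forall x, K x -> `|coord_fun f j x| <= B.
  have : compact (coord_fun f j @` K).
    apply: continuous_compact cK; apply: continuous_subspaceT.
    exact: Ck_map_continuous Cf j.
  move=> /compact_bounded[B [_ /(_ (B + 1))]]; rewrite ltrDl ltr01 => /(_ isT) h.
  by exists (B + 1) => x Kx; apply: (h (coord_fun f j x)); exists x.
exists (1 + \sum_j `|B j|); first by rewrite ltr_pwDl// sumr_ge0.
move=> _ [x Dx <-] i; apply: le_lt_trans (BP i x (DK x Dx)) _.
rewrite (bigD1 i)//= addrCA; apply: le_lt_trans (ler_norm _) _.
by rewrite ltrDl ltr_pwDl// sumr_ge0.
Qed.

(** An affine map is determined on any open set: comparing [x0] with [x0 + (e / 2) e_i], both fixed,
    yields row [i] of the linear part. *)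
Lemma isometry_id_on Omega (S : Defs.isometry R d) (x0 : 'rV[R]_d) : open Omega -> Omega x0 ->
  (forall x, Omega x -> isometry_fun S x = x) -> S = 1%g.
Proof.
move=> oO Ox0 SO.
have /nbhs_ballP[e /= e0 eO] : nbhs x0 Omega by apply: open_nbhs_nbhs.
have A1 : (val S).1^T = 1%:M.
  apply/row_matrixP => i; rewrite row1 rowE.
  pose x := x0 + (e / 2) *: delta_mx ord0 i.
  have Ox : Omega x.
    apply: eO; apply/rV_ballE => // j; rewrite /x !mxE opprD addrA subrr sub0r normrN normrM.
    rewrite (gtr0_norm (divr_gt0 e0 _))//; case: (_ && _); rewrite ?normr1 ?normr0 ?mulr0// mulr1.
    by rewrite ltr_pdivrMr// ltr_pMr// ltr1n.
  have := SO x Ox; have := SO x0 Ox0; rewrite !isometry_funE /x mulmxDl -scalemxAl => h1.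
  rewrite addrAC h1 => /addrI /(congr1 (fun y => (e / 2)^-1 *: y)).
  by rewrite !scalerA mulVf ?scale1r// gt_eqF// divr_gt0.
have c0 : (val S).2 = 0.
  by have := SO x0 Ox0; rewrite isometry_funE A1 mulmx1 => /(canRL (addKr _)); rewrite addNr.
apply: val_inj => /=; rewrite [LHS]surjective_pairing; congr pair => //.
by rewrite -[LHS]trmxK [X in X^T]A1 trmx1.
Qed.

Lemma noninvariant_test Omega (S : Defs.isometry R d) (L : R) : open Omega ->
  (forall x, Omega x -> forall i, `|x ord0 i| < L) -> symmetry Omega S ->
  (exists2 x, Omega x & isometry_fun S x <> x) ->
  exists2 v, test_function Omega v & ip Omega (coboundary S v) (coboundary S v) != 0.
Proof.
move=> oO bO SO [x Ox Sx].
have [i ix] : exists i, isometry_fun S x ord0 i != x ord0 i.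
  apply/not_existsP => h; apply: Sx; apply/rowP => i.
  by apply/eqP/negPn/negP => hi; apply: (h i).
have /nbhs_ballP[e /= e0 eO] : nbhs x Omega by apply: open_nbhs_nbhs.
(* The first bound keeps the support inside [Omega], the second puts [S x] where the bump
   vanishes. *)
pose r := Num.min (e / 2) `|isometry_fun S x ord0 i - x ord0 i|.
have r0 : 0 < r by rewrite lt_min divr_gt0//= normr_gt0 subr_eq0.
have re : r <= e / 2 by rewrite ge_min lexx.
have rO (y : 'rV[R]_d) : (forall j, `|y ord0 j - x ord0 j| <= r) -> Omega y.
  move=> yr; apply: eO; apply/rV_ballE => // j; rewrite distrC.
  by apply: le_lt_trans (yr j) _; lra.
have [v [tv vx v0]] := test_bump oO r0 rO.
exists v => //; apply/eqP => /(ip_eq0 (open_measurable_rV oO)) h.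
have tc := test_coboundary SO tv.
have := h (test_L2 oO bO tc); apply: (continuous_not_ae0 oO Ox).
  exact: (test_continuous tc).
rewrite /coboundary (v0 (isometry_fun S x) i) ?subr0//.
by rewrite ge_min lexx orbT.
Qed.

End regular_domain.

(** * The sign homomorphism *)

Section simple_spectrum.
Context (R : realType) (d : nat) (Omega : set 'rV[R]_d).
Hypothesis d0 : (0 < d)%N.
Hypothesis oO : open Omega.
Variable L : R.
Hypothesis L0 : 0 < L.
Hypothesis bO : forall x, Omega x -> forall i, `|x ord0 i| < L.
Hypothesis simple : forall n, simple_eigenvalue Omega (lambda Omega n).
Local Notation mu := (lebesgue_rV R d).
Local Notation L2 := (L2 Omega).
Local Notation ip := (ip Omega).
Local Notation eigen := (Defs.eigenspace Omega).
Local Notation aeq := (ae_eq_on Omega).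
Implicit Types (u v phi : 'rV[R]_d -> R) (S T : Iso Omega).

Let mO : measurable Omega := open_measurable_rV oO.

(* Zero is not an eigenvalue; this matters because [lambda Omega] would be the
   junk sequence [fun=> 0] if no listing of the eigenvalues existed. *)
Lemma eigenspace0 u : eigen 0 u -> ip u u = 0.
Proof.
move=> /(eigenspaceE oO bO)[g [uL gL [v [tv vu vg]]] ug].
have vL k : L2 (v k) by exact: (test_L2 oO bO).
have dvL k i : L2 (partial i (v k)) by apply: (test_L2 oO bO); exact: test_partial.
have h1 : (fun k => energy Omega (v k)) @ \oo --> grad_ip Omega g g.
  apply: cvg_big => [|i _]; first exact: add_continuous.
  exact: (L2_cvg_ip mO (dvL^~ i) (gL i) (dvL^~ i) (gL i)).
have h2 : (fun k => grad_ip Omega g (fun i => partial i (v k))) @ \oo --> grad_ip Omega g g.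
  apply: cvg_big => [|i _]; first exact: add_continuous.
  exact: (L2_cvg_ip mO (fun=> gL i) (gL i) (dvL^~ i) (gL i) (L2_cvg_cst mO _)).
have gg : grad_ip Omega g g = 0.
  rewrite -(cvg_lim _ h2)//.
  rewrite (_ : (fun k => _) = cst 0) ?lim_cst//.
  by apply/funext => k; rewrite ug// mul0r.
have h3 := L2_cvg_ip mO vL uL vL uL vu vu.
apply/eqP; rewrite eq_le ip_ge0 andbT.
have h4 : (fun k => d%:R * (2 * L) ^+ 2 * energy Omega (v k)) @ \oo --> (0 : R).
  by rewrite -(mulr0 (d%:R * (2 * L) ^+ 2)) -gg; exact: cvgMr.
apply: (ler_cvg_to h3 h4); apply: nearW => k.
exact: (Poincare oO bO d0 (tv k)).
Qed.

Lemma multiplicity_ge1P t : multiplicity_ge Omega t 1 <-> exists2 u, eigen t u & ip u u != 0.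
Proof.
split=> [[u [ut ul]]|[u ut u0]].
  exists (u ord0) => //; apply/eqP => /(ip_eq0 mO (eigenspace_L2 oO bO (ut ord0))) u0.
  have /(_ (fun=> 1)) := ul.
  have h : aeq (fun x => \sum_(i < 1) 1 * u i x) (fun=> 0).
    by apply: filterS u0 => x h Ox; rewrite big_ord1 mul1r h.
  by move=> /(_ h ord0)/eqP; rewrite oner_eq0.
exists (fun=> u); split => // c cu i; rewrite (ord1 i).
apply/eqP/negPn/negP => c0; move/eqP: u0; apply.
have uL := eigenspace_L2 oO bO ut.
have h : aeq u (fun=> 0).
  apply: filterS cu => x h Ox; have := h Ox; rewrite big_ord1 => /eqP.
  by rewrite mulf_eq0 (negbTE c0) => /eqP.
rewrite (ae_eq_ip mO uL (L2_0 Omega) uL h) /ip.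
by under eq_Rintegral do rewrite mul0r; rewrite Rintegral_cst// mul0r.
Qed.

(** Without a listing, [lambda] would be constantly 0, and [simple] would make 0 an eigenvalue. *)
Lemma lambda_listing : eigenvalue_listing Omega (lambda Omega).
Proof.
have [ex|nex] := pselect (exists lam, eigenvalue_listing Omega lam).
  by rewrite /lambda; exact: xgetPex.
have l0 : lambda Omega = (fun=> 0).
  by rewrite /lambda; apply: xgetPN => lam hlam; apply: nex; exists lam.
have [] := simple 0%N; rewrite l0 => /multiplicity_ge1P[u ut].
by rewrite eigenspace0// eqxx.
Qed.

Lemma eigenvalue_lambda t u : eigen t u -> ip u u != 0 -> exists n, lambda Omega n = t.
Proof.
move=> ut u0; have [_ /(_ t 1%N)[+ _]] := lambda_listing.
have h : multiplicity_ge Omega t 1 by apply/multiplicity_ge1P; exists u.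
move=> /(_ h) h1; apply/not_existsP => h2.
have := h1; rewrite (_ : [set n | lambda Omega n = t] = set0); last first.
  by apply/seteqP; split => n //= hn; case: (h2 n hn).
by move=> /card_le0P/seteqP[/(_ 0%N isT)].
Qed.

Lemma eigenspace_normalize t u : eigen t u -> ip u u != 0 ->
  normalized_eigenfunction Omega t (fun x => (Num.sqrt (ip u u))^-1 * u x).
Proof.
move=> ut u0; split; first exact: (eigenspaceZ oO bO).
have uL := eigenspace_L2 oO bO ut.
have := ip_sqrZ mO (Num.sqrt (ip u u))^-1 uL.
rewrite exprVn sqr_sqrtr ?ip_ge0// mulVf// => <-.
Qed.

Lemma normalized_ip t phi : normalized_eigenfunction Omega t phi -> L2 phi /\ ip phi phi = 1.
Proof.
move=> [ut nu]; split; first exact: (eigenspace_L2 oO bO ut).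
by rewrite -nu; apply: eq_Rintegral => x _; rewrite expr2.
Qed.

Lemma normalized_exists n : exists phi, normalized_eigenfunction Omega (lambda Omega n) phi.
Proof.
have [/multiplicity_ge1P[u ut u0] _] := simple n.
by exists (fun x => (Num.sqrt (ip u u))^-1 * u x); exact: eigenspace_normalize.
Qed.

(** As [multiplicity_ge] fails for 2, the pair is dependent; the normalizations then force the
    factor to have square 1. *)
Lemma normalized_sign n phi psi : normalized_eigenfunction Omega (lambda Omega n) phi ->
  normalized_eigenfunction Omega (lambda Omega n) psi ->
  exists s : R, (s = 1 \/ s = -1) /\ aeq psi (fun x => s * phi x).
Proof.
move=> nphi npsi; have [phiL phi1] := normalized_ip nphi.
have [psiL psi1] := normalized_ip npsi.
have [_ nm2] := simple n.
pose f (i : 'I_2) := if i == ord0 then phi else psi.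
have : ~ lin_indep Omega f.
  move=> fl; apply: nm2; exists f; split => // i; rewrite /f.
  by case: ifP => _; [case: nphi|case: npsi].
move=> /existsNP[c /not_implyP[cf /existsNP[i ci]]].
have {}cf : aeq (fun x => c ord0 * phi x + c ord_max * psi x) (fun=> 0).
  apply: filterS cf => x h Ox; rewrite -(h Ox) big_ord_recl big_ord1 /f /=.
  by congr (_ + c _ * _); apply/val_inj.
(* Otherwise the relation says that [phi] is zero almost everywhere, against its norm being 1. *)
have c1 : c ord_max != 0.
  apply/eqP => c1; rewrite c1 in cf.
  have c00 : c ord0 != 0.
    apply/eqP => c00; apply: ci; have [->//|] := eqVneq i ord0; move=> i0.
    by rewrite (_ : i = ord_max)//; apply/val_inj; case: i {cf c1 c00} i0 => [[|[|k]]] ?.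
  have phi0 : aeq phi (fun=> 0).
    apply: filterS cf => x h Ox; have := h Ox; rewrite mul0r addr0 => /eqP.
    by rewrite mulf_eq0 (negbTE c00) => /eqP.
  move: phi1; rewrite (ae_eq_ip mO phiL (L2_0 Omega) phiL phi0) /ip.
  under eq_Rintegral do rewrite mul0r; rewrite Rintegral_cst// mul0r => /esym/eqP.
  by rewrite oner_eq0.
pose s := - (c ord0 / c ord_max).
have psis : aeq psi (fun x => s * phi x).
  apply: filterS cf => x h Ox; have := h Ox => {}h.
  by apply: (mulfI c1); rewrite /s; move/eqP: h; rewrite addrC addr_eq0 => /eqP ->; field.
have sphiL := L2Z mO s phiL.
have s2 : s ^+ 2 = 1.
  have := ip_sqrZ mO s phiL; rewrite phi1 mulr1 => <-.
  rewrite -(ae_eq_ip mO psiL sphiL sphiL psis) ipC.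
  by rewrite -(ae_eq_ip mO psiL sphiL psiL psis).
exists s; split => //; move/eqP: s2; rewrite sqrf_eq1 => /orP[]/eqP; by [left|right].
Qed.

Lemma Iso_symmetry S : symmetry Omega (val S).
Proof.
have SO : isometry_fun (val S) @` Omega = Omega by exact/asboolP/(valP S).
move: SO => /seteqP[SO OS] x; split => Ox; last by apply: SO; exists x.
by have [y Oy /(can_inj (isometry_funK (val S))) <-] := OS _ Ox.
Qed.

Lemma normalized_isometry S t phi : normalized_eigenfunction Omega t phi ->
  normalized_eigenfunction Omega t (phi \o Iso_fun S).
Proof.
move=> nphi; have [phiL phi1] := normalized_ip nphi; case: nphi => ephi _; split.
  exact: (eigenspace_isometry oO bO (Iso_symmetry S)).
rewrite -phi1 -(ip_isometry oO (Iso_symmetry S) phiL phiL).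
by apply: eq_Rintegral => x _; rewrite expr2.
Qed.

(** [is_sign] quantifies over all normalized eigenfunctions; the sign found for one serves for all,
    since the others are scalar multiples of it. *)
Lemma is_sign_exists S n : exists s, is_sign S n s.
Proof.
have [phi nphi] := normalized_exists n.
have [s [s1 sphi]] := normalized_sign nphi (normalized_isometry S nphi).
exists s; split => // psi npsi.
have [s' [_ psis]] := normalized_sign nphi npsi.
have psiS := ae_domain_isometry (Iso_symmetry S) psis.
apply: filterS3 psis psiS sphi => x h1 h2 h3 Ox.
by rewrite /= (h2 Ox) (h1 Ox); have /= -> := h3 Ox; ring.
Qed.

Lemma is_sign_eps S n : is_sign S n (eps S n).
Proof. by rewrite /eps; apply: xgetPex; exact: is_sign_exists. Qed.

Lemma is_sign_inj S n s s' : is_sign S n s -> is_sign S n s' -> s = s'.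
Proof.
move=> [_ hs] [_ hs']; have [phi nphi] := normalized_exists n.
have [phiL phi1] := normalized_ip nphi.
have h : aeq (fun x => s * phi x) (fun x => s' * phi x).
  apply: filterS2 (hs _ nphi) (hs' _ nphi) => x h1 h2 Ox.
  by rewrite -(h1 Ox) -(h2 Ox).
have := ae_eq_ip mO (L2Z mO s phiL) (L2Z mO s' phiL) phiL h.
by rewrite !(ipZl mO)// phi1 !mulr1.
Qed.

Lemma eps_sign S n : eps S n = 1 \/ eps S n = -1.
Proof. by have [] := is_sign_eps S n. Qed.

Lemma eps1 n : eps (1%g : Iso Omega) n = 1.
Proof.
apply: is_sign_inj (is_sign_eps 1%g n) _; split; first by left.
move=> phi _; apply: nearW => x _.
by rewrite mul1r /= /Iso_fun isometry_fun1.
Qed.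

Lemma epsM S T n : eps (S * T)%g n = eps S n * eps T n.
Proof.
apply: is_sign_inj (is_sign_eps (S * T)%g n) _.
have [s1 hs] := is_sign_eps S n; have [t1 ht] := is_sign_eps T n.
split.
  by case: s1 t1 => -> [] ->; rewrite ?mulr1 ?mulrN1 ?mul1r ?opprK; [left|right|right|left].
move=> phi nphi.
have h1 := ae_domain_isometry (Iso_symmetry T) (hs _ nphi).
apply: filterS2 h1 (ht _ nphi) => x h2 h3 Ox.
rewrite -mulrA -(h3 Ox) -(h2 Ox) /= /Iso_fun.
by rewrite -isometry_funM.
Qed.

Lemma eps_trivial S : (forall n, eps S n = 1) -> S = 1%g.
Proof.
move=> S1; have SO := Iso_symmetry S.
have inv u t : eigen t u -> aeq (u \o Iso_fun S) u.
  move=> ut; have uL := eigenspace_L2 oO bO ut.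
  (* [eigen t] also contains functions vanishing almost everywhere; these cannot be normalized, so
     the signs say nothing about them. *)
  have [u0|u0] := eqVneq (ip u u) 0.
    have h := ip_eq0 mO uL u0; have hS := ae_domain_isometry SO h.
    by apply: filterS2 h hS => x h1 h2 Ox; rewrite /= (h1 Ox) (h2 Ox).
  have [n nt] := eigenvalue_lambda ut u0; rewrite -nt in ut.
  have [_ /(_ _ (eigenspace_normalize ut u0))] := is_sign_eps S n.
  apply: filterS => x h Ox; have /= := h Ox; rewrite S1 mul1r.
  have c0 : (Num.sqrt (ip u u))^-1 != 0.
    by rewrite invr_eq0 sqrtr_eq0 -ltNge lt_neqAle eq_sym u0 ip_ge0.
  by move/(mulfI c0).
have Sid x : Omega x -> isometry_fun (val S) x = x.
  move=> Ox; have [//|Sx] := pselect (isometry_fun (val S) x = x); exfalso.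
  have hv : exists2 v, test_function Omega v &
      ip (coboundary (val S) v) (coboundary (val S) v) != 0.
    by apply: (noninvariant_test oO bO SO); exists x.
  have [t [u [ut]]] := noninvariant_eigenfunction oO L0 bO SO hv.
  by apply; exact: (inv u t ut).
(* On an empty domain every isometry would act trivially; a normalized eigenfunction rules this
   out. *)
have [x0 Ox0] : exists x0, Omega x0.
  have [phi nphi] := normalized_exists 0%N; have [_ phi1] := normalized_ip nphi.
  apply/not_existsP => O0; have Oe : Omega = set0 by apply/seteqP; split => x // Ox; case: (O0 x Ox).
  by move: phi1; rewrite /ip Oe Rintegral_set0 => /esym/eqP; rewrite oner_eq0.
by apply: val_inj; exact: (isometry_id_on oO Ox0 Sid).
Qed.

Lemma eps_inj : injective (@eps R d Omega).
Proof.
move=> S T ST.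
have h : (S * T^-1)%g = 1%g.
  by apply: eps_trivial => n; rewrite epsM ST -epsM mulgV eps1.
by rewrite -[S]mulg1 -(mulVg T) mulgA h mul1g.
Qed.

Lemma IsoC S T : (S * T = T * S)%g.
Proof. by apply: eps_inj; apply/funext => n; rewrite !epsM mulrC. Qed.

Lemma Iso_sqr S : (S ^+ 2 = 1)%g.
Proof.
apply: eps_inj; apply/funext => n; rewrite expgS expg1 epsM eps1.
by case: (eps_sign S n) => ->; rewrite ?mulr1 ?mulrNN ?mulr1.
Qed.

End simple_spectrum.

(** * Elementary abelian 2-groups *)

Lemma addrr_Z2 k (v : 'rV['Z_2]_k) : v + v = 0.
Proof.
apply/rowP => i; rewrite !mxE; apply: val_inj => /=.
by case: (v ord0 i) => -[|[|//]].
Qed.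

Lemma commuting_involutions_dim (F : numFieldType) (n k : nat)
    (f : 'rV['Z_2]_k -> 'M[F]_n) : (0 < n)%N ->
  injective f -> f 0 = 1%:M -> (forall u v, f (u + v) = f u *m f v) -> (k <= n)%N.
Proof.
case: n f => // n f _ f_inj f0 fD.
have f2 v : f v *m f v = 1%:M by rewrite -fD addrr_Z2.
pose As := [seq f v | v : 'rV['Z_2]_k].
have fAs v : f v \in As by apply/mapP; exists v => //; rewrite mem_enum.
have /codiagonalizableP[P Pu /allP PAs] :
    {in As &, forall A B, comm_mx A B} /\ {in As, forall A, diagonalizable A}.
  split=> [_ _ /mapP[u _ ->] /mapP[v _ ->]|_ /mapP[v _ ->]].
    by rewrite /comm_mx -!fD addrC.
  (* Each [f v] is annihilated by [(X - 1) (X + 1)], which has distinct roots since 2 is invertible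
     in [F]. *)
  apply/diagonalizableP; exists [:: 1; -1].
    by rewrite /= inE andbT -subr_eq0 opprK -mulr2n pnatr_eq0.
  apply: mxminpoly_min; rewrite big_cons big_seq1 rmorphM !rmorphB/= horner_mx_X.
  rewrite !horner_mx_C rmorphN/= opprK mulrDr mulr1 mulrBl mul1r.
  by have /= -> : f v * f v = 1 := f2 v; rewrite addrC addrA subrK subrr.
have {}PAs v : exists D, P *m f v = diag_mx D *m P.
  have /(_ (fAs v))/diagonalizable_forPex[D PD] := PAs (f v).
  exists D; apply: simmxPp PD.
  by rewrite submx_full// row_full_unit.
have [D fP] := choice PAs.
have DP v : diag_mx (D v) = P *m f v *m invmx P by rewrite fP mulmxK.
have D2 v i : D v ord0 i = 1 \/ D v ord0 i = -1.
  have : diag_mx (D v) *m diag_mx (D v) = 1%:M.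
    by rewrite !DP !mulmxA mulmxKV// -(mulmxA P) f2 mulmx1 mulmxV.
  move=> /matrixP/(_ i i); rewrite mulmx_diag !mxE eqxx mulr1n => /eqP.
  by rewrite -expr2 sqrf_eq1 => /orP[]/eqP; [left|right].
pose h v : {ffun 'I_n.+1 -> bool} := [ffun i => D v ord0 i == 1].
have h_inj : injective h.
  move=> u v /ffunP uv; apply: f_inj.
  have Duv : D u = D v.
    apply/rowP => i; have := uv i; rewrite !ffunE.
    have N11 : (-1 == 1 :> F) = false.
      by rewrite eq_sym -subr_eq0 opprK -mulr2n pnatr_eq0.
    by case: (D2 u i) (D2 v i) => -> [] ->; rewrite ?eqxx ?N11.
  by apply: (can_inj (mulKmx Pu)); rewrite !fP Duv.
have := leq_card h h_inj.
by rewrite card_mx card_ffun card_bool !card_ord mul1n leq_exp2l.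
Qed.

(** A maximal embedded copy of [(Z/2)^k] is the whole group, since an element outside it would
    generate a larger copy. [bound] makes a maximal [k] exist, without finiteness of [G] being
    assumed. *)
Lemma exponent2_group_iso (G : groupType) (d : nat) :
  (forall x y : G, (x * y = y * x)%g) -> (forall x : G, (x ^+ 2 = 1)%g) ->
  (forall k (f : 'rV['Z_2]_k -> G), injective f ->
    (forall u v, f (u + v) = (f u * f v)%g) -> (k <= d)%N) ->
  exists2 k, (k <= d)%N & exists g : G -> 'rV['Z_2]_k,
    bijective g /\ forall x y, g (x * y)%g = g x + g y.
Proof.
move=> GC G2 bound.
pose embeds k := exists f : 'rV['Z_2]_k -> G,
  injective f /\ forall u v, f (u + v) = (f u * f v)%g.
have ex0 : exists k, `[< embeds k >].
  exists 0%N; apply/asboolP; exists (fun=> 1%g).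
  by split=> [u v _|u v]; [rewrite [u]thinmx0 [v]thinmx0|rewrite mulg1].
have bd k : `[< embeds k >] -> (k <= d)%N.
  by move=> /asboolP[f [f_inj fM]]; exact: bound f_inj fM.
case: (ex_maxnP ex0 bd) => k /asboolP[f [f_inj fM]] kmax.
exists k; first exact: bound f_inj fM.
have f1 : f 0 = 1%g by apply: (mulgI (f 0)); rewrite -fM addr0 mulg1.
have f_surj x : exists v, f v = x.
  apply/not_existsP => fx.
  suff /asboolP/kmax : embeds k.+1 by rewrite ltnn.
  rewrite -add1n.
  (* The homomorphism from [Z/2] that sends the generator to [x]; [f'] combines it with [f]. *)
  pose e (u : 'rV['Z_2]_1) : G := if u == 0 then 1%g else x.
  have Z2E (u : 'rV['Z_2]_1) : u = 0 \/ u = const_mx 1.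
    case E : (u ord0 ord0) => [[|[|//]] p]; [left|right];
      by apply/rowP => i; rewrite (ord1 i) E mxE; apply: val_inj.
  have c1 : (const_mx 1 == 0 :> 'rV['Z_2]_1) = false.
    by apply/negP => /eqP/rowP/(_ ord0)/eqP; rewrite !mxE oner_eq0.
  have eM u v : e (u + v) = (e u * e v)%g.
    rewrite /e; case: (Z2E u) (Z2E v) => -> [] ->.
    - by rewrite addr0 !eqxx mulg1.
    - by rewrite add0r eqxx c1 mul1g.
    - by rewrite addr0 eqxx c1 mulg1.
    - by rewrite addrr_Z2 eqxx c1 -(G2 x) expgS expg1.
  pose f' (w : 'rV['Z_2]_(1 + k)) := (e (lsubmx w) * f (rsubmx w))%g.
  have f'M u v : f' (u + v) = (f' u * f' v)%g.
    rewrite /f' !linearD/= eM fM -!mulgA; congr (_ * _)%g.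
    by rewrite !mulgA (GC (e _)).
  have f'1 w : f' w = 1%g -> w = 0.
    rewrite /f' /e => w1; have := w1; case: (Z2E (lsubmx w)) => l0; rewrite l0.
      rewrite eqxx mul1g -f1 => /f_inj r0.
      by rewrite -[w]hsubmxK l0 r0 row_mx0.
    (* A kernel element involving [x] would express [x] as the inverse of a value of [f], itself a
       value of [f]. *)
    rewrite c1 => xf; case: (fx (- rsubmx w)); apply: (mulIg (f (rsubmx w))).
    by rewrite -fM addNr f1 xf.
  exists f'; split => // u v uv.
  have : f' (u - v) = 1%g.
    rewrite -f1 f'M uv -f'M.
    by rewrite subrr /f' !linear0 /e eqxx mul1g.
  by move=> /f'1/eqP; rewrite subr_eq0 => /eqP.
have [g gK] := choice f_surj.
have fK : cancel f g by move=> v; apply: f_inj; rewrite gK.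
exists g; split; first by exists f.
by move=> x y; apply: f_inj; rewrite fM !gK.
Qed.

(** * The rank bound through linear parts *)

Section isometry_group.
Context (R : realType) (d : nat) (Omega : set 'rV[R]_d).
Implicit Types S T : Iso Omega.

Definition linear_part S : 'M[R]_d := (val (val S)).1.

Lemma linear_partM S T : linear_part (S * T)%g = linear_part S *m linear_part T.
Proof. by []. Qed.

Hypothesis Iso_sqr : forall S, (S ^+ 2 = 1)%g.

Lemma linear_part_inj : injective linear_part.
Proof.
have h1 S : linear_part S = 1%:M -> S = 1%g.
  move=> S1; have := Iso_sqr S; rewrite expgS expg1.
  move=> /(congr1 (fun S : Iso Omega => (val (val S)).2)) /= S2.
  apply: val_inj; apply: val_inj => /=; rewrite [LHS]surjective_pairing.
  congr pair; first exact: S1.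
  move: S2; rewrite [(sval (sval S)).1]S1 trmx1 mulmx1 => /eqP.
  by rewrite -mulr2n -scaler_nat scaler_eq0 pnatr_eq0 => /eqP.
(* [T] is its own inverse, so [S * T] has trivial linear part when [S] and [T] have the same one. *)
move=> S T ST; have TT : (T * T = 1)%g by rewrite -[RHS](Iso_sqr T) expgS expg1.
have : (S * T)%g = 1%g by apply: h1; rewrite linear_partM ST -linear_partM TT.
by rewrite -TT => /mulIg.
Qed.

Lemma Iso_rank k (f : 'rV['Z_2]_k -> Iso Omega) : (0 < d)%N -> injective f ->
  (forall u v, f (u + v) = (f u * f v)%g) -> (k <= d)%N.
Proof.
move=> d0 f_inj fM; apply: (@commuting_involutions_dim _ _ _ (linear_part \o f)) => //.
- by move=> u v /linear_part_inj/f_inj.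
- have f1 : f 0 = 1%g by apply: (mulgI (f 0)); rewrite -fM addr0 mulg1.
  by rewrite /= f1.
- by move=> u v; rewrite /= fM.
Qed.

End isometry_group.

Lemma card_le_Z2 (T : Type) k d (g : T -> 'rV['Z_2]_k) : (k <= d)%N ->
  injective g -> ([set: T] #<= `I_(2 ^ d))%card.
Proof.
move=> kd g_inj; apply: (@card_le_trans _ _ _ `I_#|'rV['Z_2]_k|).
  apply/pcard_leP; apply/injfunPex; exists (fun x => enum_rank (g x) : nat).
    by move=> x _ /=.
  by move=> x y _ _ /ord_inj/enum_rank_inj/g_inj.
by rewrite card_le_II card_mx card_ord mul1n leq_exp2l.
Qed.

Theorem proposition4p2 (R : realType) (d m : nat) (D Omega : set 'rV[R]_d) :
  (2 <= d)%N -> (3 <= m)%N ->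
  bounded_set D -> connected D -> Ck_open_set m D ->
  simple_domains m D Omega ->
  [/\ forall (S : Iso Omega) (n : nat), is_sign S n (eps S n),
      forall (S T : Iso Omega) (n : nat), eps (S * T)%g n = eps S n * eps T n &
      injective (@eps R d Omega)] /\
  [/\ forall S T : Iso Omega, (S * T = T * S)%g,
      forall S : Iso Omega, (S ^+ 2 = 1)%g,
      exists2 k : nat, (k <= d)%N &
        exists g : Iso Omega -> 'rV['Z_2]_k,
          bijective g /\ forall S T : Iso Omega, g (S * T)%g = g S + g T &
      ([set: Iso Omega] #<= `I_(2 ^ d))%card].

Proof.
move=> d2 m3 bD _ CD [dO simple].
have d0 : (0 < d)%N by exact: ltnW.
have oO := diffeo_image_open CD.1 dO.
have [L L0 bO] := diffeo_image_bounded bD dO.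
have IC := IsoC d0 oO L0 bO simple.
have I2 := Iso_sqr d0 oO L0 bO simple.
have [k kd [g [g_bij gM]]] := exponent2_group_iso IC I2
  (fun k f => @Iso_rank _ _ _ I2 k f d0).
split; split => //.
- exact: (is_sign_eps oO bO simple).
- exact: (epsM oO bO simple).
- exact: (eps_inj d0 oO L0 bO simple).
- by exists k => //; exists g.
- exact: (card_le_Z2 kd (bij_inj g_bij)).
Qed.
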